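(* Let $k$ be a field, $r\ge1$ an integer, and $B=k\langle x,y\rangle/(y^{r+1})$ with $\deg x=\deg y=1$. Let $Q$ be the quiver with vertices $1,\ldots,r+1$, arrows $x_i:i\to1$ for $1\le i\le r+1$, and arrows $y_i:i\to i+1$ for $1\le i\le r$, and let $f:B\to kQ$ be the (injective) algebra homomorphism with $f(x)=x_1+\cdots+x_{r+1}$ and $f(y)=y_1+\cdots+y_r$. The functor $kQ\otimes_B-$ induces an equivalence of categories $$F:\mathsf{QGr}(B)\to\mathsf{QGr}(kQ).$$ Furthermore, (1) $F$ restricts to an equivalence between $\mathsf{qgr}(B)$ and $\mathsf{qgr}(kQ)$; (2) $F(\mathcal{F}(1))\cong F(\mathcal{F})(1)$ for all $\mathcal{F}\in\mathsf{QGr}(B)$; (3) if $\mathcal{O}$ is used to denote both the image of ${}_BB$ in $\mathsf{QGr}(B)$ and the image of ${}_{kQ}kQ$ in $\mathsf{QGr}(kQ)$, then $F(\mathcal{O})=\mathcal{O}$.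
   Context: The path algebra $kQ$ is graded by path length, and for paths $p,q$ the product $pq$ means ''traverse $p$, then $q$'' (zero unless $p$ ends where $q$ starts). $kQ$ is a right $B$-module via $f$. For $D=B$ or $kQ$: $\mathsf{Gr}\,D$ is the category of $\mathbb{Z}$-graded left $D$-modules (degree-preserving maps), $\mathsf{Fdim}\,D$ its Serre subcategory of modules that are unions of their finite dimensional submodules, $\mathsf{QGr}\,D:=\mathsf{Gr}\,D/\mathsf{Fdim}\,D$; $\mathsf{gr}\,D\subset\mathsf{Gr}\,D$ is the full abelian subcategory of finitely presented modules, $\mathsf{fdim}\,D$ the subcategory of finite dimensional modules, and $\mathsf{qgr}\,D:=\mathsf{gr}\,D/\mathsf{fdim}\,D$, identified with the full subcategory of finitely presented objects in $\mathsf{QGr}\,D$. $\mathcal{F}\mapsto\mathcal{F}(1)$ is the autoequivalence induced by the degree shift $M(1)_i=M_{i+1}$. *)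

(* Defs.v *)
From HB Require Import structures.
From mathcomp Require Import all_boot all_algebra.
From mathcomp Require Import finmap boolp.
From mathcomp Require Import monalg.

Set Implicit Arguments.
Unset Strict Implicit.
Unset Printing Implicit Defensive.

Import GRing.Theory.
Local Open Scope quotient_scope.
Local Open Scope ring_scope.

(* Hom-sets carry an explicit equality [heq], so that the localization below
   can be built without quotienting its hom-types. *)
Record category := Category {
  obj :> Type;
  hom : obj -> obj -> Type;
  heq : forall X Y, hom X Y -> hom X Y -> Prop;
  idm : forall X, hom X X;
  comp : forall X Y Z, hom Y Z -> hom X Y -> hom X Z;
  heq_refl : forall X Y (f : hom X Y), heq f f;
  heq_sym : forall X Y (f g : hom X Y), heq f g -> heq g f;
  heq_trans : forall X Y (f g h : hom X Y), heq f g -> heq g h -> heq f h;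
  comp_heq : forall X Y Z (g g' : hom Y Z) (f f' : hom X Y),
    heq g g' -> heq f f' -> heq (comp g f) (comp g' f');
  comp_idl : forall X Y (f : hom X Y), heq (comp (idm Y) f) f;
  comp_idr : forall X Y (f : hom X Y), heq (comp f (idm X)) f;
  comp_assoc : forall X Y Z W (h : hom Z W) (g : hom Y Z) (f : hom X Y),
    heq (comp h (comp g f)) (comp (comp h g) f) }.

Arguments hom {c} X Y.
Arguments heq {c X Y} f g.
Arguments idm {c} X.
Arguments comp {c X Y Z} g f.

Record functor (C D : category) := Functor {
  fobj :> C -> D;
  fmap : forall X Y : C, hom X Y -> hom (fobj X) (fobj Y);
  fmap_heq : forall (X Y : C) (f g : hom X Y), heq f g -> heq (fmap f) (fmap g);
  fmap_id : forall X : C, heq (fmap (idm X)) (idm (fobj X));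
  fmap_comp : forall (X Y Z : C) (g : hom Y Z) (f : hom X Y),
    heq (fmap (comp g f)) (comp (fmap g) (fmap f)) }.

Definition id_functor (C : category) : functor C C.
Proof.
refine (@Functor C C (fun X => X) (fun _ _ f => f) _ _ _).
- by [].
- by move=> *; exact: heq_refl.
- by move=> *; exact: heq_refl.
Defined.

Definition comp_functor (C D E : category) (G : functor D E)
    (F : functor C D) : functor C E.
Proof.
refine (@Functor C E (fun X => G (F X)) (fun _ _ f => fmap G (fmap F f)) _ _ _).
- by move=> X Y f g fg; apply/fmap_heq/fmap_heq.
- move=> X; exact: (heq_trans (fmap_heq G (fmap_id F X)) (fmap_id G (F X))).
- move=> X Y Z g f; apply: (heq_trans (fmap_heq G (fmap_comp F g f))).
  exact: fmap_comp.
Defined.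

Definition is_iso (C : category) (X Y : C) (f : hom X Y) : Prop :=
  exists g : hom Y X, heq (comp g f) (idm X) /\ heq (comp f g) (idm Y).

Definition isomorphic (C : category) (X Y : C) : Prop :=
  exists f : hom X Y, is_iso f.

Definition nat_iso (C D : category) (F G : functor C D) : Prop :=
  exists eta : forall X : C, hom (F X) (G X),
    (forall X, is_iso (eta X)) /\
    (forall (X Y : C) (f : hom X Y),
       heq (comp (fmap G f) (eta X)) (comp (eta Y) (fmap F f))).

Definition is_equivalence (C D : category) (F : functor C D) : Prop :=
  exists G : functor D C,
    nat_iso (comp_functor G F) (id_functor C) /\
    nat_iso (comp_functor F G) (id_functor D).

Section FullSubcategory.
Variables (C : category) (P : C -> Prop).

Definition full_sub : category.
Proof.
refine (@Category {X : C | P X} (fun X Y => hom (sval X) (sval Y))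
    (fun _ _ f g => heq f g) (fun X => idm (sval X))
    (fun _ _ _ g f => comp g f) _ _ _ _ _ _ _).
- by move=> *; exact: heq_refl.
- by move=> *; exact: heq_sym.
- by move=> X Y f g h; exact: heq_trans.
- by move=> *; exact: comp_heq.
- by move=> *; exact: comp_idl.
- by move=> *; exact: comp_idr.
- by move=> *; exact: comp_assoc.
Defined.

Definition full_incl : functor full_sub C.
Proof.
refine (@Functor full_sub C (fun X => sval X) (fun _ _ f => f) _ _ _).
- by [].
- by move=> *; exact: heq_refl.
- by move=> *; exact: heq_refl.
Defined.

End FullSubcategory.

(* [S]^-1 C : morphisms are formal composites of morphisms of [C] and of formal
   inverses of the morphisms in [S], modulo the least congruence that makes
   C -> [S]^-1 C a functor and the formal inverses genuine inverses. *)
Section Localization.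
Variables (C : category) (S : forall X Y : C, hom X Y -> Prop).

Inductive loc_hom : C -> C -> Type :=
| loc_fwd X Y of hom X Y : loc_hom X Y
| loc_inv X Y (s : hom X Y) of S s : loc_hom Y X
| loc_comp X Y Z of loc_hom Y Z & loc_hom X Y : loc_hom X Z.

Inductive loc_eq : forall X Y : C, loc_hom X Y -> loc_hom X Y -> Prop :=
| loc_refl X Y (f : loc_hom X Y) : loc_eq f f
| loc_sym X Y (f g : loc_hom X Y) : loc_eq f g -> loc_eq g f
| loc_trans X Y (f g h : loc_hom X Y) : loc_eq f g -> loc_eq g h -> loc_eq f h
| loc_congr X Y Z (g g' : loc_hom Y Z) (f f' : loc_hom X Y) :
    loc_eq g g' -> loc_eq f f' -> loc_eq (loc_comp g f) (loc_comp g' f')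
| loc_assoc X Y Z W (h : loc_hom Z W) (g : loc_hom Y Z) (f : loc_hom X Y) :
    loc_eq (loc_comp h (loc_comp g f)) (loc_comp (loc_comp h g) f)
| loc_idl X Y (f : loc_hom X Y) : loc_eq (loc_comp (loc_fwd (idm Y)) f) f
| loc_idr X Y (f : loc_hom X Y) : loc_eq (loc_comp f (loc_fwd (idm X))) f
| loc_fwd_heq X Y (f g : hom X Y) : heq f g -> loc_eq (loc_fwd f) (loc_fwd g)
| loc_fwd_comp X Y Z (g : hom Y Z) (f : hom X Y) :
    loc_eq (loc_fwd (comp g f)) (loc_comp (loc_fwd g) (loc_fwd f))
| loc_invl X Y (s : hom X Y) (Ss : S s) :
    loc_eq (loc_comp (loc_inv Ss) (loc_fwd s)) (loc_fwd (idm X))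
| loc_invr X Y (s : hom X Y) (Ss : S s) :
    loc_eq (loc_comp (loc_fwd s) (loc_inv Ss)) (loc_fwd (idm Y)).

Definition localization : category :=
  @Category C loc_hom loc_eq (fun X => loc_fwd (idm X)) loc_comp
    loc_refl loc_sym loc_trans loc_congr loc_idl loc_idr loc_assoc.

Definition loc_functor : functor C localization :=
  @Functor C localization (fun X => X) loc_fwd loc_fwd_heq
    (fun X => loc_refl _) loc_fwd_comp.

End Localization.

Section LocalizationMap.
Variables (C D : category) (S : forall X Y : C, hom X Y -> Prop).
Variables (T : forall X Y : D, hom X Y -> Prop) (F : functor C D).
Hypothesis FS : forall (X Y : C) (s : hom X Y), S s -> T (fmap F s).

Fixpoint loc_fmap (X Y : C) (f : loc_hom S X Y) : loc_hom T (F X) (F Y) :=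
  match f with
  | loc_fwd _ _ f => loc_fwd T (fmap F f)
  | loc_inv _ _ _ Ss => loc_inv (FS Ss)
  | loc_comp _ _ _ g f => loc_comp (loc_fmap g) (loc_fmap f)
  end.

Lemma loc_fmap_eq (X Y : C) (f g : loc_hom S X Y) :
  loc_eq f g -> loc_eq (loc_fmap f) (loc_fmap g).
Proof.
elim=> {X Y f g} /=.
- by move=> *; exact: loc_refl.
- by move=> *; exact: loc_sym.
- by move=> X Y f g h _ fg _ gh; exact: loc_trans fg gh.
- by move=> *; exact: loc_congr.
- by move=> *; exact: loc_assoc.
- move=> X Y f; apply: loc_trans (loc_idl _).
  by apply: loc_congr (loc_refl _); apply/loc_fwd_heq/fmap_id.
- move=> X Y f; apply: loc_trans (loc_idr _).
  by apply: loc_congr; [exact: loc_refl | apply/loc_fwd_heq/fmap_id].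
- by move=> *; apply/loc_fwd_heq/fmap_heq.
- move=> X Y Z g f; apply: loc_trans (loc_fwd_comp _ _ _).
  exact/loc_fwd_heq/fmap_comp.
- move=> X Y s Ss; apply: loc_trans (loc_invl _) _.
  exact/loc_fwd_heq/heq_sym/fmap_id.
- move=> X Y s Ss; apply: loc_trans (loc_invr _) _.
  exact/loc_fwd_heq/heq_sym/fmap_id.
Qed.

Definition loc_map : functor (localization S) (localization T) :=
  @Functor (localization S) (localization T) F loc_fmap loc_fmap_eq
    (fun X => loc_fwd_heq _ (fmap_id F X)) (fun _ _ _ _ _ => loc_refl _).

End LocalizationMap.

(* [X] is finitely presented when Hom(X, -) commutes with direct limits. *)
Section FinitelyPresentedObject.
Variable C : category.

Record direct_system := DirectSystem {
  dindex : Type;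
  dle : dindex -> dindex -> Prop;
  dle_refl : forall i, dle i i;
  dle_trans : forall i j l, dle i j -> dle j l -> dle i l;
  dinhabited : inhabited dindex;
  dle_directed : forall i j, exists l, dle i l /\ dle j l;
  dobj : dindex -> C;
  dmap : forall i j, dle i j -> hom (dobj i) (dobj j);
  dmap_id : forall i (ii : dle i i), heq (dmap ii) (idm (dobj i));
  dmap_comp : forall i j l (ij : dle i j) (jl : dle j l) (il : dle i l),
    heq (dmap il) (comp (dmap jl) (dmap ij)) }.

Arguments dobj : clear implicits.
Arguments dmap : clear implicits.

Definition is_cocone (Y : direct_system) (L : C)
    (c : forall i, hom (dobj Y i) L) : Prop :=
  forall i j (ij : dle i j), heq (comp (c j) (dmap Y i j ij)) (c i).

Definition is_direct_limit (Y : direct_system) (L : C)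
    (c : forall i, hom (dobj Y i) L) : Prop :=
  is_cocone c /\
  forall (Z : C) (d : forall i, hom (dobj Y i) Z), is_cocone d ->
    exists u : hom L Z, (forall i, heq (comp u (c i)) (d i)) /\
      forall v : hom L Z, (forall i, heq (comp v (c i)) (d i)) -> heq v u.

Definition fp_object (X : C) : Prop :=
  forall (Y : direct_system) (L : C) (c : forall i, hom (dobj Y i) L),
    is_direct_limit c ->
    (forall h : hom X L, exists i (g : hom X (dobj Y i)), heq (comp (c i) g) h)
    /\
    (forall i (g g' : hom X (dobj Y i)), heq (comp (c i) g) (comp (c i) g') ->
       exists j (ij : dle i j), heq (comp (dmap Y i j ij) g) (comp (dmap Y i j ij) g')).

End FinitelyPresentedObject.

Section MorphB.
Variables (U V : zmodType) (g : U -> V).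
Hypothesis gB : {morph g : x y / x - y}.

Lemma morphB0 : g 0 = 0.
Proof. by rewrite -[X in g X](subrr 0) gB subrr. Qed.

Lemma morphBD : {morph g : x y / x + y}.
Proof.
move=> x y; have gN z : g (- z) = - g z.
  by rewrite -[- z]add0r gB morphB0 add0r.
by rewrite -[y in LHS]opprK gB gN opprK.
Qed.
End MorphB.

(* A Z-grading V = \bigoplus_i V_i, given by its homogeneous components:
   [part i v] is the component of [v] in V_i, and V_i = [homog i]. *)
Record grading (V : zmodType) := Grading {
  part : int -> V -> V;
  partB : forall i, {morph part i : u v / u - v};
  partK : forall i j v, part i (part j v) = if i == j then part j v else 0;
  part_sum : forall v,
    exists2 s : seq int, uniq s & v = \sum_(i <- s) part i v }.

Definition homog (V : zmodType) (G : grading V) (i : int) (v : V) : Prop :=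
  part G i v = v.

Section GradingTheory.
Variables (V : zmodType) (p : int -> V -> V).
Hypothesis pB : forall i, {morph p i : u v / u - v}.
Hypothesis pK : forall i j v, p i (p j v) = if i == j then p j v else 0.

Definition decomposed v := exists2 s, uniq s &
     forall s', uniq s' -> {subset s <= s'} -> v = \sum_(i <- s') p i v.

Lemma decomposedW v :
  decomposed v -> exists2 s : seq int, uniq s & v = \sum_(i <- s) p i v.
Proof. by case=> s us Hs; exists s => //; apply: Hs. Qed.

Lemma decomposed0 : decomposed 0.
Proof.
by exists [::] => // s' _ _; rewrite big1 // => i _; rewrite (morphB0 (pB i)).
Qed.

Lemma decomposedB u v : decomposed u -> decomposed v -> decomposed (u - v).
Proof.
move=> [s us Hs] [t ut Ht]; exists (undup (s ++ t)); first exact: undup_uniq.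
move=> s' us' sub; under eq_bigr do rewrite pB.
rewrite sumrB -Hs // -?Ht //.
  by move=> x xt; apply: sub; rewrite mem_undup mem_cat xt orbT.
by move=> x xs; apply: sub; rewrite mem_undup mem_cat xs.
Qed.

Lemma decomposedD u v : decomposed u -> decomposed v -> decomposed (u + v).
Proof.
move=> du dv; rewrite -[v]opprK; apply: decomposedB => //.
by rewrite -[- v]add0r; apply: decomposedB => //; exact: decomposed0.
Qed.

Lemma decomposed_bigsum (I : Type) (s : seq I) (F : I -> V) :
  (forall i, decomposed (F i)) -> decomposed (\sum_(i <- s) F i).
Proof.
by move=> H; apply: big_ind => //; [exact: decomposed0 | exact: decomposedD].
Qed.

Lemma decomposed_homog i v : p i v = v -> decomposed v.
Proof.
move=> pv; exists [:: i] => // s' us' /(_ i (mem_head _ _)) is'.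
rewrite (bigD1_seq i) //= pv big1 ?addr0 // => j ji.
by rewrite -pv pK (negPf ji).
Qed.
End GradingTheory.

Section GradingTheory2.
Variables (V : zmodType) (G : grading V).

Lemma part0 i : part G i 0 = 0.
Proof. exact: (morphB0 (partB G i)). Qed.

Lemma partD i : {morph part G i : u v / u + v}.
Proof. exact: (morphBD (partB G i)). Qed.

Lemma part_bigsum i (I : Type) (s : seq I) (P : pred I) (F : I -> V) :
  part G i (\sum_(j <- s | P j) F j) = \sum_(j <- s | P j) part G i (F j).
Proof. by apply: big_morph; [exact: partD | exact: part0]. Qed.

Lemma homog_part i v : homog G i (part G i v).
Proof. by rewrite /homog partK eqxx. Qed.

Lemma part_homog i j v : homog G j v -> part G i v = if i == j then v else 0.
Proof. by move=> hv; rewrite -{1}hv partK hv. Qed.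

Lemma part_notin s i v : v = \sum_(j <- s) part G j v -> i \notin s ->
  part G i v = 0.
Proof.
move=> -> nis; rewrite part_bigsum big_seq big1 // => j js.
by rewrite partK; case: eqP => // ij; rewrite ij js in nis.
Qed.

Definition gsupp v : seq int := s2val (cid2 (part_sum G v)).

Lemma gsupp_uniq v : uniq (gsupp v).
Proof. exact: (s2valP (cid2 (part_sum G v))). Qed.

Lemma gsupp_sum v : v = \sum_(i <- gsupp v) part G i v.
Proof. exact: (s2valP' (cid2 (part_sum G v))). Qed.

Lemma gsupp_notin v i : i \notin gsupp v -> part G i v = 0.
Proof. exact/part_notin/gsupp_sum. Qed.

Lemma big_gsupp (W : nmodType) (v : V) (F : int -> W) (s : seq int) :
  uniq s -> {subset gsupp v <= s} -> (forall i, i \notin gsupp v -> F i = 0) ->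
  \sum_(i <- gsupp v) F i = \sum_(i <- s) F i.
Proof.
move=> us sub F0; rewrite [RHS](bigID (mem (gsupp v))) /= [X in _ + X]big1.
  2: by move=> i /F0.
rewrite addr0 -[RHS]big_filter; apply: perm_big; apply: uniq_perm.
- exact: gsupp_uniq.
- exact: filter_uniq.
- move=> i; rewrite mem_filter /=.
  by case iv : (i \in gsupp v) => //=; rewrite (sub _ iv).
Qed.

Definition shift_grading : grading V.
Proof.
refine (@Grading V (fun i => part G (i + 1)) _ _ _).
- by move=> i; exact: partB.
- by move=> i j v; rewrite partK (inj_eq (addIr 1)).
- move=> v; exists [seq i - 1 | i <- gsupp v].
  by rewrite map_inj_uniq ?gsupp_uniq //; exact: addIr.
by rewrite big_map {1}[v]gsupp_sum; apply: eq_bigr => i _; rewrite subrK.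
Defined.
End GradingTheory2.

Record gralg (k : fieldType) := GrAlg {
  galg :> algType k;
  agr : grading galg;
  agr_scale : forall i c (a : galg), homog agr i a -> homog agr i (c *: a);
  agr_one : homog agr 0 1;
  agr_mul : forall i j (a b : galg),
    homog agr i a -> homog agr j b -> homog agr (i + j) (a * b) }.

Record gralg_hom (k : fieldType) (A D : gralg k) := GrAlgHom {
  ahom :> {lrmorphism A -> D};
  ahom_deg : forall i a, homog (agr A) i a -> homog (agr D) i (ahom a) }.

Section GradedModules.
Variables (k : fieldType) (A : gralg k).

Record grmod := GrMod {
  gmod :> lmodType A;
  mgr : grading gmod;
  mgr_act : forall i j (a : A) (m : gmod),
    homog (agr A) i a -> homog mgr j m -> homog mgr (i + j) (a *: m) }.

Record grhom (M N : grmod) := GrHom {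
  ghom :> {linear M -> N};
  ghom_deg : forall i m, homog (mgr M) i m -> homog (mgr N) i (ghom m) }.

Definition grhom_id (M : grmod) : grhom M M.
Proof.
by refine (@GrHom M M idfun _).
Defined.

Definition grhom_comp (M N P : grmod) (g : grhom N P) (f : grhom M N) :
  grhom M P.
Proof.
refine (@GrHom M P (g \o f) _).
by move=> i m hm; exact: (ghom_deg g (ghom_deg f hm)).
Defined.

Definition Gr : category.
Proof.
refine (@Category grmod grhom (fun _ _ f g => f =1 g) grhom_id grhom_comp
    _ _ _ _ _ _ _).
- by [].
- by move=> M N f g fg m; rewrite fg.
- by move=> M N f g h fg gh m; rewrite fg.
- by move=> M N P g g' f f' gg' ff' m; rewrite /= ff' gg'.
- by [].
- by [].
- by [].
Defined.

Definition shift_mod (M : grmod) : grmod.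
Proof.
refine (@GrMod M (shift_grading (mgr M)) _) => i j a m ha hm.
by rewrite /homog /= -addrA; exact: (mgr_act ha hm).
Defined.

Definition shift_hom (M N : grmod) (f : grhom M N) :
  grhom (shift_mod M) (shift_mod N).
Proof.
refine (@GrHom (shift_mod M) (shift_mod N) f _).
by move=> i m; exact: (ghom_deg f).
Defined.

Definition shift_functor : functor Gr Gr.
Proof.
refine (@Functor Gr Gr shift_mod shift_hom _ _ _).
- by move=> M N f g fg m; exact: fg.
- by [].
- by [].
Defined.

Definition regular_mod : grmod := @GrMod A^o (agr A) (@agr_mul k A).

Definition graded_submodule (M : grmod) (P : M -> Prop) : Prop :=
  [/\ P 0, (forall m n, P m -> P n -> P (m + n)),
      (forall (a : A) m, P m -> P (a *: m)) &
      (forall i m, P m -> P (part (mgr M) i m))].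

(* [c%:A *: m] is the action of the scalar c : k on m *)
Definition finite_dim (M : grmod) (P : M -> Prop) : Prop :=
  exists (n : nat) (e : 'I_n -> M), forall m,
    P m <-> exists c : 'I_n -> k, m = \sum_(i < n) (c i)%:A *: e i.

Definition fdim (M : grmod) : Prop := @finite_dim M (fun=> True).

Definition Fdim (M : grmod) : Prop :=
  forall m : M, exists P : M -> Prop,
    [/\ graded_submodule P, finite_dim P & P m].

Definition exact_at (M N P : grmod) (f : grhom M N) (g : grhom N P) : Prop :=
  forall n : N, g n = 0 <-> exists m, f m = n.

(* 0 -> K -> M -> N -> L -> 0 is exact with K, L in [T], that is, the kernel and
   the cokernel of [s] are in [T]. *)
Definition isom_mod (T : grmod -> Prop) (M N : grmod) (s : grhom M N) : Prop :=
  exists (K L : grmod) (i : grhom K M) (q : grhom N L),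
    [/\ T K, T L &
      [/\ injective i, exact_at i s, exact_at s q & forall l, exists n, q n = l]].

(* [M] is the cokernel of a degree preserving map
   \bigoplus_i A(- d i) -> \bigoplus_j A(- e j), which is right multiplication of
   row vectors by the matrix [R]; [g j] is the image of the [j]-th generator. *)
Definition fin_pres (M : grmod) : Prop :=
  exists (p n : nat) (d : 'I_p -> int) (e : 'I_n -> int)
         (R : 'M[A]_(p, n)) (g : 'I_n -> M),
    [/\ forall i j, homog (agr A) (d i - e j) (R i j),
        forall j, homog (mgr M) (e j) (g j),
        forall m, exists c : 'rV[A]_n, m = \sum_j c 0 j *: g j &
        forall c : 'rV[A]_n,
          \sum_j c 0 j *: g j = 0 <-> exists b : 'rV[A]_p, c = b *m R].

Definition gr : category := full_sub (C := Gr) fin_pres.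

Definition Sigma_Fdim (M N : Gr) (s : hom M N) : Prop := isom_mod Fdim s.
(* The kernel and cokernel in [Sigma_fdim] need not be required to be in [gr]:
   finite dimensional graded modules over a finitely presented algebra, such as
   B and kQ, are finitely presented. *)
Definition Sigma_fdim (M N : gr) (s : hom M N) : Prop :=
  @isom_mod fdim (sval M) (sval N) s.

(* The quotient of an abelian category by a Serre subcategory T is its
   localization at the morphisms with kernel and cokernel in T. *)
Definition QGr : category := localization Sigma_Fdim.
Definition qgr : category := localization Sigma_fdim.

Definition QGr_quo : functor Gr QGr := loc_functor Sigma_Fdim.

Lemma fdim_Fdim M : fdim M -> Fdim M.
Proof. by move=> fM m; exists (fun=> True). Qed.

Lemma Sigma_fdim_Fdim (M N : gr) (s : hom M N) :
  Sigma_fdim s -> Sigma_Fdim (fmap (full_incl (C := Gr) fin_pres) s).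
Proof.
by move=> [K [L [i [q [/fdim_Fdim fK /fdim_Fdim fL ex]]]]]; exists K, L, i, q.
Qed.

Definition qgr_incl : functor qgr QGr := loc_map Sigma_fdim_Fdim.

Lemma fdim_sub_shift (M : grmod) (P : M -> Prop) :
  graded_submodule P -> @graded_submodule (shift_mod M) P.
Proof. by case=> P0 PD PZ Pp; split => // i m; exact: Pp. Qed.

Lemma Sigma_shift (M N : Gr) (s : hom M N) :
  Sigma_Fdim s -> Sigma_Fdim (fmap shift_functor s).
Proof.
move=> [K [L [i [q [fK fL [i_inj ex1 ex2 q_surj]]]]]].
exists (shift_mod K), (shift_mod L), (shift_hom i), (shift_hom q).
split=> //.
- by move=> m; have [P [sP fP Pm]] := fK m; exists P; split=> //; exact: fdim_sub_shift.
- by move=> m; have [P [sP fP Pm]] := fL m; exists P; split=> //; exact: fdim_sub_shift.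
Qed.

Definition QGr_shift : functor QGr QGr := loc_map Sigma_shift.

Definition QGr_O : QGr := QGr_quo regular_mod.

End GradedModules.

Lemma malg_ind (K : choiceType) (R : nzRingType) (P : {malg R[K]} -> Prop) :
  P 0 -> (forall g h, P g -> P h -> P (g + h)) ->
  (forall c k, P << c *g k >>) -> forall g, P g.
Proof. by move=> P0 PD PU g; rewrite [g]monalgE; apply: big_ind. Qed.

Section MalgLift.
Variables (K : choiceType) (R : nzRingType) (V : lmodType R) (h : K -> V).

Definition malg_lift (g : {malg R[K]}) : V := \sum_(x <- msupp g) g@_x *: h x.

Lemma malg_liftEw (d : {fset K}) g : (msupp g `<=` d)%fset ->
  malg_lift g = \sum_(x <- d) g@_x *: h x.
Proof.
move=> le; rewrite [LHS](big_fset_incl _ le) => //= x xd /mcoeff_outdom ->.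
by rewrite scale0r.
Qed.

Lemma malg_lift_linear : linear malg_lift.
Proof.
move=> c g1 g2; pose d := (msupp g1 `|` msupp g2)%fset.
have le1 : (msupp g1 `<=` d)%fset by exact: fsubsetUl.
have le2 : (msupp g2 `<=` d)%fset by exact: fsubsetUr.
have le : (msupp (c *: g1 + g2) `<=` d)%fset.
  apply: (fsubset_trans (msuppD_le _ _)); apply: fsetSU; exact: msuppZ_le.
rewrite (malg_liftEw le) (malg_liftEw le1) (malg_liftEw le2).
rewrite scaler_sumr -big_split; apply: eq_bigr => x _ /=.
by rewrite mcoeffD mcoeffZ scalerDl scalerA.
Qed.

HB.instance Definition _ :=
  GRing.isLinear.Build R {malg R[K]} V *:%R malg_lift malg_lift_linear.

Lemma malg_liftU c x : malg_lift << c *g x >> = c *: h x.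
Proof. by rewrite (malg_liftEw msuppU_le) big_seq_fset1 mcoeffUU. Qed.
End MalgLift.

Section QuotLift.
Variables (R V : zmodType) (I : zmodClosed R) (g : R -> V).
Hypothesis gB : {morph g : x y / x - y}.
Hypothesis gI : forall x, x \in I -> g x = 0.

Definition quot_lift (x : {ideal_quot I}) : V := g (repr x).

Lemma quot_liftE x : quot_lift (\pi_{ideal_quot I} x) = g x.
Proof.
apply/eqP; rewrite -subr_eq0 -gB; apply/eqP/gI.
by rewrite Quotient.idealrBE reprK.
Qed.

Lemma quot_liftB : {morph quot_lift : x y / x - y}.
Proof.
by move=> x y; rewrite -[x]reprK -[y]reprK -raddfB !quot_liftE gB.
Qed.
End QuotLift.

Lemma quot_eq0 (R : zmodType) (I : zmodClosed R) (x : R) :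
  (\pi_{ideal_quot I} x == 0 :> {ideal_quot I}) = (x \in I).
Proof.
have <- : \pi_{ideal_quot I} 0 = 0 by exact: raddf0.
by rewrite -Quotient.idealrBE subr0.
Qed.

(* [D] is a right [B]-module via [f]; the tensor product is the quotient of the
   free abelian group on [D * M] by biadditivity and [B]-balancedness. *)
Section Tensor.
Variables (k : fieldType) (B D : gralg k) (f : gralg_hom B D) (M : grmod B).

Definition tens_free := {malg int[(D * M)%type]}.

Inductive tens_rel : tens_free -> Prop :=
| tens_rel0 : tens_rel 0
| tens_relB x y : tens_rel x -> tens_rel y -> tens_rel (x - y)
| tens_addl d d' m :
    tens_rel (<< (d + d', m) >> - << (d, m) >> - << (d', m) >>)
| tens_addr d m m' :
    tens_rel (<< (d, m + m') >> - << (d, m) >> - << (d, m') >>)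
| tens_bal d b m : tens_rel (<< (d * f b, m) >> - << (d, b *: m) >>).

Definition tens_null : {pred tens_free} := fun x => `[< tens_rel x >].

Lemma tens_nullP x : reflect (tens_rel x) (x \in tens_null).
Proof. exact: asboolP. Qed.

Lemma tens_null_zmod : zmod_closed tens_null.
Proof.
split; first by apply/tens_nullP; exact: tens_rel0.
by move=> x y /tens_nullP hx /tens_nullP hy; apply/tens_nullP; exact: tens_relB.
Qed.

HB.instance Definition _ := GRing.isZmodClosed.Build _ tens_null tens_null_zmod.

Definition tens := {ideal_quot tens_null}.

HB.instance Definition _ := GRing.Zmodule.on tens.

Definition tpure (d : D) (m : M) : tens := \pi_{ideal_quot tens_null} << (d, m) >>.

Lemma tpureDl d d' m : tpure (d + d') m = tpure d m + tpure d' m.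
Proof.
apply/eqP; rewrite -subr_eq0 opprD addrA -!raddfB quot_eq0.
by apply/tens_nullP; exact: tens_addl.
Qed.

Lemma tpureDr d m m' : tpure d (m + m') = tpure d m + tpure d m'.
Proof.
apply/eqP; rewrite -subr_eq0 opprD addrA -!raddfB quot_eq0.
by apply/tens_nullP; exact: tens_addr.
Qed.

Lemma tpure_bal d b m : tpure (d * f b) m = tpure d (b *: m).
Proof.
apply/eqP; rewrite -subr_eq0 -raddfB quot_eq0.
by apply/tens_nullP; exact: tens_bal.
Qed.

Lemma tens_ind (P : tens -> Prop) : P 0 ->
  (forall x y, P x -> P y -> P (x - y)) -> (forall d m, P (tpure d m)) ->
  forall x, P x.
Proof.
move=> P0 PB Pt x; rewrite -[x]reprK.
have PN y : P y -> P (- y) by rewrite -[- y]add0r; exact: PB.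
have PD y z : P y -> P z -> P (y + z).
  by move=> Py Pz; rewrite -[z]opprK; apply/PB/PN.
elim/malg_ind: (repr x) => [|g h Pg Ph|c [d m]].
- by rewrite raddf0.
- by rewrite raddfD; exact: PD.
have -> : << c *g (d, m) >> = << (d, m) >> *~ c :> tens_free.
  by rewrite -raddfMz /= intz.
rewrite raddfMz -/(tpure d m).
have Pn n : P (tpure d m *+ n) by elim: n => // n IH; rewrite mulrS; exact: PD.
case: c => n; first exact: Pn.
by rewrite NegzE mulrNz; apply: PN; exact: Pn.
Qed.

Section Lift.
Variables (V : zmodType) (h : D -> M -> V).
Hypothesis hDl : forall d d' m, h (d + d') m = h d m + h d' m.
Hypothesis hDr : forall d m m', h d (m + m') = h d m + h d m'.
Hypothesis h_bal : forall d b m, h (d * f b) m = h d (b *: m).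

Let hpair (x : (D * M)%type) : zmodule V := h x.1 x.2.

Definition tens_lift_free : tens_free -> V := malg_lift hpair.

Lemma tens_lift_freeB : {morph tens_lift_free : x y / x - y}.
Proof. by move=> x y; exact: (raddfB (malg_lift hpair)). Qed.

Lemma tens_lift_freeU d m : tens_lift_free << (d, m) >> = h d m.
Proof. by rewrite /tens_lift_free malg_liftU scale1r. Qed.

Lemma tens_lift_null x : x \in tens_null -> tens_lift_free x = 0.
Proof.
move/tens_nullP; elim=> {x} [|x y _ hx _ hy|d d' m|d m m'|d b m].
- exact: (raddf0 (malg_lift hpair)).
- by rewrite tens_lift_freeB hx hy subr0.
- by rewrite !tens_lift_freeB !tens_lift_freeU hDl addrAC addrK subrr.
- by rewrite !tens_lift_freeB !tens_lift_freeU hDr addrAC addrK subrr.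
- by rewrite !tens_lift_freeB !tens_lift_freeU h_bal subrr.
Qed.

Definition tens_lift (x : tens) : V := quot_lift tens_lift_free x.

Lemma tens_liftE d m : tens_lift (tpure d m) = h d m.
Proof.
rewrite /tens_lift quot_liftE ?tens_lift_freeU //.
  exact: tens_lift_freeB.
exact: tens_lift_null.
Qed.

Lemma tens_liftB : {morph tens_lift : x y / x - y}.
Proof. by apply: quot_liftB; [exact: tens_lift_freeB | exact: tens_lift_null]. Qed.
End Lift.

Lemma tens_eq (V : zmodType) (g h : tens -> V) :
  {morph g : x y / x - y} -> {morph h : x y / x - y} ->
  (forall d m, g (tpure d m) = h (tpure d m)) -> g =1 h.
Proof.
move=> gB hB gh; elim/tens_ind => [|x y gx gy|//].
  by rewrite -[X in g X](subrr 0) -[X in h X](subrr 0) gB hB !subrr.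
by rewrite gB hB gx gy.
Qed.

Definition tens_scale (d : D) : tens -> tens :=
  tens_lift (fun d' m => tpure (d * d') m).

Lemma tens_scaleE d d' m : tens_scale d (tpure d' m) = tpure (d * d') m.
Proof.
rewrite /tens_scale tens_liftE //.
- by move=> *; rewrite mulrDr tpureDl.
- by move=> *; rewrite tpureDr.
- by move=> *; rewrite mulrA tpure_bal.
Qed.

Lemma tens_scaleB d : {morph tens_scale d : x y / x - y}.
Proof.
apply: tens_liftB.
- by move=> *; rewrite mulrDr tpureDl.
- by move=> *; rewrite tpureDr.
- by move=> *; rewrite mulrA tpure_bal.
Qed.

Lemma tens_scaleA a b x : tens_scale a (tens_scale b x) = tens_scale (a * b) x.
Proof.
apply: (@tens_eq _ (tens_scale a \o tens_scale b) (tens_scale (a * b)) _ _ _ x)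
  => [y z|y z|d m] /=; rewrite ?tens_scaleB //.
by rewrite !tens_scaleE mulrA.
Qed.

Lemma tens_scale1 : left_id 1 tens_scale.
Proof.
move=> x; apply: (@tens_eq _ (tens_scale 1) id _ _ _ x) => [y z|//|d m].
  by rewrite tens_scaleB.
by rewrite tens_scaleE mul1r.
Qed.

Lemma tens_scaleDr : right_distributive tens_scale +%R.
Proof. by move=> a; exact: (morphBD (tens_scaleB a)). Qed.

Lemma tens_scaleDl x : {morph tens_scale^~ x : a b / a + b}.
Proof.
move=> a b /=.
apply: (@tens_eq _ (tens_scale (a + b))
          (fun x => tens_scale a x + tens_scale b x) _ _ _ x) => [y z|y z|d m]; rewrite ?tens_scaleB //.
  by rewrite opprD addrACA.
by rewrite !tens_scaleE mulrDl tpureDl.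
Qed.

HB.instance Definition _ := GRing.Zmodule_isLmodule.Build D tens
  tens_scaleA tens_scale1 tens_scaleDr tens_scaleDl.

Lemma tpureZ (d d' : D) m : d *: tpure d' m = tpure (d * d') m.
Proof. exact: tens_scaleE. Qed.

Lemma tpure0l m : tpure 0 m = 0.
Proof. by apply: (addrI (tpure 0 m)); rewrite -tpureDl !addr0. Qed.

Lemma tpure0r d : tpure d 0 = 0.
Proof. by apply: (addrI (tpure d 0)); rewrite -tpureDr !addr0. Qed.

Lemma tpure_suml (I : Type) (s : seq I) (F : I -> D) m :
  tpure (\sum_(i <- s) F i) m = \sum_(i <- s) tpure (F i) m.
Proof.
by apply: (big_morph (tpure^~ m)) => [d d'|]; rewrite ?tpureDl ?tpure0l.
Qed.

Lemma tpure_sumr (I : Type) (s : seq I) d (F : I -> M) :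
  tpure d (\sum_(i <- s) F i) = \sum_(i <- s) tpure d (F i).
Proof. by apply: big_morph => [m m'|]; rewrite ?tpureDr ?tpure0r. Qed.

(* \sum_(i + j = n) d_i \otimes m_j *)
Definition tens_part_pure (n : int) (d : D) (m : M) : tens :=
  \sum_(i <- gsupp (agr D) d) tpure (part (agr D) i d) (part (mgr M) (n - i) m).

Lemma tens_part_pureE n d m s : uniq s -> {subset gsupp (agr D) d <= s} ->
  tens_part_pure n d m =
  \sum_(i <- s) tpure (part (agr D) i d) (part (mgr M) (n - i) m).
Proof.
move=> us sub; apply: big_gsupp => // i /gsupp_notin ->; exact: tpure0l.
Qed.

Lemma tens_part_pureDl n d d' m :
  tens_part_pure n (d + d') m = tens_part_pure n d m + tens_part_pure n d' m.
Proof.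
pose s := undup (gsupp (agr D) (d + d') ++ gsupp (agr D) d ++ gsupp (agr D) d').
have us : uniq s by exact: undup_uniq.
rewrite !(@tens_part_pureE _ _ _ s) //.
- by rewrite -big_split; apply: eq_bigr => i _; rewrite partD tpureDl.
- by move=> i hi; rewrite mem_undup !mem_cat hi !orbT.
- by move=> i hi; rewrite mem_undup !mem_cat hi !orbT.
- by move=> i hi; rewrite mem_undup !mem_cat hi.
Qed.

Lemma tens_part_pureDr n d m m' :
  tens_part_pure n d (m + m') = tens_part_pure n d m + tens_part_pure n d m'.
Proof.
by rewrite -big_split; apply: eq_bigr => i _; rewrite partD tpureDr.
Qed.

Lemma tens_part_pure_homog n i j d m :
  homog (agr D) i d -> homog (mgr M) j m ->
  tens_part_pure n d m = if n == i + j then tpure d m else 0.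
Proof.
move=> hd hm; have sub : {subset gsupp (agr D) d <= undup (i :: gsupp (agr D) d)}.
  by move=> x hx; rewrite mem_undup inE hx orbT.
rewrite (tens_part_pureE _ _ (undup_uniq _) sub).
rewrite (bigD1_seq i) ?undup_uniq ?mem_undup ?mem_head //= big1 ?addr0.
  rewrite hd (part_homog _ hm) subr_eq [j + i]addrC.
  by case: ifP => //; rewrite tpure0r.
by move=> l /negPf li; rewrite (part_homog _ hd) li tpure0l.
Qed.

Lemma tens_part_pure_bal n d b m :
  tens_part_pure n (d * f b) m = tens_part_pure n d (b *: m).
Proof.
have tpp0l m' : tens_part_pure n 0 m' = 0.
  by apply: (addrI (tens_part_pure n 0 m')); rewrite -tens_part_pureDl !addr0.
have tpp0r d' : tens_part_pure n d' 0 = 0.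
  by apply: (addrI (tens_part_pure n d' 0)); rewrite -tens_part_pureDr !addr0.
have sl (s : seq int) F m' : tens_part_pure n (\sum_(i <- s) F i) m' =
    \sum_(i <- s) tens_part_pure n (F i) m'.
  by apply: (big_morph (fun x => tens_part_pure n x m')) => [x y|];
     [exact: tens_part_pureDl | exact: tpp0l].
have sr (s : seq int) F d' : tens_part_pure n d' (\sum_(i <- s) F i) =
    \sum_(i <- s) tens_part_pure n d' (F i).
  by apply: big_morph => [x y|]; [exact: tens_part_pureDr | exact: tpp0r].
rewrite [d](gsupp_sum (agr D)) [b](gsupp_sum (agr B)) [m](gsupp_sum (mgr M)).
rewrite raddf_sum !mulr_suml scaler_suml !sl; apply: eq_bigr => i _.
rewrite mulr_sumr sl sr; apply: eq_bigr => j _.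
rewrite scaler_sumr !sr; apply: eq_bigr => l _.
set di := part _ _ _; set bj := part _ _ _; set ml := part _ _ _.
have hd : homog (agr D) i di by exact: homog_part.
have hb : homog (agr B) j bj by exact: homog_part.
have hm : homog (mgr M) l ml by exact: homog_part.
rewrite (tens_part_pure_homog n (agr_mul hd (ahom_deg f hb)) hm).
by rewrite (tens_part_pure_homog n hd (mgr_act hb hm)) addrA tpure_bal.
Qed.

Definition tens_part (n : int) : tens -> tens := tens_lift (tens_part_pure n).

Lemma tens_partE n d m : tens_part n (tpure d m) = tens_part_pure n d m.
Proof.
apply: tens_liftE => *; rewrite ?tens_part_pureDl ?tens_part_pureDr //.
exact: tens_part_pure_bal.
Qed.

Lemma tens_partB n : {morph tens_part n : x y / x - y}.
Proof.
apply: tens_liftB => *; rewrite ?tens_part_pureDl ?tens_part_pureDr //.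
exact: tens_part_pure_bal.
Qed.

Lemma tens_part_homog n i j d m :
  homog (agr D) i d -> homog (mgr M) j m ->
  tens_part n (tpure d m) = if n == i + j then tpure d m else 0.
Proof. by move=> hd hm; rewrite tens_partE; exact: tens_part_pure_homog. Qed.

Lemma tens_homog_ind (P : tens -> Prop) : P 0 ->
  (forall x y, P x -> P y -> P (x - y)) ->
  (forall i j d m, homog (agr D) i d -> homog (mgr M) j m -> P (tpure d m)) ->
  forall x, P x.
Proof.
move=> P0 PB Pt; have PD x y : P x -> P y -> P (x + y).
  move=> Px Py; rewrite -[y]opprK; apply: (PB) => //.
  by rewrite -[- y]add0r; exact: PB.
elim/tens_ind => // d m; rewrite [d](gsupp_sum (agr D)) [m](gsupp_sum (mgr M)).
rewrite tpure_suml; apply: big_ind => // i _.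
rewrite tpure_sumr; apply: big_ind => // j _.
by apply: (Pt i j); exact: homog_part.
Qed.

Lemma tens_part0 i : tens_part i 0 = 0.
Proof. exact: (morphB0 (tens_partB i)). Qed.

Lemma tens_partK i j x :
  tens_part i (tens_part j x) = if i == j then tens_part j x else 0.
Proof.
elim/tens_homog_ind: x => [|x y hx hy|i' j' d m hd hm].
- by rewrite !tens_part0 if_same.
- by rewrite !tens_partB hx hy; case: ifP; rewrite ?subr0.
rewrite (tens_part_homog j hd hm); case: eqP => [->|_].
  by rewrite (tens_part_homog i hd hm).
by rewrite tens_part0 if_same.
Qed.

Lemma tens_part_sum x :
  exists2 s : seq int, uniq s & x = \sum_(i <- s) tens_part i x.
Proof.
apply: decomposedW; elim/tens_homog_ind: x => [|x y hx hy|i j d m hd hm].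
- exact: (decomposed0 tens_partB).
- exact: (decomposedB tens_partB).
apply: (decomposed_homog tens_partK (i := i + j)).
by rewrite (tens_part_homog _ hd hm) eqxx.
Qed.

Definition tens_grading : grading tens :=
  Grading tens_partB tens_partK tens_part_sum.

Lemma tens_act i j (a : D) x : homog (agr D) i a -> homog tens_grading j x ->
  homog tens_grading (i + j) (a *: x).
Proof.
move=> ha; rewrite /homog /= => hx; rewrite -hx {hx}.
elim/tens_homog_ind: x => [|x y hx hy|i' j' d m hd hm].
- by rewrite tens_part0 scaler0 tens_part0.
- by rewrite tens_partB !scalerBr !tens_partB hx hy.
rewrite (tens_part_homog _ hd hm); case: eqP => [->|]; last first.
  by rewrite scaler0 tens_part0.
by rewrite tpureZ (tens_part_homog _ (agr_mul ha hd) hm) addrA eqxx.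
Qed.

Definition tens_mod : grmod D := GrMod tens_act.

End Tensor.

Section TensorFunctor.
Variables (k : fieldType) (B D : gralg k) (f : gralg_hom B D).

Section Map.
Variables (M N : grmod B) (phi : grhom M N).

Definition tens_map : tens f M -> tens f N :=
  tens_lift (fun d m => tpure f d (phi m)).

Lemma tens_mapE d m : tens_map (tpure f d m) = tpure f d (phi m).
Proof.
by apply: tens_liftE => *; rewrite ?tpureDl ?linearD ?tpureDr ?tpure_bal ?linearZ.
Qed.

Lemma tens_mapB : {morph tens_map : x y / x - y}.
Proof.
by apply: tens_liftB => *; rewrite ?tpureDl ?linearD ?tpureDr ?tpure_bal ?linearZ.
Qed.

Lemma tens_map_linear : linear tens_map.
Proof.
move=> a x y; rewrite (morphBD tens_mapB); congr (_ + _).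
elim/tens_ind: x => [|x z hx hz|d m].
- by rewrite scaler0 (morphB0 tens_mapB) scaler0.
- by rewrite scalerBr !tens_mapB hx hz scalerBr.
- by rewrite tpureZ !tens_mapE tpureZ.
Qed.

HB.instance Definition _ :=
  GRing.isLinear.Build D (tens f M) (tens f N) *:%R tens_map tens_map_linear.

Lemma tens_map_part i x : tens_part i (tens_map x) = tens_map (tens_part i x).
Proof.
elim/tens_homog_ind: x => [|x y hx hy|i' j d m hd hm].
- by rewrite linear0 !tens_part0 linear0.
- by rewrite linearB !tens_partB hx hy linearB.
rewrite tens_mapE (tens_part_homog _ _ hd hm).
rewrite (tens_part_homog _ _ hd (ghom_deg phi hm)).
by case: ifP; rewrite ?tens_mapE ?linear0.
Qed.

Definition tens_hom : grhom (tens_mod f M) (tens_mod f N).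
Proof.
refine (@GrHom _ _ (tens_mod f M) (tens_mod f N) tens_map _).
by move=> i x; rewrite /homog /= tens_map_part => ->.
Defined.
End Map.

Definition tens_functor : functor (Gr B) (Gr D).
Proof.
refine (@Functor (Gr B) (Gr D) (tens_mod f) tens_hom _ _ _).
- move=> M N g h gh; apply: tens_eq; try exact: tens_mapB.
  by move=> d m; rewrite /= !tens_mapE gh.
- by move=> M; apply: tens_eq; [exact: tens_mapB | | move=> d m; exact: tens_mapE].
- move=> M N P g h; apply: tens_eq; first exact: tens_mapB.
    by move=> x y /=; rewrite !tens_mapB.
  by move=> d m; rewrite /= !tens_mapE.
Defined.

End TensorFunctor.

Section MalgGrading.
Variables (K : choiceType) (k : fieldType) (deg : K -> nat).

Definition malg_part (n : int) (g : {malg k[K]}) : {malg k[K]} :=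
  [malg x in msupp g => if deg x == n :> int then g@_x else 0].

Lemma malg_partE n g x : (malg_part n g)@_x = if deg x == n :> int then g@_x else 0.
Proof. by rewrite mcoeffE; case: msuppP; rewrite ?if_same. Qed.

Lemma malg_partB n : {morph malg_part n : g h / g - h}.
Proof.
move=> g h; apply/malgP => x; rewrite mcoeffB !malg_partE mcoeffB.
by case: ifP; rewrite ?subr0.
Qed.

Lemma malg_partK i j g :
  malg_part i (malg_part j g) = if i == j then malg_part j g else 0.
Proof.
apply/malgP => x; rewrite (fun_if (mcoeff x)) mcoeff0 !malg_partE.
case: (eqVneq i j) => [->|ij]; first by case: eqP.
by case: eqP => // ->; rewrite (negPf ij).
Qed.

Lemma malg_partU i c x :
  malg_part i << c *g x >> = if deg x == i :> int then << c *g x >> else 0.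
Proof.
apply/malgP => y; rewrite (fun_if (mcoeff y)) mcoeff0 malg_partE mcoeffU.
by case: (eqVneq x y) => [->|_] //; rewrite mulr0n !if_same.
Qed.

Lemma malg_part_sum g :
  exists2 s : seq int, uniq s & g = \sum_(i <- s) malg_part i g.
Proof.
apply: decomposedW; elim/malg_ind: g => [|g h hg hh|c x].
- exact: (decomposed0 malg_partB).
- exact: (decomposedD malg_partB).
by apply: (decomposed_homog malg_partK (i := deg x)); rewrite malg_partU eqxx.
Qed.

Definition malg_grading : grading {malg k[K]} :=
  Grading malg_partB malg_partK malg_part_sum.

Lemma malg_homogP n g :
  homog malg_grading n g <-> forall x, g@_x != 0 -> deg x = n :> int.
Proof.
split=> [<- x|H].
  by rewrite malg_partE; case: (Posz (deg x) =P n) => // _; rewrite eqxx.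
apply/malgP => x; rewrite malg_partE; case: (Posz (deg x) =P n) => // xn.
by case: (eqVneq g@_x 0) => [->//|/H].
Qed.

Lemma malg_homogZ n c g : homog malg_grading n g -> homog malg_grading n (c *: g).
Proof.
move=> /malg_homogP H; apply/malg_homogP => x; rewrite mcoeffZ mulf_eq0.
by case/norP => _ /H.
Qed.
End MalgGrading.

(* [false] is the letter x and [true] is the letter y *)
Definition free_alg (k : fieldType) := {malg k[{fmonom bool}]}.

HB.instance Definition _ (k : fieldType) := GRing.Lalgebra.on (free_alg k).

Section FreeAlgebra.
Variable k : fieldType.

Lemma free_alg_scalerAr (c : k) (a b : free_alg k) : c *: (a * b) = a * (c *: b).
Proof.
rewrite -!mul_malgC mulrA; suff -> : c%:MP * a = a * c%:MP by rewrite mulrA.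
elim/malg_ind: a => [|g h hg hh|d w]; first by rewrite mulr0 mul0r.
  by rewrite mulrDr mulrDl hg hh.
by rewrite !malgM_def !fgmulUU mul1m mulm1 mulrC.
Qed.

HB.instance Definition _ := GRing.Lalgebra_isAlgebra.Build k (free_alg k)
  free_alg_scalerAr.

Definition fx : free_alg k := << fmu false >>.
Definition fy : free_alg k := << fmu true >>.

Definition free_grading : grading (free_alg k) :=
  malg_grading k (fun w : {fmonom bool} => size w).

Lemma free_homogM i j (a b : free_alg k) :
  homog free_grading i a -> homog free_grading j b ->
  homog free_grading (i + j) (a * b).
Proof.
move=> /malg_homogP ha /malg_homogP hb; apply/malg_homogP => w.
rewrite mcoeff_neq0 => /msuppM_le [u [v [hu hv ->]]].
rewrite -(ha u) ?mcoeff_neq0 // -(hb v) ?mcoeff_neq0 //.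
by rewrite -PoszD; congr Posz; exact: fdegM.
Qed.

Lemma free_homog1 : homog free_grading 0 1.
Proof.
apply/malg_homogP => w; rewrite mcoeff1; case: (eqVneq w mone) => [->|_]; rewrite ?eqxx //.
by move=> _; congr Posz; exact: fdeg1.
Qed.

Lemma free_homogy n : homog free_grading n%:Z (fy ^+ n).
Proof.
have hy : homog free_grading 1 fy.
  apply/malg_homogP => w; rewrite mcoeffU1.
  case: (eqVneq (fmu true) w) => [<-|_]; rewrite ?eqxx //.
  by move=> _; congr Posz; exact: fdegU.
elim: n => [|n IH]; first by rewrite expr0; exact: free_homog1.
by rewrite exprS -add1n PoszD; exact: free_homogM.
Qed.

End FreeAlgebra.

Section AlgebraB.
Variables (k : fieldType) (r : nat).
Local Notation W := (free_alg k).
Local Notation yr := (fy k ^+ r.+1).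

Definition y_ideal : {pred W} := fun a =>
  `[< exists s : seq (W * W), a = \sum_(p <- s) p.1 * yr * p.2 >].

Lemma y_idealP a :
  reflect (exists s : seq (W * W), a = \sum_(p <- s) p.1 * yr * p.2)
          (a \in y_ideal).
Proof. exact: asboolP. Qed.

Lemma y_ideal_zmod : zmod_closed y_ideal.
Proof.
split; first by apply/y_idealP; exists [::]; rewrite big_nil.
move=> a b /y_idealP [s ->] /y_idealP [t ->]; apply/y_idealP.
exists (s ++ [seq (- p.1, p.2) | p <- t]); rewrite big_cat big_map; congr (_ + _).
by rewrite -sumrN; apply: eq_bigr => p _; rewrite !mulNr.
Qed.

HB.instance Definition _ := GRing.isZmodClosed.Build _ y_ideal y_ideal_zmod.

Lemma y_ideal_gen a b : a * yr * b \in y_ideal.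
Proof. by apply/y_idealP; exists [:: (a, b)]; rewrite big_seq1. Qed.

Lemma y_idealMl a b : b \in y_ideal -> a * b \in y_ideal.
Proof.
case/y_idealP => s ->; rewrite mulr_sumr; apply: rpred_sum => p _.
by rewrite !mulrA; exact: y_ideal_gen.
Qed.

Lemma y_idealMr a b : a \in y_ideal -> a * b \in y_ideal.
Proof.
case/y_idealP => s ->; rewrite mulr_suml; apply: rpred_sum => p _.
by rewrite -mulrA; exact: y_ideal_gen.
Qed.

Lemma y_idealZ c a : a \in y_ideal -> c *: a \in y_ideal.
Proof. by move=> ha; rewrite -[a]mul1r scalerAl; exact: y_idealMl. Qed.

Lemma y_ideal_neq1 : 1 \notin y_ideal.
Proof.
apply/negP => /y_idealP [s] /(congr1 (mcoeff mone)).
rewrite mcoeff1 eqxx raddf_sum big1 => [/eqP|p _]; first by rewrite oner_eq0.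
rewrite /= !rmorphM rmorphXn /= [X in X ^+ _]mcoeffU1.
case: eqP => [/(congr1 (size \o val))|_]; first by rewrite /= fmU fm1.
by rewrite expr0n mulr0 mul0r.
Qed.

Lemma mul3_sum (R : nzRingType) (s t : seq int) (F G : int -> R) (c : R) :
  (\sum_(i <- s) F i) * c * (\sum_(j <- t) G j) =
  \sum_(i <- s) \sum_(j <- t) F i * c * G j.
Proof.
by rewrite !mulr_suml; apply: eq_bigr => i _; rewrite mulr_sumr.
Qed.

Lemma y_ideal_part n a : a \in y_ideal -> part (free_grading k) n a \in y_ideal.
Proof.
case/y_idealP => s ->; rewrite part_bigsum; apply: rpred_sum => p _.
rewrite [p.1](gsupp_sum (free_grading k)) [p.2](gsupp_sum (free_grading k)).
rewrite mul3_sum part_bigsum; apply: rpred_sum => i _.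
rewrite part_bigsum; apply: rpred_sum => j _.
set ai := part _ i _; set bj := part _ j _.
have ha : homog (free_grading k) i ai by exact: homog_part.
have hb : homog (free_grading k) j bj by exact: homog_part.
have h := free_homogM (free_homogM ha (free_homogy k r.+1)) hb.
by rewrite (part_homog _ h); case: ifP => _; rewrite ?rpred0 ?y_ideal_gen.
Qed.

Definition algB := {ideal_quot y_ideal}.

HB.instance Definition _ := GRing.Zmodule.on algB.

Definition piB (a : W) : algB := \pi_{ideal_quot y_ideal} a.

Lemma piB_B : {morph piB : a b / a - b}.
Proof. by move=> a b; rewrite /piB raddfB. Qed.

Lemma piBD : {morph piB : a b / a + b}.
Proof. by move=> a b; rewrite /piB raddfD. Qed.

Lemma piB_eq0 a : (piB a == 0) = (a \in y_ideal).
Proof. exact: quot_eq0. Qed.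

Lemma piB_eq a b : a - b \in y_ideal -> piB a = piB b.
Proof. by rewrite -piB_eq0 piB_B subr_eq0 => /eqP. Qed.

Lemma piB_repr x : piB (repr x) = x.
Proof. exact: reprK. Qed.

Lemma repr_piB a : repr (piB a) - a \in y_ideal.
Proof. by rewrite -piB_eq0 piB_B piB_repr subrr. Qed.

Definition mulB (x y : algB) : algB := piB (repr x * repr y).

Lemma mulBE a b : mulB (piB a) (piB b) = piB (a * b).
Proof.
apply: piB_eq; set a' := repr _; set b' := repr _.
have -> : a' * b' - a * b = (a' - a) * b' + a * (b' - b).
  by rewrite mulrBl mulrBr addrA subrK.
by apply: rpredD; [apply: y_idealMr | apply: y_idealMl]; exact: repr_piB.
Qed.

Definition scaleB (c : k) (x : algB) : algB := piB (c *: repr x).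

Lemma scaleBE c a : scaleB c (piB a) = piB (c *: a).
Proof. by apply: piB_eq; rewrite -scalerBr y_idealZ ?repr_piB. Qed.

Lemma mulBA : associative mulB.
Proof.
move=> x y z; rewrite -[x]piB_repr -[y]piB_repr -[z]piB_repr.
by rewrite !mulBE mulrA.
Qed.

Lemma mul1B : left_id (piB 1) mulB.
Proof. by move=> x; rewrite -[x]piB_repr mulBE mul1r. Qed.

Lemma mulB1 : right_id (piB 1) mulB.
Proof. by move=> x; rewrite -[x]piB_repr mulBE mulr1. Qed.

Lemma mulBDl : left_distributive mulB +%R.
Proof.
move=> x y z; rewrite -[x]piB_repr -[y]piB_repr -[z]piB_repr.
by rewrite -piBD !mulBE mulrDl piBD.
Qed.

Lemma mulBDr : right_distributive mulB +%R.
Proof.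
move=> x y z; rewrite -[x]piB_repr -[y]piB_repr -[z]piB_repr.
by rewrite -piBD !mulBE mulrDr piBD.
Qed.

Lemma oneB_neq0 : piB 1 != 0.
Proof. by rewrite piB_eq0 y_ideal_neq1. Qed.

HB.instance Definition _ := GRing.Zmodule_isNzRing.Build algB
  mulBA mul1B mulB1 mulBDl mulBDr oneB_neq0.

Lemma piBM a b : piB (a * b) = piB a * piB b.
Proof. by rewrite -mulBE. Qed.

Lemma scaleBA b c x : scaleB b (scaleB c x) = scaleB (b * c) x.
Proof. by rewrite -[x]piB_repr !scaleBE scalerA. Qed.

Lemma scaleB1 : left_id 1 scaleB.
Proof. by move=> x; rewrite -[x]piB_repr !scaleBE scale1r. Qed.

Lemma scaleBDr : right_distributive scaleB +%R.
Proof.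
move=> c x y; rewrite -[x]piB_repr -[y]piB_repr.
by rewrite -piBD !scaleBE scalerDr piBD.
Qed.

Lemma scaleBDl x : {morph scaleB^~ x : b c / b + c}.
Proof. by move=> b c; rewrite /= -[x]piB_repr !scaleBE scalerDl piBD. Qed.

HB.instance Definition _ := GRing.Zmodule_isLmodule.Build k algB
  scaleBA scaleB1 scaleBDr scaleBDl.

Lemma piBZ c a : piB (c *: a) = c *: piB a.
Proof. by rewrite -scaleBE. Qed.

Lemma scaleBAl (c : k) (x y : algB) : c *: (x * y) = (c *: x) * y.
Proof.
rewrite -[x]piB_repr -[y]piB_repr.
by rewrite -piBM -!piBZ -piBM scalerAl.
Qed.

HB.instance Definition _ := GRing.Lmodule_isLalgebra.Build k algB scaleBAl.

Lemma scaleBAr (c : k) (x y : algB) : c *: (x * y) = x * (c *: y).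
Proof.
rewrite -[x]piB_repr -[y]piB_repr.
by rewrite -piBM -!piBZ -piBM scalerAr.
Qed.

HB.instance Definition _ := GRing.Lalgebra_isAlgebra.Build k algB scaleBAr.

Definition partB_free n (a : W) : algB := piB (part (free_grading k) n a).

Lemma partB_freeB n : {morph partB_free n : a b / a - b}.
Proof. by move=> a b; rewrite /partB_free partB piB_B. Qed.

Lemma partB_free_ideal n a : a \in y_ideal -> partB_free n a = 0.
Proof. by move=> ha; apply/eqP; rewrite piB_eq0 y_ideal_part. Qed.

Definition part_algB n (x : algB) : algB := quot_lift (partB_free n) x.

Lemma part_algBE n a : part_algB n (piB a) = piB (part (free_grading k) n a).
Proof. exact: (quot_liftE (@partB_freeB n) (@partB_free_ideal n)). Qed.

Lemma part_algB_B n : {morph part_algB n : x y / x - y}.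
Proof. exact: (quot_liftB (@partB_freeB n) (@partB_free_ideal n)). Qed.

Lemma part_algBK i j x :
  part_algB i (part_algB j x) = if i == j then part_algB j x else 0.
Proof.
rewrite -[x]piB_repr !part_algBE partK (fun_if piB).
by congr (if _ then _ else _); apply/eqP; rewrite piB_eq0 rpred0.
Qed.

Lemma part_algB_sum x :
  exists2 s : seq int, uniq s & x = \sum_(i <- s) part_algB i x.
Proof.
rewrite -[x]piB_repr; have [s us e] := part_sum (free_grading k) (repr x).
exists s => //; rewrite {1}e (big_morph piB (id1 := 0) piBD).
  by apply: eq_bigr => i _; rewrite part_algBE.
by apply/eqP; rewrite piB_eq0 rpred0.
Qed.

Definition algB_grading : grading algB :=
  Grading part_algB_B part_algBK part_algB_sum.

Lemma piB_homog i a :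
  homog (free_grading k) i a -> homog algB_grading i (piB a).
Proof. by rewrite /homog => ha; rewrite [LHS]part_algBE ha. Qed.

Lemma algB_homogP i x : homog algB_grading i x ->
  exists2 a, homog (free_grading k) i a & x = piB a.
Proof.
move=> hx; exists (part (free_grading k) i (repr x)); first exact: homog_part.
by rewrite -part_algBE piB_repr; exact/esym/hx.
Qed.

Definition grB : gralg k.
Proof.
refine (@GrAlg k algB algB_grading _ _ _).
- move=> i c x /algB_homogP [a ha ->]; rewrite -piBZ; apply: piB_homog.
  exact: malg_homogZ.
- apply: piB_homog; exact: free_homog1.
- move=> i j x y /algB_homogP [a ha ->] /algB_homogP [b hb ->].
  by rewrite -piBM; apply: piB_homog; exact: free_homogM.
Defined.

End AlgebraB.

(* with at least one vertex, so that 1 != 0 in the path algebra *)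
Record quiver := Quiver {
  vertex : finType;
  vertex0 : vertex;
  arrow : finType;
  asrc : arrow -> vertex;
  atgt : arrow -> vertex }.

Section PathAlgebra.
Variables (k : fieldType) (Q : quiver).

Fixpoint is_walk (v : vertex Q) (s : seq (arrow Q)) : bool :=
  if s is a :: s' then (asrc a == v) && is_walk (atgt a) s' else true.

(* A path is its source with the list of its arrows, in the order in which they
   are traversed. *)
Definition qpath := {p : vertex Q * seq (arrow Q) | is_walk p.1 p.2}.

HB.instance Definition _ := Choice.on qpath.

Definition psrc (p : qpath) : vertex Q := (val p).1.
Definition parrows (p : qpath) : seq (arrow Q) := (val p).2.
Definition ptgt (p : qpath) : vertex Q :=
  last (psrc p) (map (@atgt Q) (parrows p)).
Definition plength (p : qpath) : nat := size (parrows p).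

(* [pconcat p q] traverses [p], then [q] *)
Definition pconcat (p q : qpath) : option qpath :=
  if ptgt p == psrc q
  then @insub _ _ {p | is_walk p.1 p.2} (psrc p, parrows p ++ parrows q)
  else None.

Definition ptriv (v : vertex Q) : qpath := Sub (v, [::]) isT.

Lemma is_walk_cat v s t :
  is_walk v (s ++ t) = is_walk v s && is_walk (last v (map (@atgt Q) s)) t.
Proof. by elim: s v => //= a s IH v; rewrite IH andbA. Qed.

Lemma qpath_eq (p q : qpath) : psrc p = psrc q -> parrows p = parrows q -> p = q.
Proof.
move=> s a; apply: val_inj; move: s a; rewrite /psrc /parrows.
by case: (val p) (val q) => [? ?] [? ?] /= -> ->.
Qed.

Lemma pconcatP p q pq : pconcat p q = Some pq <->
  [/\ ptgt p = psrc q, psrc pq = psrc p & parrows pq = parrows p ++ parrows q].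
Proof.
rewrite /pconcat; split=> [|[tq sp ap]].
  case: eqP => // tq; case: insubP => //= u _ vu [<-].
  by split=> //; [exact: (congr1 fst vu) | exact: (congr1 snd vu)].
rewrite tq eqxx; case: insubP => [u _ vu|/negP[]].
  congr Some; apply: qpath_eq.
    exact: (etrans (congr1 fst vu) (esym sp)).
  exact: (etrans (congr1 snd vu) (esym ap)).
by rewrite /= is_walk_cat (valP p) /= -/(ptgt p) tq; exact: (valP q).
Qed.

Lemma pconcat_def p q : ptgt p = psrc q -> exists pq, pconcat p q = Some pq.
Proof.
move=> tq; rewrite /pconcat tq eqxx; case: insubP => [u _ _|/negP[]].
  by exists u.
by rewrite /= is_walk_cat (valP p) /= -/(ptgt p) tq; exact: (valP q).
Qed.

Lemma pconcat_tgt p q pq : pconcat p q = Some pq -> ptgt pq = ptgt q.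
Proof.
case/pconcatP => tq sp ap; rewrite /ptgt sp ap map_cat last_cat.
by rewrite -/(ptgt p) tq.
Qed.

Lemma pconcatA p q s : obind (pconcat p) (pconcat q s) =
  obind (fun pq => pconcat pq s) (pconcat p q).
Proof.
case eqs : (pconcat q s) => [qs|] /=; case epq : (pconcat p q) => [pq|] //=.
- have [t1 s1 a1] := (pconcatP _ _ _).1 eqs.
  have [t2 s2 a2] := (pconcatP _ _ _).1 epq.
  have [|l el] := @pconcat_def p qs; first by rewrite s1.
  have [|l' el'] := @pconcat_def pq s; first by rewrite (pconcat_tgt epq).
  rewrite el el'; congr Some.
  have [_ s3 a3] := (pconcatP _ _ _).1 el; have [_ s4 a4] := (pconcatP _ _ _).1 el'.
  by apply: qpath_eq; rewrite ?s3 ?s4 ?s2 // a3 a4 a1 a2 catA.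
- case e : (pconcat p qs) => [l|] //.
  have [t1 s1 a1] := (pconcatP _ _ _).1 eqs.
  have [t2 _ _] := (pconcatP _ _ _).1 e.
  by have [l' el'] := pconcat_def (etrans t2 s1); rewrite el' in epq.
- case e : (pconcat pq s) => [l|] //.
  have [t2 _ _] := (pconcatP _ _ _).1 e.
  have [l' el'] := pconcat_def (etrans (esym (pconcat_tgt epq)) t2).
  by rewrite el' in eqs.
Qed.

Definition path_alg := {malg k[qpath]}.

HB.instance Definition _ := GRing.Lmodule.on path_alg.

Definition opath (o : option qpath) : path_alg :=
  if o is Some p then << p >> else 0.

Definition pa_mul (a b : path_alg) : path_alg :=
  \sum_(p <- msupp a) a@_p *: \sum_(q <- msupp b) b@_q *: opath (pconcat p q).

Definition pa_one : path_alg := \sum_(v : vertex Q) << ptriv v >>.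

Lemma pa_mul_lift a b :
  pa_mul a b = malg_lift (fun p => malg_lift (fun q => opath (pconcat p q)) b) a.
Proof. by []. Qed.

Lemma pa_mulDl : left_distributive pa_mul +%R.
Proof. by move=> a b c; rewrite !pa_mul_lift linearD. Qed.

Lemma pa_mulDr : right_distributive pa_mul +%R.
Proof.
move=> a b c; rewrite /pa_mul -big_split; apply: eq_bigr => p _ /=.
rewrite -scalerDr; congr (_ *: _).
exact: (linearD (malg_lift (fun q => opath (pconcat p q)))).
Qed.

Lemma pa_mul0 a : pa_mul a 0 = 0.
Proof. by apply: (addrI (pa_mul a 0)); rewrite -pa_mulDr !addr0. Qed.

Lemma pa_0mul a : pa_mul 0 a = 0.
Proof. by apply: (addrI (pa_mul 0 a)); rewrite -pa_mulDl !addr0. Qed.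

Lemma pa_mulZl c a b : c *: pa_mul a b = pa_mul (c *: a) b.
Proof. by rewrite !pa_mul_lift linearZ. Qed.

Lemma pa_mulZr c a b : c *: pa_mul a b = pa_mul a (c *: b).
Proof.
rewrite /pa_mul scaler_sumr; apply: eq_bigr => p _ /=.
rewrite scalerA mulrC -scalerA; congr (_ *: _).
exact: (esym (linearZZ (malg_lift (fun q => opath (pconcat p q))) _ _)).
Qed.

Lemma malgUZ c (p : qpath) : << c *g p >> = c *: << p >> :> path_alg.
Proof. by apply/malgP => q; rewrite mcoeffZ !mcoeffU mulrnAr mulr1. Qed.

Lemma pa_mulPP p q : pa_mul << p >> << q >> = opath (pconcat p q).
Proof. by rewrite pa_mul_lift !malg_liftU !scale1r. Qed.

Lemma path_alg_ind (P : path_alg -> Prop) : P 0 ->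
  (forall a b, P a -> P b -> P (a + b)) -> (forall c a, P a -> P (c *: a)) ->
  (forall p, P << p >>) -> forall a, P a.
Proof.
move=> P0 PD PZ Pp; elim/malg_ind => // c p; rewrite malgUZ; exact/PZ/Pp.
Qed.

Lemma pa_mulA : associative pa_mul.
Proof.
move=> a b c; elim/path_alg_ind: a => [|a a' ha ha'|d a ha|p].
- by rewrite !pa_0mul.
- by rewrite !pa_mulDl ha ha'.
- by rewrite -!pa_mulZl ha.
elim/path_alg_ind: b => [|b b' hb hb'|d b hb|q].
- by rewrite !(pa_0mul, pa_mul0).
- by rewrite !(pa_mulDl, pa_mulDr) hb hb'.
- by rewrite -pa_mulZl -!pa_mulZr -pa_mulZl hb.
elim/path_alg_ind: c => [|c c' hc hc'|d c hc|s].
- by rewrite !pa_mul0.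
- by rewrite !pa_mulDr hc hc'.
- by rewrite -!pa_mulZr hc.
rewrite !pa_mulPP; have := pconcatA p q s.
case: (pconcat q s) => [qs|] /=; case: (pconcat p q) => [pq|] /= e;
  rewrite ?pa_mul0 ?pa_0mul ?pa_mulPP //; by [rewrite e | rewrite -e].
Qed.

Lemma pa_1mul : left_id pa_one pa_mul.
Proof.
move=> a; elim/path_alg_ind: a => [|a b ha hb|c a ha|p].
- exact: pa_mul0.
- by rewrite pa_mulDr ha hb.
- by rewrite -pa_mulZr ha.
rewrite /pa_one (big_morph (pa_mul^~ << p >>) (id1 := 0) (op1 := +%R)).
- rewrite (bigD1 (psrc p)) //= big1 ?addr0 => [|v vp]; rewrite pa_mulPP.
    suff -> : pconcat (ptriv (psrc p)) p = Some p by [].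
    by apply/pconcatP.
  by rewrite /pconcat /ptgt /= (negPf vp).
- by move=> b c; rewrite pa_mulDl.
- exact: pa_0mul.
Qed.

Lemma pa_mul1 : right_id pa_one pa_mul.
Proof.
move=> a; elim/path_alg_ind: a => [|a b ha hb|c a ha|p].
- exact: pa_0mul.
- by rewrite pa_mulDl ha hb.
- by rewrite -pa_mulZl ha.
rewrite /pa_one (big_morph (pa_mul << p >>) (id1 := 0) (op1 := +%R)).
- rewrite (bigD1 (ptgt p)) //= big1 ?addr0 => [|v vp]; rewrite pa_mulPP.
    suff -> : pconcat p (ptriv (ptgt p)) = Some p by [].
    by apply/pconcatP; split => //; rewrite cats0.
  by rewrite /pconcat eq_sym (negPf vp).
- by move=> b c; rewrite pa_mulDr.
- exact: pa_mul0.
Qed.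

Lemma path_coeffU (p q : qpath) : (<< p >> : path_alg)@_q = (p == q)%:R.
Proof. exact: mcoeffU. Qed.

Lemma pa_one_neq0 : pa_one != 0.
Proof.
apply/eqP => /(congr1 (mcoeff (ptriv (vertex0 Q)))); rewrite mcoeff0 raddf_sum.
rewrite (bigD1 (vertex0 Q)) //= big1 => [|v vv0].
  by rewrite addr0 mcoeffUU => /eqP; rewrite oner_eq0.
rewrite path_coeffU; case: (eqVneq (ptriv v) (ptriv (vertex0 Q))) => //.
by move=> /(congr1 psrc) e; rewrite -[v]/(psrc (ptriv v)) e eqxx in vv0.
Qed.

HB.instance Definition _ := GRing.Zmodule_isNzRing.Build path_alg
  pa_mulA pa_1mul pa_mul1 pa_mulDl pa_mulDr pa_one_neq0.

HB.instance Definition _ := GRing.Lmodule_isLalgebra.Build k path_alg pa_mulZl.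

HB.instance Definition _ := GRing.Lalgebra_isAlgebra.Build k path_alg pa_mulZr.

Lemma pa_mul_supp (a b : path_alg) p : (a * b)@_p != 0 ->
  exists q s, [/\ a@_q != 0, b@_s != 0 & pconcat q s = Some p].
Proof.
move=> abp; apply: contrapT => H; move/eqP: abp; apply.
rewrite -[a * b]/(pa_mul a b) /pa_mul raddf_sum big_seq big1 //= => q qa.
rewrite mcoeffZ raddf_sum big_seq big1 ?mulr0 //= => s sb.
rewrite mcoeffZ; case e : (pconcat q s) => [l|] /=; last by rewrite mcoeff0 mulr0.
rewrite path_coeffU; case: (eqVneq l p) => [lp|]; last by rewrite mulr0.
by case: H; exists q, s; rewrite e lp !mcoeff_neq0.
Qed.

Definition path_grading : grading path_alg := malg_grading k plength.

Definition gr_path_alg : gralg k.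
Proof.
refine (@GrAlg k path_alg path_grading _ _ _).
- exact: malg_homogZ.
- apply/malg_homogP => p; rewrite -[1]/pa_one raddf_sum.
  move=> p1; apply: contrapT => H; move/eqP: p1; apply.
  rewrite big1 // => v _ /=; rewrite path_coeffU.
  by case: (eqVneq (ptriv v) p) => // e; case: H; rewrite -e.
- move=> i j a b /malg_homogP ha /malg_homogP hb; apply/malg_homogP => p.
  move=> /pa_mul_supp [q [s [/ha <- /hb <- /pconcatP [_ _ e]]]].
  by rewrite -PoszD /plength e size_cat.
Defined.

End PathAlgebra.

Section MapF.
Variables (k : fieldType) (r : nat).

(* The vertices 1, ..., r+1 are numbered 0, ..., r; [inl i] is the arrow x
   starting at vertex [i], and [inr i] the arrow y from [i] to [i + 1]. *)
Definition quiverQ : quiver :=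
  @Quiver 'I_r.+1 ord0 ('I_r.+1 + 'I_r)%type
    (fun a => match a with inl i => i | inr i => widen_ord (leqnSn r) i end)
    (fun a => match a with inl _ => ord0 | inr i => lift ord0 i end).

Local Notation kQ := (path_alg k quiverQ).

Definition parrow (a : arrow quiverQ) : qpath quiverQ :=
  @exist (vertex quiverQ * seq (arrow quiverQ)) (fun p => is_walk p.1 p.2)
    (asrc a, [:: a]) (introT andP (conj (eqxx (asrc a)) isT)).

Definition xQ : kQ := \sum_(i < r.+1) << parrow (inl i) >>.
Definition yQ : kQ := \sum_(i < r) << parrow (inr i) >>.

Lemma yQ_exp : yQ ^+ r.+1 = 0.
Proof.
have H n p : (yQ ^+ n)@_p != 0 -> nat_of_ord (ptgt p) = (nat_of_ord (psrc p) + n)%N.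
  elim: n p => [|n IH] p.
    rewrite expr0 -[1]/(pa_one k quiverQ) raddf_sum addn0 => p1.
    apply: contrapT => H; move/eqP: p1; apply; rewrite big1 // => v _.
    rewrite /= path_coeffU; case: (eqVneq (ptriv v) p) => // e; case: H.
    by rewrite -e.
  rewrite exprS => /pa_mul_supp [q [s [hq hs e]]].
  rewrite (pconcat_tgt e) (IH s hs); have [<- -> _] := (pconcatP _ _ _).1 e.
  suff -> : nat_of_ord (ptgt q) = (nat_of_ord (psrc q)).+1 by rewrite addSnnS.
  apply: contrapT => H; move/eqP: hq; apply; rewrite raddf_sum big1 // => i _.
  rewrite /= path_coeffU; case: (eqVneq (parrow (inr i)) q) => // eq; case: H.
  by rewrite -eq.
apply/malgP => p; rewrite mcoeff0; apply/eqP; apply: contraT => /H e.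
by have := ltn_ord (ptgt p); rewrite e addnS ltnS ltnNge leq_addl.
Qed.

Definition letterQ (l : bool) : kQ := if l then yQ else xQ.

Definition wordQ (w : {fmonom bool}) : kQ := \prod_(l <- w) letterQ l.

Definition f_free (a : free_alg k) : kQ := malg_lift wordQ a.

Lemma f_free_linear : linear f_free.
Proof. exact: malg_lift_linear. Qed.

HB.instance Definition _ :=
  GRing.isLinear.Build k (free_alg k) kQ *:%R f_free f_free_linear.

Lemma f_freeU c w : f_free << c *g w >> = c *: wordQ w.
Proof. exact: malg_liftU. Qed.

Lemma f_freeM : {morph f_free : a b / a * b}.
Proof.
move=> a b; elim/malg_ind: a => [|a a' ha ha'|c u].
- by rewrite mul0r linear0 mul0r.
- by rewrite mulrDl !linearD /= mulrDl ha ha'.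
elim/malg_ind: b => [|b b' hb hb'|d v].
- by rewrite mulr0 linear0 mulr0.
- by rewrite mulrDr !linearD /= mulrDr hb hb'.
rewrite !f_freeU [_ * _ in LHS]malgM_def fgmulUU f_freeU.
by rewrite /wordQ fmM big_cat -scalerAl -scalerAr scalerA.
Qed.

Lemma f_free1 : f_free 1 = 1.
Proof. by rewrite -[1]/(<< mone >>) f_freeU scale1r /wordQ fm1 big_nil. Qed.

Lemma f_free_x : f_free (fx k) = xQ.
Proof. by rewrite f_freeU scale1r /wordQ fmU big_seq1. Qed.

Lemma f_free_y : f_free (fy k) = yQ.
Proof. by rewrite f_freeU scale1r /wordQ fmU big_seq1. Qed.

Lemma f_free_ideal a : a \in y_ideal r -> f_free a = 0.
Proof.
case/y_idealP => s ->; rewrite linear_sum big1 // => p _ /=.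
have fX n : f_free (fy k ^+ n) = yQ ^+ n.
  by elim: n => [|n IH]; rewrite ?expr0 ?f_free1 // !exprS f_freeM IH f_free_y.
by rewrite !f_freeM fX yQ_exp mulr0 mul0r.
Qed.

Definition fBQ (x : algB k r) : kQ := quot_lift f_free x.

Lemma fBQ_pi a : fBQ (piB r a) = f_free a.
Proof. by apply: quot_liftE; [exact: linearB | exact: f_free_ideal]. Qed.

Lemma fBQ_linear : linear fBQ.
Proof.
move=> c x y; rewrite -[x]piB_repr -[y]piB_repr -piBZ -piBD !fBQ_pi.
by rewrite linearP.
Qed.

HB.instance Definition _ :=
  GRing.isLinear.Build k (algB k r) kQ *:%R fBQ fBQ_linear.

Lemma fBQ_monoid : monoid_morphism fBQ.
Proof.
split=> [|x y]; first by rewrite -[1]/(piB r 1) fBQ_pi f_free1.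
by rewrite -[x]piB_repr -[y]piB_repr -piBM !fBQ_pi f_freeM.
Qed.

HB.instance Definition _ :=
  GRing.isMonoidMorphism.Build (algB k r) kQ fBQ fBQ_monoid.

Definition gr_kQ : gralg k := gr_path_alg k quiverQ.

Lemma letterQ_homog l : homog (path_grading k quiverQ) 1 (letterQ l).
Proof.
apply/malg_homogP => p hp; apply: contrapT => H; move/eqP: hp; apply.
have K a : (<< parrow a >> : kQ)@_p = 0.
  by rewrite path_coeffU; case: (eqVneq (parrow a) p) => // e; case: H; rewrite -e.
by case: l; rewrite raddf_sum big1 // => i _; exact: K.
Qed.

Lemma fBQ_deg i (x : algB k r) :
  homog (algB_grading k r) i x -> homog (path_grading k quiverQ) i (fBQ x).
Proof.
move=> /algB_homogP [a ha ->]; rewrite fBQ_pi /f_free /malg_lift.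
rewrite /homog part_bigsum big_seq [RHS]big_seq; apply: eq_bigr => w.
rewrite -mcoeff_neq0 => /((malg_homogP _ _ _).1 ha) <-.
apply: (@malg_homogZ _ k (@plength quiverQ)).
suff : forall s : seq bool,
    homog (path_grading k quiverQ) (size s) (\prod_(l <- s) letterQ l) by apply.
elim=> [|l s IH]; first by rewrite big_nil; exact: (agr_one gr_kQ).
rewrite big_cons -[size _]/(1 + size s)%N PoszD.
exact: (agr_mul (g := gr_kQ) (letterQ_homog l) IH).
Qed.

Definition f_hom : gralg_hom (grB k r) gr_kQ :=
  @GrAlgHom k (grB k r) gr_kQ fBQ fBQ_deg.

Lemma f_hom_x : f_hom (piB r (fx k)) = \sum_(i < r.+1) << parrow (inl i) >>.
Proof. by rewrite [LHS]fBQ_pi f_free_x. Qed.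

Lemma f_hom_y : f_hom (piB r (fy k)) = \sum_(i < r) << parrow (inr i) >>.
Proof. by rewrite [LHS]fBQ_pi f_free_y. Qed.

End MapF.

(* Main.v *)
From HB Require Import structures.
From mathcomp Require Import all_boot all_algebra.
From mathcomp Require Import boolp.
From mathcomp Require Import monalg.
From mathcomp Require Import zify.
Require Import Defs.

Set Implicit Arguments.
Unset Strict Implicit.
Unset Printing Implicit Defensive.

Import GRing.Theory.
Local Open Scope quotient_scope.
Local Open Scope ring_scope.

(** Number the vertices 0, ..., r, so that the arrows labelled x lead to 0 and
    those labelled y from v to v+1. At each vertex at most one arrow has a given
    label, so that every path is e_v f(w) for its source v and its word w of
    labels; as right B-modules, e_v kQ is B / y^{r+1-v} B, which is isomorphic
    to y^v B by multiplication by y^v.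

    Large quotients. A word w of length r+1 is zero in B or of the form
    u x y^v with v <= r. The path x y^v ends at the vertex v only, so that
    f(w) d = f(u x) f(y^v b) when b in B is a lift of e_v d; that is,
    f(w) kQ is contained in f(B) (word_descent). It follows that the kernels and
    cokernels of the unit M -> kQ (x) M and of the counit kQ (x) N -> N, where N
    is restricted along f, are killed by all words of length r+1. Over both
    algebras the modules in Fdim are those whose elements are killed by all
    sufficiently long words (FdimP). Hence kQ (x) - and restriction induce
    inverse equivalences of the localizations; only naturality on the module
    categories has to be checked, since a transformation that is natural before
    localization stays natural afterwards (nat_iso_localization).

    Small quotients. There are two readings of the small quotient. For the
    finitely presented objects of QGr the claim is formal, since the notion is
    categorical (equiv_restrict_fp). For the localization of the finitely
    presented modules restriction is of no use, as it does not preserve finite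
    presentation, and an inverse is given by I (x) -, where I is the ideal BxB
    of B. It is a B-kQ-bimodule, a sum of copies of e_0 kQ on the right, and
    free of rank r+1 over B on the left, so that I (x) - preserves finite
    presentation and finite dimensional kernels and cokernels. The maps
    I (x) kQ (x) M -> M and kQ (x) I (x) N -> N are given by multiplication.
    They are controlled by the decompositions of B and of kQ as a finite
    dimensional space, spanned by the y^i or the e_v y^i, plus the direct sum of
    the right ideals y^j x B or e_v y^j x kQ; for finitely presented modules
    this gives finite dimensional kernels and cokernels (decomposition_ker,
    decomposition_coker).

    The compatibility with shifts and with the structure sheaves already holds
    for graded modules. *)

(** * Equivalences, localizations and finitely presented objects *)

Section Isomorphisms.
Variable C : category.

Lemma is_iso_idm (X : C) : is_iso (idm X).
Proof. by exists (idm X); split; exact: comp_idl. Qed.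

Lemma comp_assoc' (X Y Z W : C) (h : hom Z W) (g : hom Y Z) (f : hom X Y) :
  heq (comp (comp h g) f) (comp h (comp g f)).
Proof. exact/heq_sym/comp_assoc. Qed.

Lemma comp_heql (X Y Z : C) (g g' : hom Y Z) (f : hom X Y) :
  heq g g' -> heq (comp g f) (comp g' f).
Proof. by move=> gg'; exact: (comp_heq gg' (heq_refl _)). Qed.

Lemma comp_heqr (X Y Z : C) (g : hom Y Z) (f f' : hom X Y) :
  heq f f' -> heq (comp g f) (comp g f').
Proof. by move=> ff'; exact: (comp_heq (heq_refl _) ff'). Qed.

Lemma iso_cancel_l (X Y Z : C) (g : hom Y Z) (f f' : hom X Y) :
  is_iso g -> heq (comp g f) (comp g f') -> heq f f'.
Proof.
move=> [g' [g'g _]] e.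
have K (h : hom X Y) : heq h (comp g' (comp g h)).
  apply: heq_trans (comp_assoc' _ _ _); apply: heq_trans (heq_sym (comp_idl _)) _.
  exact/comp_heql/heq_sym.
apply: heq_trans (K f) _; apply: heq_trans (heq_sym (K f')).
exact: comp_heqr.
Qed.

Lemma iso_cancel_r (X Y Z : C) (g g' : hom Y Z) (f : hom X Y) :
  is_iso f -> heq (comp g f) (comp g' f) -> heq g g'.
Proof.
move=> [f' [_ ff']] e.
have K (h : hom Y Z) : heq h (comp (comp h f) f').
  apply: heq_trans (comp_assoc _ _ _); apply: heq_trans (heq_sym (comp_idr _)) _.
  exact/comp_heqr/heq_sym.
apply: heq_trans (K g) _; apply: heq_trans (heq_sym (K g')).
exact: comp_heql.
Qed.

End Isomorphisms.

Lemma fmap_iso (C D : category) (F : functor C D) (X Y : C) (f : hom X Y) :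
  is_iso f -> is_iso (fmap F f).
Proof.
move=> [g [gf fg]]; exists (fmap F g); split.
- apply: heq_trans (heq_sym (fmap_comp F g f)) _.
  exact: heq_trans (fmap_heq F gf) (fmap_id F X).
- apply: heq_trans (heq_sym (fmap_comp F f g)) _.
  exact: heq_trans (fmap_heq F fg) (fmap_id F Y).
Qed.

Section NaturalIsomorphisms.
Variables C D : category.

Lemma nat_iso_sym (F G : functor C D) : nat_iso F G -> nat_iso G F.
Proof.
move=> [eta [eta_iso nat]].
pose th X := cid (eta_iso X); exists (fun X => sval (th X)); split=> [X|X Y f].
  by have [l r] := svalP (th X); exists (eta X).
have [lX rX] := svalP (th X); have [lY rY] := svalP (th Y).
apply: (iso_cancel_l (eta_iso Y)); apply: heq_trans (comp_assoc _ _ _) _.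
apply: heq_trans (comp_heql _ (heq_sym (nat X Y f))) _.
apply: heq_trans (comp_assoc' _ _ _) _.
apply: heq_trans (comp_heqr _ rX) _; apply: heq_trans (comp_idr _) _.
apply: heq_sym; apply: heq_trans (comp_assoc _ _ _) _.
by apply: heq_trans (comp_heql _ rY) _; exact: comp_idl.
Qed.

End NaturalIsomorphisms.

Section Equivalences.
Variables (C D : category) (F : functor C D) (G : functor D C).
Hypothesis GF : nat_iso (comp_functor G F) (id_functor C).
Hypothesis FG : nat_iso (comp_functor F G) (id_functor D).

Lemma equiv_faithful (X Y : C) (f g : hom X Y) :
  heq (fmap F f) (fmap F g) -> heq f g.
Proof.
move=> e; have [eta [eta_iso nat]] := GF; apply: (iso_cancel_r (eta_iso X)).
apply: heq_trans (nat _ _ f) _; apply: heq_trans (heq_sym (nat _ _ g)).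
apply: comp_heqr; exact: fmap_heq e.
Qed.

Lemma equiv_esssurj (Y : D) : exists X : C, isomorphic (F X) Y.
Proof. by have [eps [eps_iso _]] := FG; exists (G Y), (eps Y); exact: eps_iso. Qed.

End Equivalences.

Section FullyFaithful.
Variables (C D : category) (F : functor C D) (G : functor D C).
Hypothesis GF : nat_iso (comp_functor G F) (id_functor C).
Hypothesis FG : nat_iso (comp_functor F G) (id_functor D).

Lemma equiv_full (X Y : C) (h : hom (F X) (F Y)) : exists f, heq (fmap F f) h.
Proof.
have [eta [eta_iso nat]] := GF; have [et [ete eet]] := eta_iso X.
exists (comp (eta Y) (comp (fmap G h) et)).
apply: (equiv_faithful FG); set f := comp _ _.
apply: (iso_cancel_l (eta_iso Y)); apply: (heq_trans (heq_sym (nat _ _ f))).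
apply: heq_trans (comp_assoc' _ _ _) _; apply: comp_heqr.
apply: heq_trans (comp_assoc' _ _ _) _.
by apply: heq_trans (comp_heqr _ ete) _; exact: comp_idr.
Qed.

(** A cocone on the image system has, up to isomorphism, its vertex in the image
    of F, and then the whole cocone comes from C because F is fully faithful:
    so an equivalence preserves direct limits. *)
Section DirectLimits.
Variable Y : direct_system C.

Definition image_system : direct_system D.
Proof.
refine (@DirectSystem D (dindex Y) (@dle _ Y) (@dle_refl _ Y) (@dle_trans _ Y)
  (dinhabited Y) (@dle_directed _ Y) (fun i => F (dobj i))
  (fun i j ij => fmap F (dmap ij)) _ _).
- by move=> i ii; apply: heq_trans (fmap_heq F (dmap_id ii)) (fmap_id F _).
- move=> i j l ij jl il.
  by apply: heq_trans (fmap_heq F (dmap_comp ij jl il)) (fmap_comp F _ _).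
Defined.

Lemma equiv_direct_limit (L : C) (c : forall i : dindex Y, hom (dobj i) L) :
  is_direct_limit c ->
  @is_direct_limit D image_system (F L) (fun i => fmap F (c i)).
Proof.
move=> [cc univ]; split=> [i j ij|Z d dc].
  apply: heq_trans (heq_sym (fmap_comp F _ _)) _; exact/fmap_heq/cc.
have [Z' [a a_iso]] := equiv_esssurj FG Z; have [a' [a'a aa']] := a_iso.
have full i := cid (equiv_full (comp a' (d i))).
pose d' i : hom (dobj i) Z' := sval (full i).
have d'E i : heq (comp a (fmap F (d' i))) (d i).
  apply: heq_trans (comp_heqr _ (svalP (full i))) _.
  apply: heq_trans (comp_assoc _ _ _) _.
  by apply: heq_trans (comp_heql _ aa') _; exact: comp_idl.
have d'c : is_cocone d'.
  move=> i j ij; apply: (equiv_faithful GF); apply: (iso_cancel_l a_iso).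
  apply: heq_trans (comp_heqr _ (fmap_comp F _ _)) _.
  apply: heq_trans (comp_assoc _ _ _) _.
  apply: heq_trans (comp_heql _ (d'E j)) _.
  by apply: heq_trans (dc i j ij) _; exact/heq_sym/d'E.
have [u [uc uniq]] := univ Z' d' d'c; exists (comp a (fmap F u)); split=> [i|v vc].
  apply: heq_trans (comp_assoc' _ _ _) _; apply: heq_trans (d'E i).
  apply: comp_heqr; apply: heq_trans (heq_sym (fmap_comp F _ _)) _.
  exact: fmap_heq.
have [v' v'E] := equiv_full (comp a' v).
have av' : heq (comp a (fmap F v')) v.
  apply: heq_trans (comp_heqr _ v'E) _.
  apply: heq_trans (comp_assoc _ _ _) _.
  by apply: heq_trans (comp_heql _ aa') _; exact: comp_idl.
apply: heq_trans (heq_sym av') _; apply/comp_heqr/fmap_heq/uniq => i.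
apply: (equiv_faithful GF); apply: (iso_cancel_l a_iso).
apply: heq_trans (comp_heqr _ (fmap_comp F _ _)) _.
apply: heq_trans (comp_assoc _ _ _) _.
apply: heq_trans (comp_heql _ av') _.
by apply: heq_trans (vc i) _; exact/heq_sym/d'E.
Qed.

End DirectLimits.
End FullyFaithful.

(** Maps from F X to a direct limit correspond to maps from X to the image of
    that limit under the inverse equivalence, which is again a direct limit. *)
Lemma equiv_fp_object (C D : category) (F : functor C D) (G : functor D C) :
  nat_iso (comp_functor G F) (id_functor C) ->
  nat_iso (comp_functor F G) (id_functor D) ->
  forall X : C, fp_object X -> fp_object (F X).
Proof.
move=> GF FG X fpX Y L c lim; have [eta [eta_iso _]] := GF.
have [lift inj] := fpX _ _ _ (equiv_direct_limit FG GF lim).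
have [et [ete eet]] := eta_iso X.
split=> [h|i g g' gg'].
- have [i [g ge]] := lift (comp (fmap G h) et).
  have [g' g'E] := equiv_full FG GF (comp g (eta X)).
  exists i, g'; apply: (equiv_faithful FG).
  apply: heq_trans (fmap_comp G _ _) _; apply: heq_trans (comp_heqr _ g'E) _.
  apply: heq_trans (comp_assoc _ _ _) _; apply: heq_trans (comp_heql _ ge) _.
  apply: heq_trans (comp_assoc' _ _ _) _; apply: heq_trans (comp_heqr _ ete) _.
  exact: comp_idr.
- have [|j [ij e]] := inj i (comp (fmap G g) et) (comp (fmap G g') et).
    apply: heq_trans (comp_assoc _ _ _) _.
    apply: heq_trans (comp_assoc' _ _ _); apply: comp_heql.
    apply: heq_trans (heq_sym (fmap_comp G _ _)) _.
    by apply: heq_trans (fmap_comp G _ _); exact: fmap_heq.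
  exists j, ij; apply: (equiv_faithful FG).
  have et_iso : is_iso et by exists (eta X).
  apply: (iso_cancel_r et_iso).
  apply: heq_trans (comp_heql _ (fmap_comp G _ _)) _.
  apply: heq_trans (heq_sym (comp_heql _ (fmap_comp G _ _))).
  apply: heq_trans (comp_assoc' _ _ _) _.
  by apply: heq_trans (comp_assoc _ _ _).
Qed.

Section RestrictFunctor.
Variables (C D : category) (P : C -> Prop) (P' : D -> Prop).
Variables (F : functor C D) (FP : forall X, P X -> P' (F X)).

Definition restrict_functor : functor (full_sub P) (full_sub P').
Proof.
refine (@Functor (full_sub P) (full_sub P')
  (fun X => exist P' (F (sval X)) (FP (svalP X))) (fun _ _ f => fmap F f) _ _ _).
- by move=> X Y f g; exact: (@fmap_heq _ _ F).
- by move=> X; exact: (fmap_id F).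
- by move=> X Y Z g f; exact: (@fmap_comp _ _ F).
Defined.

Lemma restrict_functor_incl :
  nat_iso (comp_functor (full_incl P') restrict_functor)
          (comp_functor F (full_incl P)).
Proof.
exists (fun X => idm (F (sval X))); split=> [X|X Y f]; first exact: is_iso_idm.
by apply: heq_trans (comp_idr _) _; exact/heq_sym/comp_idl.
Qed.

End RestrictFunctor.

Lemma restrict_nat_iso (C D : category) (P : C -> Prop) (P' : D -> Prop)
    (F : functor C D) (G : functor D C)
    (FP : forall X, P X -> P' (F X)) (GP : forall X, P' X -> P (G X)) :
  nat_iso (comp_functor G F) (id_functor C) ->
  nat_iso (comp_functor (restrict_functor GP) (restrict_functor FP))
          (id_functor (full_sub P)).
Proof.
move=> [eta [eta_iso nat]]; exists (fun X => eta (sval X)); split=> [X|X Y f].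
- exact: eta_iso.
- exact: nat.
Qed.

(** Being finitely presented is defined in terms of the category alone, so any
    equivalence restricts to the finitely presented objects. *)
Lemma equiv_restrict_fp (C D : category) (F : functor C D) :
  is_equivalence F ->
  exists F' : functor (full_sub (@fp_object C)) (full_sub (@fp_object D)),
    is_equivalence F' /\
    nat_iso (comp_functor (full_incl (@fp_object D)) F')
            (comp_functor F (full_incl (@fp_object C))).
Proof.
move=> [G [GF FG]]; have FP := equiv_fp_object GF FG.
have GP := equiv_fp_object FG GF.
exists (restrict_functor FP); split; last exact: restrict_functor_incl.
by exists (restrict_functor GP); split; exact: restrict_nat_iso.
Qed.

Section Localizations.
Variables (C : category) (S : forall X Y : C, hom X Y -> Prop).

Lemma loc_fwd_iso (X Y : C) (s : hom X Y) :
  S s -> @is_iso (localization S) X Y (loc_fwd S s).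
Proof.
by move=> Ss; exists (loc_inv Ss); split; [exact: loc_invl | exact: loc_invr].
Qed.

(** A family natural for the morphisms of [C] is natural for their formal
    inverses too, because the functors send these to genuine inverses. *)
Lemma nat_iso_localization (E : category) (K K' : functor (localization S) E) :
  nat_iso (comp_functor K (loc_functor S)) (comp_functor K' (loc_functor S)) ->
  nat_iso K K'.
Proof.
move=> [eta [eta_iso nat]]; exists eta; split=> //.
move=> X Y f; elim: {X Y} f => [X Y f|X Y s Ss|X Y Z g IHg f IHf].
- exact: nat.
- have Ks := fmap_iso K (loc_fwd_iso Ss); have K's := fmap_iso K' (loc_fwd_iso Ss).
  have inv (K0 : functor (localization S) E) :
      heq (comp (fmap K0 (loc_fwd S s)) (fmap K0 (loc_inv Ss : @hom (localization S) Y X))) (idm (K0 Y)).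
    apply: heq_trans (heq_sym (fmap_comp K0 _ _)) _.
    apply: heq_trans (fmap_id K0 Y); apply: fmap_heq; exact: loc_invr.
  apply: (iso_cancel_l K's); apply: heq_trans (comp_assoc _ _ _) _.
  apply: heq_trans (comp_heql _ (inv K')) _.
  apply: heq_trans (comp_idl _) _; apply: heq_sym.
  apply: heq_trans (comp_assoc _ _ _) _.
  apply: heq_trans (comp_heql _ (nat _ _ s)) _.
  apply: heq_trans (comp_assoc' _ _ _) _.
  by apply: heq_trans (comp_heqr _ (inv K)) _; exact: comp_idr.
- apply: heq_trans (comp_heql _ (fmap_comp K' g f)) _.
  apply: heq_trans (comp_assoc' _ _ _) _; apply: heq_trans (comp_heqr _ IHf) _.
  apply: heq_trans (comp_assoc _ _ _) _; apply: heq_trans (comp_heql _ IHg) _.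
  apply: heq_trans (comp_assoc' _ _ _) _; apply: comp_heqr.
  exact/heq_sym/(fmap_comp K g f).
Qed.

Lemma nat_iso_inverted (E : category) (F F' : functor E C)
    (th : forall X, hom (F X) (F' X)) :
  (forall X, S (th X)) ->
  (forall X Y (f : hom X Y), heq (comp (fmap F' f) (th X)) (comp (th Y) (fmap F f))) ->
  nat_iso (comp_functor (loc_functor S) F) (comp_functor (loc_functor S) F').
Proof.
move=> Sth nat; exists (fun X => loc_fwd S (th X)); split=> [X|X Y f].
  exact/loc_fwd_iso/Sth.
apply: loc_trans (loc_sym (loc_fwd_comp _ _ _)) _.
by apply: loc_trans (loc_fwd_comp _ _ _); exact: (loc_fwd_heq S (nat X Y f)).
Qed.

End Localizations.

(** The functors F and G need not be inverse equivalences: unit and counit only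
    have to become isomorphisms in the localizations, and by the universal
    property it is enough to have them natural on C and on D. *)
Lemma loc_map_equivalence (C D : category) (S : forall X Y : C, hom X Y -> Prop)
    (T : forall X Y : D, hom X Y -> Prop) (F : functor C D) (G : functor D C)
    (FS : forall (X Y : C) (s : hom X Y), S X Y s -> T _ _ (fmap F s))
    (GT : forall (X Y : D) (s : hom X Y), T X Y s -> S _ _ (fmap G s)) :
  nat_iso (comp_functor (loc_functor S) (comp_functor G F)) (loc_functor S) ->
  nat_iso (comp_functor (loc_functor T) (comp_functor F G)) (loc_functor T) ->
  is_equivalence (loc_map FS).
Proof.
move=> GF FG; exists (loc_map GT); split; apply: nat_iso_localization.
- exact: GF.
- exact: FG.
Qed.

Lemma loc_map_square (C D C' D' : category)
    (S : forall X Y : C, hom X Y -> Prop) (T : forall X Y : D, hom X Y -> Prop)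
    (S' : forall X Y : C', hom X Y -> Prop) (T' : forall X Y : D', hom X Y -> Prop)
    (F : functor C D) (F' : functor C' D') (I : functor C C') (J : functor D D')
    (FS : forall (X Y : C) (s : hom X Y), S X Y s -> T _ _ (fmap F s))
    (FS' : forall (X Y : C') (s : hom X Y), S' X Y s -> T' _ _ (fmap F' s))
    (IS : forall (X Y : C) (s : hom X Y), S X Y s -> S' _ _ (fmap I s))
    (JT : forall (X Y : D) (s : hom X Y), T X Y s -> T' _ _ (fmap J s)) :
  nat_iso (comp_functor J F) (comp_functor F' I) ->
  nat_iso (comp_functor (loc_map JT) (loc_map FS))
          (comp_functor (loc_map FS') (loc_map IS)).
Proof.
move=> [eta [eta_iso nat]]; apply: nat_iso_localization.
exists (fun X => loc_fwd T' (eta X)); split=> [X|X Y f].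
  exact: (fmap_iso (loc_functor T') (eta_iso X)).
apply: loc_trans (loc_sym (loc_fwd_comp _ _ _)) _.
by apply: loc_trans (loc_fwd_comp _ _ _); exact: (loc_fwd_heq T' (nat X Y f)).
Qed.

Lemma loc_map_functor (C D : category) (S : forall X Y : C, hom X Y -> Prop)
    (T : forall X Y : D, hom X Y -> Prop) (F : functor C D)
    (FS : forall (X Y : C) (s : hom X Y), S X Y s -> T _ _ (fmap F s)) :
  nat_iso (comp_functor (loc_map FS) (loc_functor S))
          (comp_functor (loc_functor T) F).
Proof.
exists (fun X => idm (loc_functor T (F X))); split=> [X|X Y f].
  exact: is_iso_idm.
by apply: loc_trans (loc_idr _) _; apply: loc_sym; exact: loc_idl.
Qed.

(** * Finite dimensional subspaces *)

Section Span.
Variables (k : fieldType) (V : lmodType k).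

Fixpoint in_span (s : seq V) (v : V) : Prop :=
  if s is e :: s' then exists c : k, in_span s' (v - c *: e) else v = 0.

Definition subspace (P : V -> Prop) : Prop :=
  P 0 /\ forall c u v, P u -> P v -> P (c *: u + v).

Definition fin_span (P : V -> Prop) : Prop :=
  exists s, forall v, P v -> in_span s v.

Lemma subspaceZ P c u : subspace P -> P u -> P (c *: u).
Proof. by move=> [P0 PP] Pu; rewrite -[_ *: _]addr0; exact: PP. Qed.

Lemma subspaceD P u v : subspace P -> P u -> P v -> P (u + v).
Proof. by move=> [P0 PP] Pu Pv; rewrite -[u]scale1r; exact: PP. Qed.

Lemma subspaceB P u v : subspace P -> P u -> P v -> P (u - v).
Proof. by move=> [P0 PP] Pu Pv; rewrite addrC -scaleN1r; exact: PP. Qed.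

Lemma subspace_sum P (I : Type) (t : seq I) (F : I -> V) :
  subspace P -> (forall i, P (F i)) -> P (\sum_(i <- t) F i).
Proof.
by move=> sP PF; apply: big_ind => //; [exact: sP.1 | move=> *; exact: subspaceD].
Qed.

Lemma subspaceI P P' : subspace P -> subspace P' ->
  subspace (fun v => P v /\ P' v).
Proof.
move=> [P0 PP] [P0' PP']; split=> // c u v [Pu P'u] [Pv P'v].
by split; [exact: PP | exact: PP'].
Qed.

Lemma span_subspace s : subspace (in_span s).
Proof.
elim: s => [|e s [s0 ss]]; first by split=> [//|c u v /= -> ->]; rewrite scaler0 addr0.
split=> /=; first by exists 0; rewrite scale0r subr0.
move=> c u v [a ua] [b vb]; exists (c * a + b).
suff -> : c *: u + v - (c * a + b) *: e = c *: (u - a *: e) + (v - b *: e).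
  exact: ss.
by rewrite scalerBr scalerA scalerDl opprD addrACA.
Qed.

Lemma mem_in_span s e : e \in s -> in_span s e.
Proof.
elim: s => //= a s IH; rewrite inE; case: eqP => [-> _|_ /= /IH h].
  by exists 1; rewrite scale1r subrr; exact: (span_subspace s).1.
by exists 0; rewrite scale0r subr0.
Qed.

Lemma span_min P s v : subspace P -> (forall e, e \in s -> P e) ->
  in_span s v -> P v.
Proof.
move=> sP; elim: s v => [|e s IH] v Ps /=; first by move=> ->; exact: sP.1.
case=> c /IH Pc; rewrite -[v](subrK (c *: e)); apply: subspaceD => //.
  by apply: Pc => a sa; apply: Ps; rewrite inE sa orbT.
by apply: subspaceZ => //; apply: Ps; rewrite mem_head.
Qed.

Lemma in_span_sub s t v : (forall e, e \in s -> in_span t e) ->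
  in_span s v -> in_span t v.
Proof. by move=> H; apply: span_min => //; exact: span_subspace. Qed.

Lemma in_spanE s v : in_span s v <->
  exists c : 'I_(size s) -> k, v = \sum_(i < size s) c i *: s`_i.
Proof.
elim: s v => [|e s IH] v /=.
  by split=> [->|[c ->]]; [exists (fun=> 0) | ]; rewrite big_ord0.
split=> [[a /IH [c vc]]|[c vc]].
  exists (fun i => if unlift ord0 i is Some j then c j else a).
  rewrite big_ord_recl unlift_none /=; under eq_bigr do rewrite liftK.
  by rewrite -vc addrC subrK.
exists (c ord0); apply/IH; exists (fun i => c (lift ord0 i)).
by rewrite vc big_ord_recl /= addrC addKr.
Qed.

(** By induction on the spanning family: either no element of the subspace
    involves the first vector, or a single such element spans the subspace
    modulo the elements that do not involve it. *)
Lemma span_basis P s : subspace P -> (forall v, P v -> in_span s v) ->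
  exists2 t, (forall e, e \in t -> P e) & forall v, P v -> in_span t v.
Proof.
elim: s P => [|e s IH] P sP Ps; first by exists [::].
have [t tP Pt] : exists2 t, (forall e, e \in t -> P e /\ in_span s e) &
    forall v, P v /\ in_span s v -> in_span t v.
  by apply: IH => [|v []//]; apply: subspaceI => //; exact: span_subspace.
have [[u Pu us]|H] := pselect (exists2 u, P u & ~ in_span s u); last first.
  exists t => [a /tP []//|v Pv]; apply: Pt; split=> //; apply: contrapT => nv.
  by apply: H; exists v.
exists (u :: t) => [a|v Pv /=]; first by rewrite inE => /orP [/eqP ->//|/tP []].
have [a ua] := Ps u Pu; have [b vb] := Ps v Pv.
have a0 : a != 0.
  by apply/eqP => a0; apply: us; move: ua; rewrite a0 scale0r subr0.
exists (b / a); apply: Pt; split; first by apply: subspaceB => //; exact: subspaceZ.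
suff -> : v - (b / a) *: u = (v - b *: e) - (b / a) *: (u - a *: e).
  by apply: subspaceB (span_subspace s) _ _ => //; apply: subspaceZ (span_subspace s) _.
by rewrite scalerBr scalerA divfK // opprB addrA subrK.
Qed.

End Span.

Section SpanMaps.
Variables (k : fieldType) (U V : lmodType k) (phi : U -> V).
Hypothesis phi_lin : linear phi.

Let phiZ c u : phi (c *: u) = c *: phi u.
Proof.
have phi0 : phi 0 = 0.
  by have := phi_lin (-1) 0 0; rewrite scaler0 add0r scaleN1r addNr.
by have := phi_lin c u 0; rewrite phi0 !addr0.
Qed.

Let phiB u v : phi (u - v) = phi u - phi v.
Proof. by rewrite addrC -scaleN1r phi_lin scaleN1r addrC. Qed.

Lemma preimage_subspace (P : V -> Prop) :
  subspace P -> subspace (fun u => P (phi u)).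
Proof.
move=> [P0 PP]; split=> [|c u v Pu Pv]; last by rewrite phi_lin; exact: PP.
by rewrite -(subrr 0) phiB subrr.
Qed.

Lemma in_span_map s u : in_span s u -> in_span (map phi s) (phi u).
Proof.
apply: (@span_min k U (fun u => in_span _ (phi u))).
  exact: (preimage_subspace (span_subspace (map phi s))).
by move=> e es; apply: mem_in_span; exact: map_f.
Qed.

Lemma span_lift (P : U -> Prop) t :
  subspace P -> (forall e, e \in t -> exists2 u, P u & phi u = e) ->
  exists t', forall v, in_span t v -> exists w, [/\ P w, in_span t' w & phi w = v].
Proof.
move=> sP; elim: t => [|e t IH] H.
  exists [::] => v /= ->; exists 0; split=> //; first exact: sP.1.
  by rewrite -(subrr 0) phiB subrr.
have [|t' t'P] := IH; first by move=> x xt; apply: H; rewrite inE xt orbT.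
have [u Pu ue] := H e (mem_head _ _); exists (u :: t') => v [c /t'P [w [Pw wt wv]]].
exists (w + c *: u); split.
- by apply: subspaceD => //; exact: subspaceZ.
- by exists c; rewrite addrK.
- by rewrite addrC phi_lin wv ue addrC subrK.
Qed.

(** The preimage of a finite dimensional space by a map with finite dimensional
    kernel is spanned by the kernel and by lifts of a basis of its image. *)
Lemma fin_span_preimage (P : U -> Prop) s :
  subspace P -> fin_span (fun u => P u /\ phi u = 0) ->
  fin_span (fun u => P u /\ in_span s (phi u)).
Proof.
move=> sP [l0 ker].
have [|v []//|t tP Pt] := @span_basis _ _ (fun v => in_span s v /\
    exists2 u, P u & phi u = v) s.
  split; first split; first exact: (span_subspace s).1.
    by exists 0; [exact: sP.1 | rewrite -(subrr 0) phiB subrr].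
  move=> c x y [sx [u Pu ux]] [sy [v Pv vy]]; split.
    exact: (span_subspace s).2.
  rewrite -ux -vy.
  by exists (c *: u + v); [exact: sP.2 | exact: phi_lin].
have [|l lP] := span_lift sP (t := t); first by move=> e /tP [].
exists (l ++ l0) => u [Pu su].
have [|w [Pw wl wu]] := lP (phi u); first by apply: Pt; split=> //; exists u.
rewrite -[u](subrK w).
apply: (@subspaceD k U (in_span _)); first exact: span_subspace.
  apply: (@in_span_sub _ _ l0) => [e el|]; first by apply: mem_in_span; rewrite mem_cat el orbT.
  by apply: ker; split; [exact: subspaceB | rewrite phiB wu subrr].
by apply: in_span_sub wl => e el; apply: mem_in_span; rewrite mem_cat el.
Qed.

End SpanMaps.

(** M as a vector space over k; a name of its own is needed because M itself
    already carries scalars from A. *)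
Definition kspace (k : fieldType) (A : algType k) (M : lmodType A) : Type := M.

Section KSpace.
Variables (k : fieldType) (A : algType k) (M : lmodType A).
Local Notation kM := (kspace M).

HB.instance Definition _ := GRing.Zmodule.on kM.

Definition kscale (c : k) (m : kM) : kM := (c%:A : A) *: (m : M).

Lemma kscaleA b c m : kscale b (kscale c m) = kscale (b * c) m.
Proof. by rewrite /kscale scalerA -scalerAl mul1r scalerA. Qed.

Lemma kscale1 : left_id 1 kscale.
Proof. by move=> m; rewrite /kscale scale1r scale1r. Qed.

Lemma kscaleDr : right_distributive kscale +%R.
Proof. by move=> c m n; exact: scalerDr. Qed.

Lemma kscaleDl m : {morph kscale^~ m : b c / b + c}.
Proof. by move=> b c; rewrite /kscale scalerDl; exact: scalerDl. Qed.

HB.instance Definition _ := GRing.Zmodule_isLmodule.Build k kM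
  kscaleA kscale1 kscaleDr kscaleDl.

Lemma kspaceZ (c : k) (m : kM) : c *: m = (c%:A : A) *: (m : M).
Proof. by []. Qed.

Lemma kspaceZA (c : k) (a : A) (m : M) : (c *: a) *: m = c *: (a *: m : kM) :> kM.
Proof. by rewrite kspaceZ scalerA -scalerAl mul1r. Qed.

Lemma kspaceAZ (c : k) (a : A) (m : M) : a *: (c *: (m : kM) : M) = c *: (a *: m : kM) :> kM.
Proof. by rewrite -kspaceZA kspaceZ scalerA -scalerAr mulr1. Qed.

End KSpace.

Lemma klinear (k : fieldType) (A : algType k) (M N : lmodType A)
    (phi : {linear M -> N}) : linear (phi : kspace M -> kspace N).
Proof. by move=> c u v; rewrite linearP. Qed.

Lemma finite_dimP (k : fieldType) (A : gralg k) (M : grmod A)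
    (P : kspace M -> Prop) :
  subspace P -> @finite_dim k A M P <-> fin_span P.
Proof.
move=> sP; split=> [[n [e eP]]|[s Ps]].
  exists [seq e i | i <- enum 'I_n] => m /eP [c ->].
  apply: (subspace_sum (P := @in_span k (kspace M) _)) => [|i].
    exact: span_subspace.
  apply: (@subspaceZ k (kspace M)); first exact: span_subspace.
  by apply: mem_in_span; apply: map_f; rewrite mem_enum.
have [t tP Pt] := span_basis sP Ps.
exists (size t), (fun i => t`_i) => m; split=> [/Pt /in_spanE //|[c ->]].
apply: (subspace_sum (P := P)) => // i; apply: (@subspaceZ k (kspace M)) => //.
by apply: tP; exact: mem_nth.
Qed.

(** * Kernels and cokernels of graded maps *)

Section GradedMaps.
Variables (k : fieldType) (A : gralg k) (M N : grmod A).

Lemma part_act i j (a : A) (m : M) :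
  homog (agr A) i a -> part (mgr M) (i + j) (a *: m) = a *: part (mgr M) j m.
Proof.
move=> ha; rewrite {1}[m](gsupp_sum (mgr M)) scaler_sumr part_bigsum.
have H l : part (mgr M) (i + j) (a *: part (mgr M) l m) =
    if l == j then a *: part (mgr M) j m else 0.
  rewrite (part_homog _ (mgr_act ha (homog_part (mgr M) l m))).
  by rewrite (inj_eq (addrI i)) eq_sym; case: eqP => // ->.
rewrite (eq_bigr _ (fun l _ => H l)) -big_mkcond big_const_seq.
have [js|js] := boolP (j \in gsupp (mgr M) m).
  have -> : count (eq_op^~ j) (gsupp (mgr M) m) = 1%N.
    by rewrite count_uniq_mem ?gsupp_uniq // js.
  exact: addr0.
rewrite (gsupp_notin js) scaler0.
by elim: (count _ _) => //= n ->; rewrite addr0.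
Qed.

Lemma grhom_part (s : grhom M N) i m : part (mgr N) i (s m) = s (part (mgr M) i m).
Proof.
rewrite {1}[m](gsupp_sum (mgr M)) raddf_sum part_bigsum.
have H l : part (mgr N) i (s (part (mgr M) l m)) =
    if l == i then s (part (mgr M) i m) else 0.
  rewrite (part_homog _ (ghom_deg s (homog_part (mgr M) l m))) eq_sym.
  by case: eqP => // ->.
rewrite (eq_bigr _ (fun l _ => H l)) -big_mkcond big_const_seq.
have [js|js] := boolP (i \in gsupp (mgr M) m).
  have -> : count (eq_op^~ i) (gsupp (mgr M) m) = 1%N.
    by rewrite count_uniq_mem ?gsupp_uniq // js.
  exact: addr0.
rewrite (gsupp_notin js) linear0.
by elim: (count _ _) => //= n ->; rewrite addr0.
Qed.

End GradedMaps.

Record gsubmod (k : fieldType) (A : gralg k) (M : grmod A) := GSubmod {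
  gsub_pred :> M -> Prop;
  gsubP : graded_submodule gsub_pred }.

Section Submodule.
Variables (k : fieldType) (A : gralg k) (M : grmod A) (P : gsubmod M).

Definition gsub_mem : {pred M} := fun m => `[< P m >].

Lemma gsub_memP m : reflect (P m) (m \in gsub_mem).
Proof. exact: asboolP. Qed.

Lemma gsub_mem_closed : submod_closed gsub_mem.
Proof.
have [P0 PD PZ _] := gsubP P; split; first exact/gsub_memP.
by move=> a u v /gsub_memP Pu /gsub_memP Pv; apply/gsub_memP/PD => //; exact: PZ.
Qed.

HB.instance Definition _ := GRing.isSubmodClosed.Build A M gsub_mem gsub_mem_closed.

Record gsub := GSub { gsub_val : M; gsub_valP : gsub_val \in gsub_mem }.

HB.instance Definition _ := [isSub for gsub_val].
HB.instance Definition _ := [Choice of gsub by <:].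
HB.instance Definition _ := [SubChoice_isSubLmodule of gsub by <:].

Lemma gsub_part_mem i (m : gsub) : part (mgr M) i (gsub_val m) \in gsub_mem.
Proof.
by have [_ _ _ Pp] := gsubP P; apply/gsub_memP/Pp/gsub_memP; case: m.
Qed.

Definition gsub_part i (m : gsub) : gsub := GSub (gsub_part_mem i m).

Lemma gsub_partB i : {morph gsub_part i : u v / u - v}.
Proof.
move=> u v; apply: val_inj; rewrite [RHS]raddfB.
by rewrite -[LHS]/(part (mgr M) i (val (u - v))) raddfB partB.
Qed.

Lemma gsub_partK i j m :
  gsub_part i (gsub_part j m) = if i == j then gsub_part j m else 0.
Proof. by apply: val_inj; rewrite (fun_if val) /= partK; case: ifP. Qed.

Lemma gsub_part_sum m :
  exists2 s : seq int, uniq s & m = \sum_(i <- s) gsub_part i m.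
Proof.
exists (gsupp (mgr M) (gsub_val m)); first exact: gsupp_uniq.
apply: val_inj; rewrite raddf_sum /=; exact: gsupp_sum.
Qed.

Definition gsub_mod : grmod A.
Proof.
refine (@GrMod k A gsub (Grading gsub_partB gsub_partK gsub_part_sum) _).
move=> i j a m ha /(congr1 val) hm; apply: val_inj.
exact: (mgr_act ha (hm : homog (mgr M) j (gsub_val m))).
Defined.

Definition gsub_incl : grhom gsub_mod M.
Proof.
by refine (@GrHom _ _ gsub_mod M (val : gsub -> M) _) => i m /(congr1 val).
Defined.

Definition gquot := {ideal_quot gsub_mem}.

HB.instance Definition _ := GRing.Zmodule.on gquot.

Definition gpi (m : M) : gquot := \pi_{ideal_quot gsub_mem} m.

Lemma gpiB : {morph gpi : u v / u - v}.
Proof. by move=> u v; rewrite /gpi raddfB. Qed.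

Lemma gpiD : {morph gpi : u v / u + v}.
Proof. by move=> u v; rewrite /gpi raddfD. Qed.

Lemma gpi_repr x : gpi (repr x) = x.
Proof. exact: reprK. Qed.

Lemma gpi_eq0 m : gpi m = 0 <-> P m.
Proof.
have e : (gpi m == 0) = (m \in gsub_mem) by exact: quot_eq0.
by split=> [/eqP|Pm]; [rewrite e => /gsub_memP | apply/eqP; rewrite e; exact/gsub_memP].
Qed.

Lemma gpi_eq u v : P (u - v) -> gpi u = gpi v.
Proof. by move=> /gpi_eq0 /eqP; rewrite gpiB subr_eq0 => /eqP. Qed.

Lemma gquot_reprP m : P (repr (gpi m) - m).
Proof. by apply/gpi_eq0; rewrite gpiB gpi_repr subrr. Qed.

Definition gquot_scale (a : A) (x : gquot) : gquot := gpi (a *: repr x).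

Lemma gquot_scaleE a m : gquot_scale a (gpi m) = gpi (a *: m).
Proof.
have [_ _ PZ _] := gsubP P; apply: gpi_eq; rewrite -scalerBr; apply: PZ.
exact: gquot_reprP.
Qed.

Lemma gquot_scaleA a b x : gquot_scale a (gquot_scale b x) = gquot_scale (a * b) x.
Proof. by rewrite -[x]gpi_repr !gquot_scaleE scalerA. Qed.

Lemma gquot_scale1 : left_id 1 gquot_scale.
Proof. by move=> x; rewrite -[x]gpi_repr gquot_scaleE scale1r. Qed.

Lemma gquot_scaleDr : right_distributive gquot_scale +%R.
Proof.
move=> a x y; rewrite -[x]gpi_repr -[y]gpi_repr.
by rewrite -gpiD !gquot_scaleE scalerDr gpiD.
Qed.

Lemma gquot_scaleDl x : {morph gquot_scale^~ x : a b / a + b}.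
Proof. by move=> a b; rewrite /= -[x]gpi_repr !gquot_scaleE scalerDl gpiD. Qed.

HB.instance Definition _ := GRing.Zmodule_isLmodule.Build A gquot
  gquot_scaleA gquot_scale1 gquot_scaleDr gquot_scaleDl.

Definition gquot_part i (x : gquot) : gquot := gpi (part (mgr M) i (repr x)).

Lemma gquot_partE i m : gquot_part i (gpi m) = gpi (part (mgr M) i m).
Proof.
have [_ _ _ Pp] := gsubP P; apply: gpi_eq; rewrite -partB; apply: Pp.
exact: gquot_reprP.
Qed.

Lemma gquot_partB i : {morph gquot_part i : u v / u - v}.
Proof.
move=> x y; rewrite -[x]gpi_repr -[y]gpi_repr.
by rewrite -gpiB !gquot_partE partB gpiB.
Qed.

Lemma gquot_partK i j x :
  gquot_part i (gquot_part j x) = if i == j then gquot_part j x else 0.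
Proof.
rewrite -[x]gpi_repr !gquot_partE partK (fun_if gpi).
by have -> : gpi 0 = 0 by rewrite -(subrr 0) gpiB subrr.
Qed.

Lemma gquot_part_sum x :
  exists2 s : seq int, uniq s & x = \sum_(i <- s) gquot_part i x.
Proof.
rewrite -[x]gpi_repr; exists (gsupp (mgr M) (repr x)); first exact: gsupp_uniq.
rewrite {1}[repr x](gsupp_sum (mgr M)) (big_morph gpi (id1 := 0) gpiD).
  by apply: eq_bigr => i _; rewrite gquot_partE.
by rewrite -(subrr 0) gpiB subrr.
Qed.

Definition gquot_mod : grmod A.
Proof.
refine (@GrMod k A gquot (Grading gquot_partB gquot_partK gquot_part_sum) _).
move=> i j a x ha hx; have {}hx : gquot_part j x = x := hx.
rewrite -hx -[x]gpi_repr gquot_partE /homog /=.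
rewrite -[X in gquot_part _ X]/(gquot_scale a _) gquot_scaleE gquot_partE.
by rewrite (mgr_act ha (homog_part (mgr M) j (repr x))) -gquot_scaleE.
Defined.

Lemma gpi_linear : linear gpi.
Proof. by move=> a u v; rewrite gpiD -gquot_scaleE. Qed.

HB.instance Definition _ := GRing.isLinear.Build A M gquot *:%R gpi gpi_linear.

Definition gquot_proj : grhom M gquot_mod.
Proof.
refine (@GrHom _ _ M gquot_mod gpi _) => i m hm.
by rewrite /homog /= gquot_partE hm.
Defined.

End Submodule.

Section IsomMod.
Variables (k : fieldType) (A : gralg k) (M N : grmod A) (s : grhom M N).

Definition grker : gsubmod M.
Proof.
refine (@GSubmod _ _ M (fun m => s m = 0) _); split.
- exact: linear0.
- by move=> m n sm sn; rewrite linearD sm sn addr0.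
- by move=> a m sm; rewrite linearZ_LR /= sm scaler0.
- by move=> i m sm; rewrite -grhom_part sm part0.
Defined.

Definition grim : gsubmod N.
Proof.
refine (@GSubmod _ _ N (fun n => exists m, s m = n) _); split.
- by exists 0; rewrite linear0.
- by move=> _ _ [m <-] [n <-]; exists (m + n); rewrite linearD.
- by move=> a _ [m <-]; exists (a *: m); rewrite linearZ_LR.
- by move=> i _ [m <-]; exists (part (mgr M) i m); rewrite grhom_part.
Defined.

Lemma isom_modI (T : grmod A -> Prop) :
  T (gsub_mod grker) -> T (gquot_mod grim) -> isom_mod T s.
Proof.
move=> TK TL; exists (gsub_mod grker), (gquot_mod grim), (gsub_incl grker), (gquot_proj grim).
split=> //; split.
- exact: val_inj.
- move=> m; split=> [sm|[x <-]].
    have sm' : m \in gsub_mem grker by apply/gsub_memP.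
    by exists (GSub sm').
  exact: elimT (gsub_memP grker _) (gsub_valP x).
- by move=> n; exact: (gpi_eq0 grim).
- by move=> l; exists (repr l); exact: gpi_repr.
Qed.

(** Spanning families are easier to follow through a functor than the kernel
    and cokernel modules that they stand for. *)
Lemma isom_fdimP : isom_mod (@fdim k A) s <->
  fin_span (fun m : kspace M => s m = 0) /\
  exists l : seq (kspace N), forall n, exists m, in_span l (n - s m).
Proof.
have sT (V : grmod A) : subspace (fun=> True : Prop) (V := kspace V) by [].
split=> [[K [L [i [q [fK fL [i_inj ex1 ex2 q_surj]]]]]]|[kers [l cokers]]].
  have [lK HK] := (finite_dimP (sT K)).1 fK.
  have [lL HL] := (finite_dimP (sT L)).1 fL; split.
    exists (map (i : kspace K -> kspace M) lK) => m /ex1 [x <-].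
    by apply: (in_span_map (klinear i)); exact: HK.
  have [|l lP] := @span_lift k (kspace N) (kspace L) q (klinear q) (fun=> True) lL (sT N).
    by move=> e _; have [n ne] := q_surj e; exists n.
  exists l => n; have [w [_ wl wn]] := lP _ (HL (q n) I).
  have /ex2 [m sm] : q (n - w) = 0 by rewrite linearB wn subrr.
  by exists m; rewrite sm opprB addrC subrK.
apply: isom_modI.
  apply: (finite_dimP (sT (gsub_mod grker))).2; have [l0 l0P] := kers.
  have [] := @fin_span_preimage k (kspace (gsub_mod grker)) (kspace M) _ (klinear (gsub_incl grker))
     (fun=> True) l0 (sT _).
    exists [::] => v [_ v0]; apply: (@val_inj _ _ (gsub grker)); exact: v0.
  move=> t tP; exists t => v _; apply: tP; split=> //; apply: l0P.
  exact: elimT (gsub_memP grker _) (gsub_valP v).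
apply: (finite_dimP (sT (gquot_mod grim))).2.
exists (map (gquot_proj grim : kspace N -> kspace (gquot_mod grim)) l) => x _.
have [m nm] := cokers (repr x).
rewrite -[x]gpi_repr.
have -> : gpi grim (repr x) = gquot_proj grim (repr x - s m).
  by apply: gpi_eq; exists m; rewrite opprB addrC subrK.
exact: (in_span_map (klinear (gquot_proj grim))).
Qed.

End IsomMod.

(** * Torsion modules over an algebra spanned by words *)

(** This is applied to B with the letters x, y and the single idempotent 1, and
    to kQ with the letters f(x), f(y) and the idempotents of the vertices. *)
Section WordAlgebra.
Variables (k : fieldType) (A : gralg k) (lam : bool -> A).

Definition word (w : seq bool) : A := \prod_(l <- w) lam l.

Lemma word_cat u v : word (u ++ v) = word u * word v.
Proof. exact: big_cat. Qed.

Definition torsion (M : lmodType A) (m : M) : Prop :=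
  exists n, forall w, size w = n -> word w *: m = 0.

Lemma torsion_leq (M : lmodType A) (m : M) n :
  (forall w, size w = n -> word w *: m = 0) ->
  forall w, (n <= size w)%N -> word w *: m = 0.
Proof.
move=> H w nw; rewrite -[w](cat_take_drop (size w - n)) word_cat -scalerA.
by rewrite H ?scaler0 // size_drop subKn.
Qed.

(** Only finitely many words have a given length, so that an extension of
    torsion by torsion is torsion. *)
Lemma torsion_ext (M : lmodType A) (m : M) n :
  (forall w, size w = n -> torsion (word w *: m)) -> torsion m.
Proof.
move=> H.
have [c cP] := choice (fun t : n.-tuple bool => H t (size_tuple t)).
exists (\max_t c t + n)%N => w sw; pose p := (\max_t c t)%N.
have ts : size (drop p w) == n by rewrite size_drop sw addKn.
rewrite -[w](cat_take_drop p) word_cat -scalerA -[drop p w]/(tval (Tuple ts)).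
apply: (torsion_leq (cP (Tuple ts))).
by rewrite size_takel ?leq_bigmax // sw leq_addr.
Qed.

Hypothesis lam_homog : forall l, homog (agr A) 1 (lam l).

Lemma word_homog w : homog (agr A) (size w) (word w).
Proof.
rewrite /word; elim: w => [|l w IH]; first by rewrite big_nil; exact: agr_one.
by rewrite big_cons -[size _]/(1 + size w)%N PoszD; exact: agr_mul.
Qed.

Lemma scalar_homog (c : k) : homog (agr A) 0 c%:A.
Proof. by apply: agr_scale; exact: agr_one. Qed.

Lemma part_linear (M : grmod A) i : linear (part (mgr M) i : kspace M -> kspace M).
Proof.
move=> c u v; rewrite partD !kspaceZ; congr (_ + _).
by rewrite -[i in LHS]add0r part_act //; exact: scalar_homog.
Qed.

Variables (V : finType) (eps : V -> A).
Hypothesis eps_homog : forall v, homog (agr A) 0 (eps v).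
Hypothesis eps_word_span : forall a, exists s : seq (k * (V * seq bool)),
  a = \sum_(t <- s) t.1 *: (eps t.2.1 * word t.2.2).

Definition words_lt n : seq (seq bool) :=
  flatten [seq [seq tval t | t : i.-tuple bool] | i <- iota 0 n].

Lemma mem_words_lt n w : (size w < n)%N -> w \in words_lt n.
Proof.
move=> wn; apply/flattenP; exists [seq tval t | t : (size w).-tuple bool].
  by apply: map_f; rewrite mem_iota.
by apply/codomP; exists (in_tuple w).
Qed.

(** If m lies in a finite dimensional graded submodule, long words move its
    components out of the finitely many degrees that occur there. Conversely, if
    the words of length n kill m, then the submodule generated by the components
    m_i is spanned by the eps_v w m_i with w shorter than n. *)
Lemma FdimP (M : grmod A) : Fdim M <-> forall m : M, torsion m.
Proof.
split=> FM m.
- have [P [[P0 PD PZ Pp] [n [e eP]] Pm]] := FM m.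
  pose S := flatten [seq gsupp (mgr M) (e j) | j <- enum 'I_n].
  have PS p i : P p -> i \notin S -> part (mgr M) i p = 0.
    move=> /eP [c ->] iS; rewrite part_bigsum big1 // => j _.
    rewrite -[i]add0r (part_act _ _ (scalar_homog (c j))) gsupp_notin ?scaler0 //.
    apply: contra iS => ij; apply/flattenP; exists (gsupp (mgr M) (e j)) => //.
    by apply: map_f; rewrite mem_enum.
  pose a := (\max_(i <- S) absz i)%N; pose b := (\max_(i <- gsupp (mgr M) m) absz i)%N.
  exists (a + b).+1 => w sw; rewrite [m](gsupp_sum (mgr M)) scaler_sumr.
  rewrite big_seq big1 // => i im; rewrite -(part_act _ _ (word_homog w)).
  apply: PS; first exact: PZ.
  apply/negP => wiS.
  have h1 : (absz ((size w)%:Z + i)%R <= a)%N by apply: (@leq_bigmax_seq _ _ xpredT absz).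
  have h2 : (absz i <= b)%N by apply: (@leq_bigmax_seq _ _ xpredT absz).
  by move: h1 h2; rewrite sw; lia.
- have [n mn] := FM m.
  pose F t := (eps t.1 * word t.2.1) *: part (mgr M) t.2.2 m.
  pose L : seq (kspace M) := [seq F t | t <- allpairs pair (enum V)
    (allpairs pair (words_lt n) (gsupp (mgr M) m))].
  have sL := span_subspace L.
  have LA a i : i \in gsupp (mgr M) m -> in_span L (a *: part (mgr M) i m).
    move=> im; have [s ->] := eps_word_span a; rewrite scaler_suml.
    apply: (@subspace_sum k (kspace M)) => // [[c [v w]]] /=.
    rewrite kspaceZA; apply: subspaceZ => //; have [wn|nw] := ltnP (size w) n.
      apply: mem_in_span; apply/mapP; exists (v, (w, i)) => //.
      by rewrite !allpairs_f ?mem_enum // mem_words_lt.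
    rewrite -scalerA -(part_act _ _ (word_homog w)).
    by rewrite (torsion_leq mn) // part0 scaler0; exact: sL.1.
  exists (in_span L); split.
  + split=> [|u v|a u|i u].
    * exact: sL.1.
    * by move=> Lu Lv; exact: (subspaceD sL Lu Lv).
    * apply: (@span_min k (kspace M) (fun u => in_span L (a *: u))).
        split=> [|c x y Lx Ly]; first by rewrite scaler0; exact: sL.1.
        by rewrite scalerDr kspaceAZ; exact: sL.2.
      move=> _ /mapP [[v [w i]] /allpairsP [[v' [w' i']] /= [_ h [-> -> ->]]] ->].
      have /allpairsP [[w'' i''] /= [_ i''m [_ ei]]] := h.
      by rewrite /F /= scalerA; apply: LA; rewrite ei.
    * apply: (@span_min k (kspace M) (fun u => in_span L (part (mgr M) i u))).
        exact: (preimage_subspace (@part_linear M i) sL).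
      move=> x /mapP [[v [w j]] vwj ->]; rewrite /F /=.
      have hF : homog (mgr M) (0 + (size w)%:Z + j) ((eps v * word w) *: part (mgr M) j m).
        apply: mgr_act (homog_part _ _ _); apply: agr_mul => //; exact: word_homog.
      rewrite (part_homog _ hF); case: ifP => _; last exact: sL.1.
      by apply: mem_in_span; apply/mapP; exists (v, (w, j)).
  + by apply/finite_dimP => //; exists L.
  + rewrite [m](gsupp_sum (mgr M)) big_seq; apply: big_ind => [|u v|i im].
    * exact: sL.1.
    * by move=> Lu Lv; exact: (subspaceD sL Lu Lv).
    * by rewrite -[part _ _ _]scale1r; exact: LA.
Qed.

(** Torsion in the cokernel, said without the cokernel. *)
Lemma isom_FdimP (M N : grmod A) (s : grhom M N) : isom_mod (@Fdim k A) s <->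
  (forall m, s m = 0 -> torsion m) /\
  forall n : N, exists d, forall w, size w = d -> exists m, word w *: n = s m.
Proof.
split=> [[K [L [i [q [/FdimP fK /FdimP fL [i_inj ex1 ex2 q_surj]]]]]]|[kers cokers]].
  split=> [m /ex1 [x <-]|n].
    have [d xd] := fK x; exists d => w /xd e.
    by rewrite -linearZ_LR e linear0.
  have [d nd] := fL (q n); exists d => w /nd e.
  by have /ex2 [m <-] : q (word w *: n) = 0; [rewrite linearZ_LR | exists m].
apply: isom_modI; apply/FdimP => x.
  have [d xd] := kers _ (elimT (gsub_memP (grker s) _) (gsub_valP x)).
  exists d => w /xd e; apply: val_inj; rewrite raddf0 linearZ_LR; exact: e.
have [d xd] := cokers (repr x); exists d => w /xd [m e].
rewrite -[x]gpi_repr -linearZ_LR e; apply/gpi_eq0; by exists m.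
Qed.

End WordAlgebra.

(** * Restriction of scalars *)

Definition res_space (k : fieldType) (B D : gralg k) (f : gralg_hom B D)
  (N : grmod D) : Type := N.

Section Restriction.
Variables (k : fieldType) (B D : gralg k) (f : gralg_hom B D).

Lemma ahomM (a b : B) : f (a * b) = f a * f b. Proof. exact: rmorphM. Qed.
Lemma ahomD (a b : B) : f (a + b) = f a + f b. Proof. exact: rmorphD. Qed.
Lemma ahomB (a b : B) : f (a - b) = f a - f b. Proof. exact: rmorphB. Qed.
Lemma ahom_sum (I : Type) (s : seq I) (F : I -> B) :
  f (\sum_(i <- s) F i) = \sum_(i <- s) f (F i).
Proof. exact: rmorph_sum. Qed.
Lemma ahom1 : f 1 = 1. Proof. exact: rmorph1. Qed.
Lemma ahom0 : f 0 = 0. Proof. exact: rmorph0. Qed.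
Lemma ahomZ c (a : B) : f (c *: a) = c *: f a. Proof. exact: linearZ. Qed.
Lemma ahomX (a : B) n : f (a ^+ n) = f a ^+ n. Proof. exact: rmorphXn. Qed.

Section Object.
Variable N : grmod D.

Local Notation fN := (res_space f N).
HB.instance Definition _ := GRing.Zmodule.on fN.

Definition res_scale (b : B) (n : fN) : fN := f b *: (n : N).

Lemma res_scaleA a b n : res_scale a (res_scale b n) = res_scale (a * b) n.
Proof. by rewrite /res_scale scalerA rmorphM. Qed.

Lemma res_scale1 : left_id 1 res_scale.
Proof. by move=> n; rewrite /res_scale rmorph1 scale1r. Qed.

Lemma res_scaleDr : right_distributive res_scale +%R.
Proof. by move=> b m n; exact: scalerDr. Qed.

Lemma res_scaleDl n : {morph res_scale^~ n : a b / a + b}.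
Proof. by move=> a b; rewrite /res_scale rmorphD scalerDl. Qed.

HB.instance Definition _ := GRing.Zmodule_isLmodule.Build B fN
  res_scaleA res_scale1 res_scaleDr res_scaleDl.

Lemma res_act i j (b : B) (n : fN) :
  homog (agr B) i b -> homog (mgr N) j n -> homog (mgr N) (i + j) (b *: n).
Proof. by move=> hb hn; exact: (mgr_act (ahom_deg f hb) hn). Qed.

Definition res_mod : grmod B := @GrMod k B fN (mgr N) res_act.

End Object.

Lemma res_linear (M N : grmod D) (s : grhom M N) :
  linear (s : res_space f M -> res_space f N).
Proof. by move=> b u v; rewrite linearD; congr (_ + _); exact: linearZ_LR. Qed.

HB.instance Definition _ (M N : grmod D) (s : grhom M N) :=
  GRing.isLinear.Build B (res_space f M) (res_space f N) *:%R
    (s : res_space f M -> res_space f N) (res_linear s).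

Definition res_hom (M N : grmod D) (s : grhom M N) : grhom (res_mod M) (res_mod N) :=
  @GrHom _ _ (res_mod M) (res_mod N) (s : res_space f M -> res_space f N) (@ghom_deg _ _ _ _ s).

Definition res_functor : functor (Gr D) (Gr B).
Proof. by refine (@Functor (Gr D) (Gr B) res_mod res_hom _ _ _). Defined.

End Restriction.

(** * Words in B and paths in kQ *)

Section Labels.
Variable r : nat.
Local Notation Q := (quiverQ r).

Definition label (a : arrow Q) : bool := if a is inr _ then true else false.
Definition plabel (p : qpath Q) : seq bool := map label (parrows p).

Lemma arrow_inj (a b : arrow Q) : asrc a = asrc b -> label a = label b -> a = b.
Proof.
case: a b => a [] b //= e _; first by rewrite e.
by congr inr; apply: val_inj; exact: (congr1 val e).
Qed.

End Labels.

(** All that the proof needs to know about B, kQ and f, apart from their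
    construction. Here false stands for the letter x and true for y;
    letterB_lift is the universal property of B = k<x, y>/(y^{r+1}): operators X
    and Y on a vector space with Y^{r+1} = 0 make it a B-module; path_lift and
    path_gen say that the paths form a basis of kQ. *)
Record path_setting (k : fieldType) (r : nat) := PathSetting {
  algB_of : gralg k;
  algQ_of : gralg k;
  fhom : gralg_hom algB_of algQ_of;
  letterB : bool -> algB_of;
  pe : qpath (quiverQ r) -> algQ_of;
  letterB_homog : forall l, homog (agr algB_of) 1 (letterB l);
  letterB_nilp : letterB true ^+ r.+1 = 0;
  letterB_gen : forall b, exists s : seq (k * seq bool),
    b = \sum_(t <- s) t.1 *: word letterB t.2;
  letterB_lift : forall (V : lmodType k) (X : bool -> V -> V),
    (forall l, linear (X l)) -> (forall v, iter r.+1 (X true) v = 0) ->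
    exists act : algB_of -> V -> V,
      [/\ forall a b v, act a (act b v) = act (a * b) v,
          forall v, act 1 v = v,
          forall a u v, act a (u + v) = act a u + act a v,
          forall a b v, act (a + b) v = act a v + act b v &
          (forall c v, act c%:A v = c *: v) /\
          forall l v, act (letterB l) v = X l v];
  pe_homog : forall p, homog (agr algQ_of) (plength p) (pe p);
  path_mul : forall p q, pe p * pe q = if pconcat p q is Some s then pe s else 0;
  path_one : 1 = \sum_v pe (ptriv v);
  path_gen : forall d, exists s : seq (k * qpath (quiverQ r)),
    d = \sum_(t <- s) t.1 *: pe t.2;
  path_lift : forall (V : lmodType k) (h : qpath (quiverQ r) -> V),
    exists2 g : algQ_of -> V, linear g & forall p, g (pe p) = h p;
  f_letter : forall l,
    fhom (letterB l) = \sum_(a : arrow (quiverQ r) | label a == l) pe (parrow a) }.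

Section Standard.
Variables (k : fieldType) (r : nat).
Local Notation Q := (quiverQ r).

Let letter (l : bool) : grB k r := piB r (if l then fy k else fx k).

Lemma piB_word (w : {fmonom bool}) : piB r << w >> = word letter w.
Proof.
have H (s : seq bool) : exists2 u : {fmonom bool}, u = s :> seq bool & piB r << u >> = word letter s.
  elim: s => [|l s [u us pu]]; first by exists mone; rewrite ?fm1 // /word big_nil.
  exists (mmul (fmu l) u); first by rewrite fmM fmU us.
  rewrite /word big_cons -/(word letter s) -pu -[<< _ >>](_ : << fmu l >> * << u >> = _) ?piBM.
    by congr (_ * _); case: l.
  by rewrite malgM_def fgmulUU mulr1.
by have [u uw <-] := H w; congr (piB r << _ >>); apply: val_inj.
Qed.

Section OperatorModule.
Variables (V : lmodType k) (X : bool -> V -> V).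
Hypothesis X_lin : forall l, linear (X l).
Hypothesis X_nilp : forall v, iter r.+1 (X true) v = 0.

Let op (w : seq bool) (v : V) : V := foldr X v w.
Let act0 (a : free_alg k) (v : V) : V := malg_lift (fun w : {fmonom bool} => op w v) a.

Let X_D l u v : X l (u + v) = X l u + X l v.
Proof. by have := X_lin l 1 u v; rewrite !scale1r. Qed.

Let X_0 l : X l 0 = 0.
Proof. by apply: (addrI (X l 0)); rewrite -X_D !addr0. Qed.

Let X_Z l c v : X l (c *: v) = c *: X l v.
Proof. by have := X_lin l c v 0; rewrite X_0 !addr0. Qed.

Let opD w u v : op w (u + v) = op w u + op w v.
Proof. by elim: w => //= l w IH; rewrite IH X_D. Qed.

Let opZ w c v : op w (c *: v) = c *: op w v.
Proof. by elim: w => //= l w IH; rewrite IH X_Z. Qed.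

Let act0_lin v : linear (act0^~ v).
Proof. exact: malg_lift_linear. Qed.

Let act0_Dl a b v : act0 (a + b) v = act0 a v + act0 b v.
Proof. by have := act0_lin v 1 a b; rewrite !scale1r. Qed.

Let act0_0l v : act0 0 v = 0.
Proof. by apply: (addrI (act0 0 v)); rewrite -act0_Dl !addr0. Qed.

Let act0_U c w v : act0 << c *g w >> v = c *: op w v.
Proof. exact: malg_liftU. Qed.

Let act0_Dr a u v : act0 a (u + v) = act0 a u + act0 a v.
Proof.
by rewrite /act0 /malg_lift -big_split; apply: eq_bigr => w _; rewrite opD scalerDr.
Qed.

Let act0_0r a : act0 a 0 = 0.
Proof. by apply: (addrI (act0 a 0)); rewrite -act0_Dr !addr0. Qed.

Let act0_M a b v : act0 (a * b) v = act0 a (act0 b v).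
Proof.
elim/malg_ind: a => [|a a' ha ha'|c u]; first by rewrite mul0r !act0_0l.
  by rewrite mulrDl !act0_Dl; congr (_ + _).
elim/malg_ind: b => [|b b' hb hb'|d w]; first by rewrite mulr0 !act0_0l act0_0r.
  by rewrite mulrDr !act0_Dl act0_Dr; congr (_ + _).
rewrite [_ * _ in LHS]malgM_def fgmulUU !act0_U opZ scalerA.
by rewrite /op fmM foldr_cat.
Qed.

Let act0_ideal a v : a \in y_ideal r -> act0 a v = 0.
Proof.
case/y_idealP => s ->.
rewrite (big_morph (act0^~ v) (id1 := 0) (op1 := +%R)) ?act0_0l //.
apply: big1 => p _; rewrite !act0_M.
have -> u : act0 (fy k ^+ r.+1) u = 0.
  rewrite -(X_nilp u); elim: r.+1 => [|n IH].
    by rewrite expr0 -[1]/(<< mone >>) act0_U scale1r /op fm1.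
  by rewrite exprS act0_M IH act0_U scale1r /op fmU.
exact: act0_0r.
Qed.

Let act (b : grB k r) (v : V) : V := act0 (repr (b : algB k r)) v.

Let actE a v : act (piB r a) v = act0 a v.
Proof.
rewrite /act -[repr _](subrK a) act0_Dl.
by rewrite (act0_ideal _ (repr_piB r a)) add0r.
Qed.

Lemma algB_operators : exists act : grB k r -> V -> V,
  [/\ forall a b v, act a (act b v) = act (a * b) v,
      forall v, act 1 v = v,
      forall a u v, act a (u + v) = act a u + act a v,
      forall a b v, act (a + b) v = act a v + act b v &
      (forall c v, act c%:A v = c *: v) /\
      forall l v, act (letter l) v = X l v].
Proof.
have act_1 v c : act (c *: 1) v = c *: v.
  rewrite -[1]/(piB r 1) -[_ *: _](piBZ r c 1) actE -[1]/(<< mone >>).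
  have := act0_lin v c << mone >> 0; rewrite !addr0 => ->.
  by rewrite act0_0l addr0 act0_U scale1r /op fm1.
exists act; split=> [a b v|v|a u v|a b v|].
- have -> : a * b = piB r (repr (a : algB k r) * repr (b : algB k r)).
    by rewrite piBM !piB_repr.
  by rewrite actE act0_M.
- by rewrite -[1]scale1r act_1 scale1r.
- exact: act0_Dr.
- have -> : a + b = piB r (repr (a : algB k r) + repr (b : algB k r)).
    by rewrite piBD !piB_repr.
  by rewrite actE act0_Dl.
split=> // l v; rewrite actE; case: l; by rewrite act0_U scale1r /op fmU.
Qed.

End OperatorModule.

(** The algebras and the homomorphism are compared as one tuple, because the
    type of the homomorphism depends on the algebras. *)
Lemma std_setting : exists S : path_setting k r,
  existT (fun BD : gralg k * gralg k => gralg_hom BD.1 BD.2)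
    (algB_of S, algQ_of S) (fhom S) =
  existT (fun BD : gralg k * gralg k => gralg_hom BD.1 BD.2)
    (grB k r, gr_kQ k r) (f_hom k r).
Proof.
pose p0 (p : qpath Q) : gr_kQ k r := << p >>.
suff [H1 H2 H3 H4 [H5 H6 H7 H8 H9]] : [/\ forall l, homog (agr (grB k r)) 1 (letter l),
   letter true ^+ r.+1 = 0,
   forall b : grB k r, exists s : seq (k * seq bool),
     b = \sum_(t <- s) t.1 *: word letter t.2,
   forall p, homog (agr (gr_kQ k r)) (plength p) (p0 p) &
   [/\ forall p q, p0 p * p0 q = if pconcat p q is Some s then p0 s else 0,
   1 = \sum_v p0 (ptriv v),
   forall d, exists s : seq (k * qpath Q), d = \sum_(t <- s) t.1 *: p0 t.2,
   forall (V : lmodType k) (h : qpath Q -> V),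
     exists2 g : gr_kQ k r -> V, linear g & forall p, g (p0 p) = h p &
   forall l, f_hom k r (letter l) = \sum_(a : arrow Q | label a == l) p0 (parrow a)]].
  by exists (@PathSetting k r _ _ (f_hom k r) letter p0 H1 H2 H3 algB_operators H4 H5 H6 H7 H8 H9).
split=> [l||b|p|].
- apply: piB_homog; apply/malg_homogP => w.
  by case: l; rewrite mcoeffU1; case: (eqVneq _ w) => [<- _|_]; rewrite ?eqxx //; congr Posz; exact: fdegU.
- have -> : letter true ^+ r.+1 = piB r (fy k ^+ r.+1).
    by elim: (r.+1) => [|n IH]; rewrite ?expr0 // !exprS IH -piBM.
  apply/eqP; rewrite piB_eq0 -[_ ^+ _]mul1r -[_ * _]mulr1; exact: y_ideal_gen.
- rewrite -[b]piB_repr; elim/malg_ind: (repr b) => [|g h [s Hs] [t Ht]|c w].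
  + by exists [::]; rewrite big_nil; apply/eqP; rewrite piB_eq0 rpred0.
  + by exists (s ++ t); rewrite big_cat /= -Hs -Ht; exact: piBD.
  + exists [:: (c, w : seq bool)]; rewrite big_seq1 /= -piB_word -piBZ.
    by congr piB; apply/malgP => q; rewrite mcoeffZ !mcoeffU mulrnAr mulr1.
- by apply/malg_homogP => q; rewrite path_coeffU; case: (eqVneq _ q) => [<-|_]; rewrite ?eqxx.
split=> [p q||d|V h|l].
- have -> : p0 p * p0 q = opath k (pconcat p q) by exact: pa_mulPP.
  by case: (pconcat p q).
- by [].
- elim/path_alg_ind: d => [|a b [s ->] [t ->]|c a [s ->]|p].
  + by exists [::]; rewrite big_nil.
  + by exists (s ++ t); rewrite big_cat.
  + exists [seq (c * t.1, t.2) | t <- s]; rewrite big_map scaler_sumr.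
    by apply: eq_bigr => t _; rewrite scalerA.
  + by exists [:: (1, p)]; rewrite big_seq1 scale1r.
- exists (malg_lift h); first exact: malg_lift_linear.
  by move=> p; rewrite malg_liftU scale1r.
have pick (I : finType) (h : I -> arrow Q) : injective h ->
    (forall a, label a == l -> exists i, a = h i) -> (forall i, label (h i) == l) ->
    \sum_i p0 (parrow (h i)) = \sum_(a : arrow Q | label a == l) p0 (parrow a).
  move=> h_inj hl lh; rewrite (partition_big h (fun a => label a == l)) //=.
  apply: eq_bigr => a al; have [i ai] := hl a al.
  rewrite (big_pred1 i) ?ai // => j /=; exact: inj_eq.
case: l pick => pick.
- rewrite [LHS]f_hom_y; by apply: pick => // [i j [->]//|[]// i _]; exists i.
- rewrite [LHS]f_hom_x; by apply: pick => // [i j [->]//|[]// i _]; exists i.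
Qed.

End Standard.

Section Combinatorics.
Variables (k : fieldType) (r : nat) (S : path_setting k r).

Local Notation Q := (quiverQ r).
Local Notation kQ := (algQ_of S).
Local Notation B := (algB_of S).
Local Notation f := (fhom S).
Local Notation pe := (@pe k r S).

Definition letterK (l : bool) : kQ := f (letterB S l).
Definition vtx (v : 'I_r.+1) : kQ := pe (ptriv (v : vertex Q)).

Local Notation bword := (word (letterB S)).
Local Notation qword := (word letterK).
Local Notation by_ := (letterB S true).
Local Notation qx := (letterK false).
Local Notation qy := (letterK true).

Lemma letterK_homog l : homog (agr kQ) 1 (letterK l).
Proof. by apply: ahom_deg; exact: letterB_homog. Qed.

Lemma letterK_sum l : letterK l = \sum_(a : arrow Q | label a == l) pe (parrow a).
Proof. exact: f_letter. Qed.

Lemma f_word w : f (bword w) = qword w.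
Proof. exact: rmorph_prod. Qed.

Lemma bword_nseq n : bword (nseq n true) = by_ ^+ n.
Proof. by elim: n => [|n IH]; rewrite /word ?big_nil // big_cons exprS -IH. Qed.

Lemma qword_nseq n : qword (nseq n true) = qy ^+ n.
Proof. by elim: n => [|n IH]; rewrite /word ?big_nil // big_cons exprS -IH. Qed.

Lemma y_homog i : homog (agr kQ) (i%:Z) (qy ^+ i).
Proof.
rewrite -[qy ^+ i]qword_nseq.
by have := word_homog letterK_homog (nseq i true); rewrite size_nseq.
Qed.

Lemma bword_cons l w : bword (l :: w) = letterB S l * bword w.
Proof. exact: big_cons. Qed.

Lemma qword_cons l w : qword (l :: w) = letterK l * qword w.
Proof. exact: big_cons. Qed.

Lemma by_exp0 n : (r < n)%N -> by_ ^+ n = 0.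
Proof. by move=> rn; rewrite -(subnK rn) exprD letterB_nilp mulr0. Qed.

Lemma algB_ind (P : B -> Prop) : P 0 -> (forall a b, P a -> P b -> P (a + b)) ->
  (forall c a, P a -> P (c *: a)) -> (forall w, P (bword w)) -> forall b, P b.
Proof.
move=> P0 PD PZ Pw b; have [s ->] := letterB_gen b.
by apply: big_ind => // t _; exact/PZ/Pw.
Qed.

Lemma kQ_ind (P : kQ -> Prop) : P 0 -> (forall a b, P a -> P b -> P (a + b)) ->
  (forall c a, P a -> P (c *: a)) -> (forall p, P (pe p)) -> forall a, P a.
Proof.
move=> P0 PD PZ Pp d; have [s ->] := path_gen d.
by apply: big_ind => // t _; exact/PZ/Pp.
Qed.

Lemma vtx_homog v : homog (agr kQ) 0 (vtx v).
Proof. exact: (pe_homog S (ptriv (v : vertex Q))). Qed.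

Lemma path_mulE (p q pq : qpath Q) : pconcat p q = Some pq -> pe p * pe q = pe pq.
Proof. by move=> e; rewrite path_mul e. Qed.

Lemma vtx_path v (p : qpath Q) :
  vtx v * pe p = if psrc p == v then pe p else 0.
Proof.
case: eqP => [pv|pv]; first by apply: path_mulE; apply/pconcatP.
by rewrite path_mul /pconcat /ptgt /=; case: eqP => // e; case: pv.
Qed.

Lemma path_vtx v (p : qpath Q) :
  pe p * vtx v = if ptgt p == v then pe p else 0.
Proof.
case: eqP => [pv|pv].
  by apply: path_mulE; apply/pconcatP; split=> //; rewrite cats0.
by rewrite path_mul /pconcat; case: eqP => // e; case: pv.
Qed.

Lemma vtxM u v : vtx u * vtx v = if u == v then vtx v else 0.
Proof. by rewrite vtx_path eq_sym. Qed.

Lemma vtx_sum : \sum_v vtx v = 1.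
Proof. exact/esym/path_one. Qed.

Lemma asrc_parrow (a : arrow Q) : psrc (parrow a) = asrc a. Proof. by []. Qed.
Lemma ptgt_parrow (a : arrow Q) : ptgt (parrow a) = atgt a. Proof. by []. Qed.

(** At each vertex at most one arrow has a given label. *)
Lemma vtx_letter (a : arrow Q) : vtx (asrc a) * letterK (label a) = pe (parrow a).
Proof.
rewrite letterK_sum mulr_sumr.
transitivity (\sum_(b | label b == label a) if b == a then pe (parrow a) else 0).
  apply: eq_bigr => b /eqP lb; rewrite vtx_path asrc_parrow.
  case: (eqVneq b a) => [->|ba]; first by rewrite eqxx.
  by case: eqP => // e; rewrite (arrow_inj e lb) eqxx in ba.
rewrite -big_mkcondr (big_pred1 a) // => b.
by rewrite andbC /=; case: (b =P a) => [->|//]; exact: eqxx.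
Qed.

Lemma path_letter (p : qpath Q) (a : arrow Q) : ptgt p = asrc a ->
  pe p * letterK (label a) = pe p * pe (parrow a).
Proof. by move=> pa; rewrite -vtx_letter mulrA path_vtx pa eqxx. Qed.

Lemma path_x (p : qpath Q) :
  pe p * qx = pe p * pe (parrow (inl (ptgt p) : arrow Q)).
Proof. exact: (path_letter (a := inl (ptgt p) : arrow Q)). Qed.

Lemma path_y (p : qpath Q) (h : (ptgt p < r)%N) :
  pe p * qy = pe p * pe (parrow (inr (Ordinal h) : arrow Q)).
Proof. by apply: (path_letter (a := inr (Ordinal h) : arrow Q)); apply: val_inj. Qed.

Lemma path_y0 (p : qpath Q) : ptgt p = ord_max -> pe p * qy = 0.
Proof.
move=> pr; rewrite letterK_sum mulr_sumr big1 // => a; case: a => // i _.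
rewrite path_mul /pconcat pr; case: eqP => //= /(congr1 val) /= ri.
by have := ltn_ord i; rewrite -ri ltnn.
Qed.

(** Of the paths in f(w) only one starts at a given vertex, as each letter
    can be followed along one arrow only. *)
Lemma vtx_plabel (p : qpath Q) : vtx (psrc p) * qword (plabel p) = pe p.
Proof.
case: p => [[v s] ws]; rewrite /plabel /psrc /parrows /=.
have H : forall s (v : 'I_r.+1) (ws : @is_walk Q v s),
  vtx v * qword (map (@label r) s) = pe (exist _ (v : vertex Q, s) ws).
  elim=> [|a t IH] u wu; first by rewrite /word big_nil mulr1; congr pe; exact: val_inj.
  have /andP [/eqP au wt] := wu; rewrite /= qword_cons mulrA.
  rewrite -{1}au vtx_letter.
  have -> : pe (parrow a) = pe (parrow a) * vtx (atgt a) by rewrite path_vtx eqxx.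
  rewrite -mulrA (IH _ wt); apply: path_mulE.
  by apply/pconcatP; split.
exact: H.
Qed.

Lemma kQ_word_span (a : kQ) : exists s : seq (k * ('I_r.+1 * seq bool)),
  a = \sum_(t <- s) t.1 *: (vtx t.2.1 * qword t.2.2).
Proof.
elim/kQ_ind: a => [|a b [s ->] [t ->]|c a [s ->]|p].
- by exists [::]; rewrite big_nil.
- by exists (s ++ t); rewrite big_cat.
- exists [seq (c * t.1, t.2) | t <- s]; rewrite big_map scaler_sumr.
  by apply: eq_bigr => t _; rewrite scalerA.
- by exists [:: (1, (psrc p, plabel p))]; rewrite big_seq1 scale1r vtx_plabel.
Qed.

Lemma algB_word_span (b : B) : exists s : seq (k * (unit * seq bool)),
  b = \sum_(t <- s) t.1 *: (1 * bword t.2.2).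
Proof.
have [s ->] := letterB_gen b; exists [seq (t.1, (tt, t.2)) | t <- s].
by rewrite big_map; apply: eq_bigr => t _; rewrite mul1r.
Qed.

End Combinatorics.

(** * The comparison maps between kQ and B *)

Section Comparison.
Variables (k : fieldType) (r : nat) (S : path_setting k r).

Local Notation Q := (quiverQ r).
Local Notation kQ := (algQ_of S).
Local Notation B := (algB_of S).
Local Notation f := (fhom S).
Local Notation bword := (word (letterB S)).
Local Notation bx := (letterB S false).
Local Notation by_ := (letterB S true).
Local Notation qx := (letterK S false).
Local Notation qy := (letterK S true).
Local Notation e_ := (@vtx k r S).
Local Notation pe := (@pe k r S).

Lemma f_by n : f (by_ ^+ n) = qy ^+ n.
Proof. exact: ahomX. Qed.

Lemma word_last_x (w : seq bool) : w = nseq (size w) true \/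
  exists u n, w = u ++ false :: nseq n true.
Proof.
elim: w => [|[] w [->|[u [n ->]]]]; first by left.
- by left; rewrite /= size_nseq.
- by right; exists (true :: u), n.
- by right; exists [::], (size w).
- by right; exists (false :: u), n.
Qed.

Lemma word_first_x (w : seq bool) : w = nseq (size w) true \/
  exists n u, w = nseq n true ++ false :: u.
Proof.
elim: w => [|[] w [->|[n [u ->]]]]; first by left.
- by left; rewrite /= size_nseq.
- by right; exists n.+1, u.
- by right; exists 0%N, (nseq (size w) true).
- by right; exists 0%N, (nseq n true ++ false :: u).
Qed.

(** Arrows x lead to the vertex 0 and arrows y to the next vertex, so that the
    target is read off from the letters y after the last x. *)
Lemma plabel_tgt (p : qpath Q) :
  plabel p = nseq (ptgt p - psrc p) true /\ (psrc p <= ptgt p)%N \/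
  exists u, plabel p = u ++ false :: nseq (ptgt p) true.
Proof.
case: p => [[v s] ws]; rewrite /plabel /ptgt /psrc /parrows /=.
have H : forall s (v : 'I_r.+1), @is_walk Q v s ->
    let t := last v (map (@atgt Q) s) : 'I_r.+1 in
    map (@label r) s = nseq (t - v) true /\ (v <= t)%N \/
    exists u, map (@label r) s = u ++ false :: nseq t true.
  elim=> [|a s' IH] u /=; first by left; rewrite subnn.
  case: a => i /= /andP [/eqP <- /IH] [[-> it]|[u' ->]].
  - by right; exists [::]; rewrite subn0.
  - by right; exists (false :: u').
  - left; split; last by apply: leq_trans it; rewrite leqnSn.
    by rewrite -[true :: _]/(nseq (_.+1) true) lift0 subnS prednK ?subn_gt0.
  - by right; exists (true :: u').
exact: H.
Qed.

Section FixedSource.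
Variable v : 'I_r.+1.

(** On e_v kQ this lifts to B the inverse of the bijection induced by f from
    B / y^{r+1-v} B; the lift is right linear only modulo y^{r+1-v} B. *)
Lemma pathB_ex : exists g : {linear kQ -> B},
  forall p, g (pe p) = if psrc p == v then bword (plabel p) else 0.
Proof.
have [g g_lin gE] := path_lift S (fun p => if psrc p == v then bword (plabel p) else 0).
pose R := GRing.isLinear.Build k kQ B *:%R g g_lin.
pose gL : {linear kQ -> B} := HB.pack g R.
by exists gL.
Qed.

Definition pathB : {linear kQ -> B} := sval (cid pathB_ex).

Lemma pathBE p : pathB (pe p) = if psrc p == v then bword (plabel p) else 0.
Proof. exact: svalP (cid pathB_ex) p. Qed.

Lemma pathB_0 : pathB 0 = 0. Proof. exact: linear0. Qed.
Lemma pathB_D a b : pathB (a + b) = pathB a + pathB b. Proof. exact: linearD. Qed.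
Lemma pathB_Z c a : pathB (c *: a) = c *: pathB a. Proof. exact: linearZ. Qed.

Lemma vtx_f_pathB d : e_ v * f (pathB d) = e_ v * d.
Proof.
elim/kQ_ind: d => [|a b ha hb|c a ha|p].
- by rewrite pathB_0 ahom0.
- by rewrite pathB_D ahomD !mulrDr ha hb.
- by rewrite pathB_Z ahomZ -!scalerAr ha.
- rewrite pathBE vtx_path; case: eqP => [<-|_]; last by rewrite ahom0 mulr0.
  by rewrite f_word vtx_plabel.
Qed.

Lemma pathB_vtx u d : pathB (e_ u * d) = if u == v then pathB d else 0.
Proof.
elim/kQ_ind: d => [|a b ha hb|c a ha|p].
- by rewrite mulr0 pathB_0 if_same.
- by rewrite mulrDr !pathB_D ha hb; case: ifP; rewrite ?addr0.
- by rewrite -scalerAr !pathB_Z ha; case: ifP; rewrite ?scaler0.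
- rewrite vtx_path pathBE; case: (eqVneq (psrc p) u) => [pu|pu].
    by rewrite pathBE pu; case: (u == v).
  rewrite pathB_0; case: (eqVneq u v) => // uv; rewrite uv in pu.
  by rewrite (negPf pu).
Qed.

Lemma pathB_vtx1 u : pathB (e_ u) = if u == v then 1 else 0.
Proof. by rewrite pathBE /plabel /= /word big_nil. Qed.

Lemma pathB1 : pathB 1 = 1.
Proof.
rewrite -vtx_sum linear_sum (eq_bigr (fun u => if u == v then 1 else 0)).
  by rewrite -big_mkcond big_pred1_eq.
by move=> u _; exact: pathB_vtx1.
Qed.

Definition in_yB (b : B) : Prop := exists b', b = by_ ^+ (r.+1 - v) * b'.

Lemma in_yB0 : in_yB 0.
Proof. by exists 0; rewrite mulr0. Qed.

Lemma in_yBD a b : in_yB a -> in_yB b -> in_yB (a + b).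
Proof. by move=> [a' ->] [b' ->]; exists (a' + b'); rewrite mulrDr. Qed.

Lemma in_yBZ c a : in_yB a -> in_yB (c *: a).
Proof. by move=> [a' ->]; exists (c *: a'); rewrite scalerAr. Qed.

Lemma in_yBM a b : in_yB a -> in_yB (a * b).
Proof. by move=> [a' ->]; exists (a' * b); rewrite mulrA. Qed.

(** A path from v ending at r has a word w such that w y is a multiple
    of y^{r+1-v}, although the path cannot be continued by an arrow y. *)
Lemma pathB_letter d l :
  in_yB (pathB (d * letterK S l) - pathB d * letterB S l).
Proof.
elim/kQ_ind: d => [|a b ha hb|c a ha|p].
- by rewrite !mul0r pathB_0 mul0r subrr; exact: in_yB0.
- rewrite mulrDl !pathB_D mulrDl opprD addrACA; exact: in_yBD.
- by rewrite -scalerAl !pathB_Z -scalerAl -scalerBr; exact: in_yBZ.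
have cont (a : arrow Q) : ptgt p = asrc a ->
    pathB (pe p * pe (parrow a)) = pathB (pe p) * letterB S (label a).
  move=> pa; have [|q pq] := @pconcat_def _ p (parrow a); first by rewrite pa.
  have [_ sq aq] := (pconcatP _ _ _).1 pq.
  rewrite (path_mulE S pq) !pathBE sq; case: eqP => _; last by rewrite mul0r.
  by rewrite /plabel aq map_cat word_cat /= {2}/word big_seq1.
case: l; last first.
  by rewrite path_x cont // subrr; exact: in_yB0.
have [tr|rt] := ltnP (ptgt p) r.
  by rewrite (path_y S tr) cont ?subrr; [exact: in_yB0 | exact: val_inj].
have pr : ptgt p = ord_max.
  by apply: val_inj; apply/eqP; rewrite eqn_leq rt andbT -ltnS ltn_ord.
rewrite path_y0 // pathB_0 sub0r pathBE; case: eqP => [pv|_]; last first.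
  by rewrite mul0r oppr0; exact: in_yB0.
rewrite -scaleN1r; apply: in_yBZ.
case: (plabel_tgt p) => [[-> _]|[u ->]]; rewrite pr.
  exists 1; rewrite mulr1 bword_nseq -exprSr pv; congr (_ ^+ _).
  by rewrite subSn // -ltnS ltn_ord.
rewrite word_cat bword_cons bword_nseq -!mulrA -exprSr letterB_nilp !mulr0.
exact: in_yB0.
Qed.

Lemma pathB_mul d b : in_yB (pathB (d * f b) - pathB d * b).
Proof.
elim/algB_ind: b => [|a b ha hb|c a ha|w].
- by rewrite ahom0 !mulr0 pathB_0 subrr; exact: in_yB0.
- by rewrite ahomD !mulrDr pathB_D opprD addrACA; exact: in_yBD.
- by rewrite ahomZ -!scalerAr pathB_Z -scalerBr; exact: in_yBZ.
elim: w d => [|l w IH] d.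
  by rewrite /word big_nil ahom1 !mulr1 subrr; exact: in_yB0.
rewrite bword_cons ahomM !mulrA.
rewrite -(subrK (pathB (d * letterK S l) * bword w) (pathB _)) -addrA.
by rewrite -mulrBl; apply: in_yBD (IH _) _; exact/in_yBM/pathB_letter.
Qed.

(** Multiplication by y^v kills y^{r+1-v} B, the obstruction to right
    linearity. *)
Definition ypathB (d : kQ) : B := by_ ^+ v * pathB d.

Lemma ypathB_linear : linear ypathB.
Proof. by move=> c a b; rewrite /ypathB linearP mulrDr -scalerAr. Qed.

HB.instance Definition _ := GRing.isLinear.Build k kQ B *:%R ypathB ypathB_linear.

Lemma ypathB_mul d b : ypathB (d * f b) = ypathB d * b.
Proof.
apply/eqP; rewrite -subr_eq0 -mulrA -mulrBr.
have [b' ->] := pathB_mul d b.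
by rewrite mulrA -exprD subnKC ?letterB_nilp ?mul0r //; exact: ltnW.
Qed.

Lemma ypathB_f b : ypathB (f b) = by_ ^+ v * b.
Proof. by rewrite -[f b]mul1r ypathB_mul /ypathB pathB1 mulr1. Qed.

End FixedSource.

Lemma pathB0_f b : pathB ord0 (f b) = b.
Proof. by have := ypathB_f ord0 b; rewrite /ypathB !mul1r. Qed.

Lemma pathB0_mul d b : pathB ord0 (d * f b) = pathB ord0 d * b.
Proof. by have := ypathB_mul ord0 d b; rewrite /ypathB !mul1r. Qed.

Lemma qx_vtx v : qx * e_ v = if v == ord0 then qx else 0.
Proof.
case: eqP => [->|/eqP v0]; rewrite letterK_sum mulr_suml.
  by apply: eq_bigr => [] [] // i _; rewrite path_vtx.
by rewrite big1 // => [] [] // i _; rewrite path_vtx ptgt_parrow /= eq_sym (negPf v0).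
Qed.

Lemma vtx_y (v u : 'I_r.+1) : u = v.+1 :> nat -> e_ v * qy = qy * e_ u.
Proof.
move=> uv; have vr : (v < r)%N by rewrite -ltnS -uv.
pose a := inr (Ordinal vr) : arrow Q.
have -> : e_ v * qy = pe (parrow a).
  rewrite -vtx_letter; congr (e_ _ * _); exact: val_inj.
rewrite letterK_sum mulr_suml.
transitivity (\sum_(b : arrow Q | label b == true) if b == a then pe (parrow a) else 0).
  rewrite -big_mkcondr (big_pred1 a) // => b.
  by rewrite andbC /=; case: (b =P a) => [->|].
apply: eq_bigr => [] [] // i _; rewrite path_vtx ptgt_parrow.
suff -> : (lift ord0 i == u) = (inr i == a :> arrow Q) by case: eqP => [->|].
apply/eqP/eqP => [iu|[->]]; last by apply: ord_inj; rewrite lift0 uv.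
by congr inr; apply: val_inj; move/eqP: uv; rewrite -iu lift0 eqSS => /eqP.
Qed.

Lemma qxy_vtx (v : 'I_r.+1) : qx * qy ^+ v * e_ v = qx * qy ^+ v.
Proof.
case: v => n /= nr; elim: n nr => [|n IH] nr.
  by rewrite expr0 mulr1 qx_vtx.
have nr' := ltnW nr.
by rewrite exprSr -!mulrA -(@vtx_y (Ordinal nr')) // !mulrA -[qx * _ * _ in LHS]mulrA -{1}(IH nr') !mulrA.
Qed.

Lemma vtx_y_exp0 (v : 'I_r.+1) n : (r < v + n)%N -> e_ v * qy ^+ n = 0.
Proof.
elim: n v => [|n IH] v; first by rewrite addn0 leqNgt ltn_ord.
move=> h; have [vr|rv] := ltnP v r.
  rewrite exprS mulrA (@vtx_y _ (lift ord0 (Ordinal vr))) // -mulrA.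
  by rewrite IH ?mulr0 // lift0 addSnnS.
rewrite exprS mulrA path_y0 ?mul0r //; apply: val_inj; apply/eqP.
by rewrite eqn_leq rv andbT -ltnS ltn_ord.
Qed.

(** After multiplication by a word of length r+1 every element of kQ comes
    from B: such a word is 0 or ends with some x y^v, v <= r, and x y^v
    ends at the vertex v only. *)
Lemma word_descent (w : seq bool) : size w = r.+1 ->
  exists rho : {linear kQ -> B},
    [/\ forall d b, rho (d * f b) = rho d * b,
        forall b, rho (f b) = bword w * b &
        forall d, f (rho d) = f (bword w) * d].
Proof.
move=> sw; case: (word_last_x w) => [ew|[u [n ew]]].
  exists (\0 : {linear kQ -> B}).
  have w0 : bword w = 0 by rewrite ew sw bword_nseq letterB_nilp.
  by rewrite w0; split=> [d b|b|d]; rewrite /= ?mul0r ?ahom0 ?mul0r.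
have nr : (n < r.+1)%N.
  by rewrite -sw ew size_cat /= size_nseq addnS ltnS leq_addl.
pose v := Ordinal nr; pose rho d := bword u * bx * ypathB v d.
have rho_lin : linear rho.
  by move=> c a b; rewrite /rho linearP mulrDr -scalerAr.
pose R := GRing.isLinear.Build k kQ B *:%R rho rho_lin.
pose rhoL : {linear kQ -> B} := HB.pack rho R.
have we : bword w = bword u * bx * by_ ^+ v.
  by rewrite ew word_cat bword_cons bword_nseq mulrA.
exists rhoL; split=> [d b|b|d] /=; rewrite /rho.
- by rewrite ypathB_mul mulrA.
- by rewrite ypathB_f we mulrA.
have xd : f (bx * by_ ^+ v) * d = f (bx * ypathB v d).
  rewrite /ypathB mulrA [RHS]ahomM ahomM f_by.
  by rewrite -qxy_vtx -!mulrA vtx_f_pathB.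
by rewrite we -!mulrA !(ahomM _ (bword u)) -mulrA xd.
Qed.

End Comparison.

(** * The equivalence of the large quotient categories *)

Section Adjunction.
Variables (k : fieldType) (B D : gralg k) (f : gralg_hom B D).

Lemma tpureBr (M : grmod B) d (m m' : M) :
  tpure f d (m - m') = tpure f d m - tpure f d m'.
Proof. by apply/eqP; rewrite eq_sym subr_eq -tpureDr subrK. Qed.

Section Unit.
Variable M : grmod B.

Definition unit_map (m : M) : res_space f (tens_mod f M) := tpure f 1 m.

Lemma unit_map_linear : linear unit_map.
Proof.
move=> b u v; rewrite /unit_map tpureDr -tpure_bal mul1r.
by rewrite -[X in tpure _ X u]mulr1 -tpureZ.
Qed.

HB.instance Definition _ := GRing.isLinear.Build B M (res_space f (tens_mod f M))
  *:%R unit_map unit_map_linear.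

Definition unit_hom : grhom M (res_mod f (tens_mod f M)).
Proof.
refine (@GrHom _ _ M (res_mod f (tens_mod f M)) unit_map _) => i m hm.
by rewrite /homog /= (tens_part_homog f i (agr_one D) hm) add0r eqxx.
Defined.

End Unit.

Section TensHom.
Variables (M : grmod B) (N : grmod D) (h : D -> M -> N).
Hypothesis hDl : forall d d' m, h (d + d') m = h d m + h d' m.
Hypothesis hDr : forall d m m', h d (m + m') = h d m + h d m'.
Hypothesis h_bal : forall d b m, h (d * f b) m = h d (b *: m).
Hypothesis hA : forall a d m, h (a * d) m = a *: h d m.
Hypothesis h_deg : forall i j d m,
  homog (agr D) i d -> homog (mgr M) j m -> homog (mgr N) (i + j) (h d m).

Let lh : tens f M -> N := tens_lift h.

Let lhE d m : lh (tpure f d m) = h d m.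
Proof. exact: tens_liftE. Qed.

Let lhB : {morph lh : x y / x - y}.
Proof. exact: tens_liftB. Qed.

Let lh_linear : linear lh.
Proof.
move=> a x y; rewrite (morphBD lhB); congr (_ + _).
elim/tens_ind: x => [|x z hx hz|d m].
- by rewrite scaler0 (morphB0 lhB) scaler0.
- by rewrite scalerBr !lhB hx hz scalerBr.
- by rewrite tpureZ !lhE hA.
Qed.

Lemma tens_ghom : exists g : grhom (tens_mod f M) N, forall d m, g (tpure f d m) = h d m.
Proof.
pose R := GRing.isLinear.Build D (tens f M) N *:%R lh lh_linear.
pose lhL : {linear tens f M -> N} := HB.pack lh R.
unshelve eexists; first refine (@GrHom _ _ (tens_mod f M) N lhL _); last exact: lhE.
move=> i x hx; change (homog (mgr N) i (lh x)); rewrite -[x]hx {hx} /=.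
elim/tens_homog_ind: x => [|x y hx hy|i' j' d m hd hm].
- by rewrite tens_part0 (morphB0 lhB) /homog part0.
- by rewrite tens_partB lhB /homog partB hx hy.
rewrite (tens_part_homog f i hd hm); case: eqP => [->|_]; last first.
  by rewrite (morphB0 lhB) /homog part0.
by rewrite lhE; exact: h_deg.
Qed.

End TensHom.

Section Counit.
Variable N : grmod D.

Lemma counit_ex : exists g : grhom (tens_mod f (res_mod f N)) N,
  forall d n, g (tpure f (M := res_mod f N) d n) = d *: (n : N).
Proof.
apply: (@tens_ghom (res_mod f N) N (fun d n => d *: (n : N))) => *.
- exact: scalerDl.
- exact: scalerDr.
- exact/esym/scalerA.
- exact/esym/scalerA.
- exact: (mgr_act (g := N)).
Qed.

Definition counit_hom : grhom (tens_mod f (res_mod f N)) N := sval (cid counit_ex).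

Lemma counit_mapE d n : counit_hom (tpure f (M := res_mod f N) d n) = d *: (n : N).
Proof. exact: (svalP (cid counit_ex)). Qed.

End Counit.

Lemma unit_natural (M N : grmod B) (s : grhom M N) m :
  res_hom f (tens_hom f s) (unit_hom M m) = unit_hom N (s m).
Proof. exact: tens_mapE. Qed.

Lemma counit_natural (M N : grmod D) (s : grhom M N) t :
  s (counit_hom M t) = counit_hom N (tens_hom f (res_hom f s) t).
Proof.
elim/tens_ind: t => [|x y hx hy|d m].
- by rewrite !linear0.
- by rewrite !linearB /= -hx -hy.
- rewrite counit_mapE linearZ_LR [tens_hom _ _ _]tens_mapE.
  exact/esym/counit_mapE.
Qed.

End Adjunction.

Section LargeQuotients.
Variables (k : fieldType) (r : nat) (S : path_setting k r).

Local Notation kQ := (algQ_of S).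
Local Notation B := (algB_of S).
Local Notation f := (fhom S).
Local Notation bword := (word (letterB S)).
Local Notation qword := (word (letterK S)).
Local Notation torsQ := (torsion (letterK S)).

Definition isom_FdimB (M N : grmod B) (s : grhom M N) :=
  isom_FdimP (letterB_homog S) (fun _ : unit => agr_one B) (@algB_word_span k r S) s.

Definition isom_FdimQ (M N : grmod kQ) (s : grhom M N) :=
  isom_FdimP (@letterK_homog k r S) (@vtx_homog k r S) (@kQ_word_span k r S) s.

Lemma torsion_res (N : grmod kQ) (n : N) :
  torsion (letterB S) (M := res_mod f N) n <-> torsQ n.
Proof.
split=> [] [d H]; exists d => w /H e; first by rewrite -f_word; exact: e.
by rewrite -[LHS]/(f (bword w) *: (n : N)) f_word; exact: e.
Qed.

(** By descent on the first factor, a word of length r+1 acts on kQ (x) M as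
    a composite kQ (x) M -> B (x) M = M -> kQ (x) M. Hence it kills the kernel of
    the counit and maps every tensor into the image of the unit. *)
Lemma word_tens (w : seq bool) : size w = r.+1 ->
  exists rho : forall M : grmod B, tens f M -> M,
    [/\ forall M, {morph rho M : x y / x - y},
        forall M t, qword w *: t = tpure f 1 (rho M t),
        forall M m, rho M (tpure f 1 m) = bword w *: m,
        forall (M N : grmod B) (s : grhom M N) t, rho N (tens_hom f s t) = s (rho M t) &
        forall (N : grmod kQ) t, rho (res_mod f N) t = qword w *: counit_hom f N t].
Proof.
move=> /(word_descent S) [rho [rhoM rhof frho]].
pose R (M : grmod B) : tens f M -> M := tens_lift (fun d m => rho d *: m).
have RE M d m : R M (tpure f d m) = rho d *: m.
  by apply: tens_liftE => *; rewrite ?linearD ?scalerDl ?scalerDr ?rhoM ?scalerA.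
have RB M : {morph R M : x y / x - y}.
  by apply: tens_liftB => *; rewrite ?linearD ?scalerDl ?scalerDr ?rhoM ?scalerA.
exists R; split=> [//|M t|M m|M N s t|N t].
- elim/tens_ind: t => [|x y hx hy|d m].
  + by rewrite (morphB0 (RB M)) tpure0r scaler0.
  + by rewrite scalerBr RB tpureBr hx hy.
  + by rewrite RE -tpure_bal mul1r frho f_word tpureZ.
- by rewrite RE -(ahom1 f) rhof mulr1.
- elim/tens_ind: t => [|x y hx hy|d m].
  + by rewrite linear0 !(morphB0 (RB _)) linear0.
  + by rewrite linearB /= !RB hx hy linearB.
  + by rewrite /= tens_mapE !RE linearZ_LR.
- elim/tens_ind: t => [|x y hx hy|d m].
  + by rewrite (morphB0 (RB _)) linear0 scaler0.
  + by rewrite RB hx hy linearB scalerBr.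
  + rewrite RE counit_mapE scalerA -f_word -frho.
    by [].
Qed.

Lemma isom_unit (M : grmod B) : isom_mod (@Fdim k B) (unit_hom f M).
Proof.
apply/isom_FdimB; split=> [m m0|t]; exists r.+1 => w /word_tens [rho [rB rt rm _ _]].
  by rewrite -rm -[tpure f 1 m]/(unit_hom f M m) m0 (morphB0 (rB M)).
exists (rho M t); rewrite -[RHS]/(tpure f 1 (rho M t)) -rt -f_word.
by [].
Qed.

Lemma isom_counit (N : grmod kQ) : isom_mod (@Fdim k kQ) (counit_hom f N).
Proof.
apply/isom_FdimQ; split=> [t t0|n]; last first.
  exists 0%N => w _; exists (tpure f (M := res_mod f N) (qword w) n); exact/esym/counit_mapE.
exists r.+1 => w /word_tens [rho [_ rt _ _ rc]].
by rewrite rt rc t0 scaler0 tpure0r.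
Qed.

Lemma coker_torsion (A : gralg k) (lam : bool -> A) (M N : grmod A) (s : grhom M N) n :
  torsion lam (gpi (grim s) n) <->
  exists d, forall w, size w = d -> exists m, word lam w *: n = s m.
Proof.
split=> [] [d H]; exists d => w /H.
  by rewrite -linearZ_LR => /gpi_eq0 [m <-]; exists m.
by move=> [m e]; rewrite -linearZ_LR e; apply/gpi_eq0; exists m.
Qed.

Lemma tens_isom_Fdim (M N : grmod B) (s : grhom M N) :
  isom_mod (@Fdim k B) s -> isom_mod (@Fdim k kQ) (tens_hom f s).
Proof.
move=> /isom_FdimB [kers cokers]; apply/isom_FdimQ; split=> [t t0|t].
  apply: (@torsion_ext _ _ _ _ _ r.+1) => w /word_tens [rho [rB rt _ rn _]].
  rewrite rt; have [|d H] := kers (rho M t); first by rewrite -rn t0 (morphB0 (rB N)).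
  exists d => u /H e; rewrite -f_word tpureZ mulr1 -[f _]mul1r tpure_bal e.
  exact: tpure0r.
apply/coker_torsion; apply: (@torsion_ext _ _ _ _ _ r.+1) => w.
move=> /word_tens [rho [_ rt _ _ _]]; rewrite -linearZ_LR rt; apply/coker_torsion.
have [d H] := cokers (rho N t); exists d => u /H [m e].
exists (tpure f 1 m); rewrite /= tens_mapE -e -tpure_bal mul1r -f_word.
by rewrite tpureZ mulr1.
Qed.

Lemma res_isom_Fdim (M N : grmod kQ) (s : grhom M N) :
  isom_mod (@Fdim k kQ) s -> isom_mod (@Fdim k B) (res_hom f s).
Proof.
move=> /isom_FdimQ [kers cokers]; apply/isom_FdimB; split=> [m m0|n].
  exact/torsion_res/kers.
have [d H] := cokers n; exists d => w /H [m e]; exists m.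
by rewrite -[RHS]e -f_word.
Qed.

Definition QGr_tens : functor (QGr B) (QGr kQ) :=
  loc_map (F := tens_functor f) tens_isom_Fdim.

Theorem QGr_tens_equivalence : is_equivalence QGr_tens.
Proof.
apply: (loc_map_equivalence (G := res_functor f) _ res_isom_Fdim).
- apply: nat_iso_sym; apply: (nat_iso_inverted (F := id_functor _)
    (F' := comp_functor (res_functor f) (tens_functor f)) (th := unit_hom f)).
    exact: isom_unit.
  by move=> M N s m; exact: unit_natural.
- apply: (nat_iso_inverted (F' := id_functor _)
    (F := comp_functor (tens_functor f) (res_functor f)) (th := counit_hom f)).
    exact: isom_counit.
  by move=> M N s m; exact: counit_natural.
Qed.

End LargeQuotients.

(** * An inverse on finitely presented modules *)

(** Restriction does not preserve finite presentation: kQ is not finitely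
    generated over B. On finitely presented modules the inverse is tensoring
    with the two-sided ideal I = BxB. It is a B-kQ-bimodule because f maps it
    onto f(x) kQ + f(yx) kQ + ... + f(y^r x) kQ; as a right kQ-module it is the
    sum of the y^j x e_0 kQ, and as a left B-module it is free on the x y^i.
    So I (x) N is the sum of the y^j x (x) e_0 N for 0 <= j <= r. *)
Section IdealTensor.
Variables (k : fieldType) (r : nat) (S : path_setting k r).

Local Notation kQ := (algQ_of S).
Local Notation B := (algB_of S).
Local Notation f := (fhom S).
Local Notation bword := (word (letterB S)).
Local Notation bx := (letterB S false).
Local Notation by_ := (letterB S true).
Local Notation qx := (letterK S false).
Local Notation qy := (letterK S true).
Local Notation e0 := (@vtx k r S ord0).

Lemma qx_vtx0 : qx * e0 = qx.
Proof. by rewrite qx_vtx eqxx. Qed.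

Lemma vtx0_idem : e0 * e0 = e0.
Proof. by rewrite vtxM eqxx. Qed.

(** ** Additive maps of B-modules *)

Lemma algB_homog_span i (b : B) : homog (agr B) i b ->
  exists s : seq (k * seq bool), (forall t, t \in s -> size t.2 = i :> int) /\
    b = \sum_(t <- s) t.1 *: bword t.2.
Proof.
move=> hb; have [s sE] := letterB_gen b.
exists [seq t <- s | (size t.2)%:Z == i]; split=> [t|].
  by rewrite mem_filter => /andP [/eqP].
rewrite -{1}hb sE part_bigsum big_filter [RHS]big_mkcond; apply: eq_bigr => t _.
have h : homog (agr B) (size t.2) (t.1 *: bword t.2).
  by apply: agr_scale; apply: word_homog; exact: letterB_homog.
by rewrite (part_homog _ h) eq_sym.
Qed.

Lemma algB_linear (M N : lmodType B) (phi : M -> N) :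
  {morph phi : u v / u + v} ->
  (forall c u, phi (c%:A *: u) = c%:A *: phi u) ->
  (forall l u, phi (letterB S l *: u) = letterB S l *: phi u) -> linear phi.
Proof.
move=> phiD phiZ phil b u v; rewrite phiD; congr (_ + _).
have phi0 : phi 0 = 0 by apply: (addrI (phi 0)); rewrite -phiD !addr0.
elim/algB_ind: b => [|a b ha hb|c a ha|w].
- by rewrite !scale0r phi0.
- by rewrite !scalerDl phiD ha hb.
- have -> : c *: a = c%:A * a by rewrite -scalerAl mul1r.
  by rewrite -!scalerA phiZ ha.
- elim: w => [|l w IH]; first by rewrite /word big_nil !scale1r.
  by rewrite bword_cons -!scalerA phil IH.
Qed.

(** ** The idempotent part of a module over the path algebra *)

Section Object.
Variable N : grmod kQ.

Definition vtx0_mem : {pred kspace N} := fun n => e0 *: (n : N) == n.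

Lemma vtx0_mem_closed : submod_closed vtx0_mem.
Proof.
split=> [|c u v /eqP hu /eqP hv]; apply/eqP; first exact: scaler0.
by rewrite scalerDr kspaceAZ hu hv.
Qed.

HB.instance Definition _ := GRing.isSubmodClosed.Build k (kspace N) vtx0_mem
  vtx0_mem_closed.

Record vtx0_part := Vtx0Part { vtx0_val : kspace N; vtx0_valP : vtx0_val \in vtx0_mem }.

HB.instance Definition _ := [isSub for vtx0_val].
HB.instance Definition _ := [Choice of vtx0_part by <:].
HB.instance Definition _ := [SubChoice_isSubLmodule of vtx0_part by <:].

Lemma vtx0_mem_proj (n : N) : (e0 *: n : kspace N) \in vtx0_mem.
Proof. by apply/eqP; rewrite scalerA vtx0_idem. Qed.

Definition vtx0_proj (n : N) : vtx0_part := Vtx0Part (vtx0_mem_proj n).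

Definition inN (u : vtx0_part) : N := vtx0_val u.

Lemma inN_inj : injective inN.
Proof. exact: val_inj. Qed.

Lemma inN_D u v : inN (u + v) = inN u + inN v. Proof. by []. Qed.
Lemma inN_Z (c : k) u : inN (c *: u) = c%:A *: inN u. Proof. by []. Qed.
Lemma inN_B u v : inN (u - v) = inN u - inN v. Proof. by []. Qed.

Lemma inN_proj n : inN (vtx0_proj n) = e0 *: n.
Proof. by []. Qed.

Lemma vtx0_inN u : e0 *: inN u = inN u.
Proof. exact/eqP/(vtx0_valP u). Qed.

Lemma vtx0_projD m n : vtx0_proj (m + n) = vtx0_proj m + vtx0_proj n.
Proof. by apply: inN_inj; rewrite inN_D !inN_proj scalerDr. Qed.

Lemma vtx0_projZ (c : k) n : vtx0_proj (c%:A *: n) = c *: vtx0_proj n.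
Proof.
by apply: inN_inj; rewrite inN_Z !inN_proj !scalerA -scalerAl -scalerAr mul1r mulr1.
Qed.

(** ** The B-module *)

(** The family h stands for the sum of the y^j x (x) h j. *)
Definition ideal_fam := {ffun 'I_r.+1 -> vtx0_part}.

HB.instance Definition _ := GRing.Lmodule.on ideal_fam.

(** x and y act on a family by left multiplication on the factors y^j x. *)
Definition fam_act (l : bool) (h : ideal_fam) : ideal_fam :=
  if l then [ffun j : 'I_r.+1 => if j == 0 :> nat then 0 else h (inord j.-1)]
  else [ffun j : 'I_r.+1 => if j == 0 :> nat
          then vtx0_proj (\sum_(i < r.+1) (qy ^+ i * qx) *: inN (h i)) else 0].

Lemma fam_act_linear l : linear (fam_act l).
Proof.
move=> c g h; case: l; apply/ffunP => j; rewrite !ffunE; case: eqP => _;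
  rewrite ?scaler0 ?addr0 ?ffunE //.
rewrite -vtx0_projZ -vtx0_projD; congr vtx0_proj.
rewrite scaler_sumr -big_split; apply: eq_bigr => i _ /=.
by rewrite !ffunE inN_D inN_Z scalerDr !scalerA -scalerAl -scalerAr mul1r mulr1.
Qed.

Lemma fam_act_iter n (h : ideal_fam) j :
  iter n (fam_act true) h j = if (j < n)%N then 0 else h (inord (j - n)).
Proof.
elim: n j => [|n IH] j; first by rewrite subn0 inord_val.
rewrite iterS /fam_act ffunE; case: eqP => [-> //|/eqP j0].
rewrite IH inordK; last by rewrite (leq_ltn_trans (leq_pred _)).
have -> : (j.-1 < n)%N = (j < n.+1)%N by case: (nat_of_ord j) j0.
by case: ifP => // _; rewrite -predn_sub subnS.
Qed.

Lemma fam_act_nilp h : iter r.+1 (fam_act true) h = 0.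
Proof. by apply/ffunP => j; rewrite fam_act_iter ltn_ord ffunE. Qed.

Definition fam_alg : B -> ideal_fam -> ideal_fam :=
  sval (cid (letterB_lift S fam_act_linear fam_act_nilp)).

Definition fam_algP := svalP (cid (letterB_lift S fam_act_linear fam_act_nilp)).

Definition ideal_space : Type := ideal_fam.
HB.instance Definition _ := GRing.Zmodule.on ideal_space.

Lemma fam_algA a b (h : ideal_space) : fam_alg a (fam_alg b h) = fam_alg (a * b) h.
Proof. by have [H _ _ _ _] := fam_algP; exact: H. Qed.

Lemma fam_alg1 : left_id 1 (fam_alg : B -> ideal_space -> ideal_space).
Proof. by have [_ H _ _ _] := fam_algP; exact: H. Qed.

Lemma fam_algDr : right_distributive (fam_alg : B -> ideal_space -> ideal_space) +%R.
Proof. by have [_ _ H _ _] := fam_algP; exact: H. Qed.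

Lemma fam_algDl (h : ideal_space) :
  {morph (fam_alg : B -> ideal_space -> ideal_space)^~ h : a b / a + b}.
Proof. by have [_ _ _ H _] := fam_algP; move=> a b; exact: H. Qed.

HB.instance Definition _ := GRing.Zmodule_isLmodule.Build B ideal_space
  fam_algA fam_alg1 fam_algDr fam_algDl.

Lemma ideal_letter l (h : ideal_space) : letterB S l *: h = fam_act l h.
Proof. by have [_ _ _ _ [_ H]] := fam_algP; exact: H. Qed.

Lemma ideal_scalar (c : k) (h : ideal_space) : (c%:A : B) *: h = c *: (h : ideal_fam).
Proof. by have [_ _ _ _ [H _]] := fam_algP; exact: H. Qed.

(** The element y^j x (x) n. *)
Definition slot (j : 'I_r.+1) (n : N) : ideal_space :=
  [ffun i => if i == j then vtx0_proj n else 0] : ideal_fam.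

Definition coord (h : ideal_space) (j : 'I_r.+1) : N := inN ((h : ideal_fam) j).

Lemma coordD g h j : coord (g + h) j = coord g j + coord h j.
Proof. by rewrite /coord ffunE inN_D. Qed.

Lemma coordB g h j : coord (g - h) j = coord g j - coord h j.
Proof. by rewrite /coord !ffunE inN_B. Qed.

Lemma coord0 j : coord 0 j = 0.
Proof. by rewrite /coord ffunE. Qed.

Lemma coordZ (c : k) h j : coord ((c%:A : B) *: h) j = c%:A *: coord h j.
Proof. by rewrite ideal_scalar /coord ffunE. Qed.

Lemma vtx0_coord h j : e0 *: coord h j = coord h j.
Proof. exact: vtx0_inN. Qed.

Lemma coord_inj g h : coord g =1 coord h -> g = h.
Proof. by move=> gh; apply/ffunP => j; apply: inN_inj; exact: gh. Qed.

Lemma coord_slot i j n : coord (slot j n) i = if i == j then e0 *: n else 0.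
Proof. by rewrite /coord ffunE; case: eqP. Qed.

Lemma coord_y h (j : 'I_r.+1) :
  coord (by_ *: h) j = if j == 0 :> nat then 0 else coord h (inord j.-1).
Proof. by rewrite /coord ideal_letter ffunE; case: eqP. Qed.

Lemma coord_x h (j : 'I_r.+1) : coord (bx *: h) j =
  if j == 0 :> nat then e0 *: \sum_(i < r.+1) (qy ^+ i * qx) *: coord h i else 0.
Proof. by rewrite /coord ideal_letter ffunE; case: eqP. Qed.

Lemma slot_sum h : h = \sum_(j < r.+1) slot j (coord h j).
Proof.
apply: coord_inj => i.
rewrite (big_morph (coord^~ i) (id1 := 0) (op1 := +%R)); last exact: coord0.
  rewrite (eq_bigr (fun j => if j == i then coord h i else 0)).
    by rewrite -big_mkcond big_pred1_eq.
  by move=> j _; rewrite coord_slot eq_sym; case: eqP => [->|//]; rewrite vtx0_coord.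
by move=> g g'; exact: coordD.
Qed.

Lemma slotD j m n : slot j (m + n) = slot j m + slot j n.
Proof.
apply: coord_inj => i; rewrite coordD !coord_slot scalerDr.
by case: eqP; rewrite ?addr0.
Qed.

Lemma slot0 j : slot j 0 = 0.
Proof. by apply: coord_inj => i; rewrite coord_slot coord0 scaler0 if_same. Qed.

Lemma slotB j m n : slot j (m - n) = slot j m - slot j n.
Proof.
apply: coord_inj => i; rewrite coordB !coord_slot scalerBr.
by case: eqP; rewrite ?subr0.
Qed.

Lemma slot_vtx j n : slot j (e0 *: n) = slot j n.
Proof. by apply: coord_inj => i; rewrite !coord_slot scalerA vtx0_idem. Qed.

Lemma slotZ j (c : k) n : slot j (c%:A *: n) = (c%:A : B) *: slot j n.
Proof.
apply: coord_inj => i; rewrite coordZ !coord_slot; case: eqP => _; rewrite ?scaler0 //.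
by rewrite !scalerA -scalerAl -scalerAr mul1r mulr1.
Qed.

Lemma y_slot (i j : 'I_r.+1) n : i = j.+1 :> nat -> by_ *: slot j n = slot i n.
Proof.
move=> ij; apply: coord_inj => a; rewrite coord_y !coord_slot.
have [a0|a0] := eqVneq (a : nat) 0%N.
  by case: eqP => // ai; move: ij; rewrite -ai a0.
suff -> : (inord a.-1 == j) = (a == i) by [].
rewrite -!val_eqE /= inordK ?(leq_ltn_trans (leq_pred _)) //.
by rewrite ij -eqSS prednK ?lt0n.
Qed.

Lemma y_slot_max n : by_ *: slot ord_max n = 0.
Proof.
apply: coord_inj => a; rewrite coord_y coord_slot coord0; case: eqP => // a0.
case: eqP => // /(congr1 val) /=; rewrite inordK ?(leq_ltn_trans (leq_pred _)) //.
move=> ar; have := ltn_ord a; rewrite -[nat_of_ord a]prednK ?ar ?ltnn //.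
by rewrite lt0n; exact/eqP.
Qed.

Lemma y_exp_slot (j : 'I_r.+1) n : by_ ^+ j *: slot ord0 n = slot j n.
Proof.
case: j => j jr; rewrite /=; elim: j jr => [|j IH] jr.
  by rewrite expr0 scale1r; congr slot; apply: val_inj.
by rewrite exprS -scalerA (IH (ltnW jr)); exact: y_slot.
Qed.

Lemma x_slot j n : bx *: slot j n = slot ord0 ((qy ^+ j * qx) *: n).
Proof.
apply: coord_inj => a; rewrite coord_x coord_slot -val_eqE /=; case: eqP => // _.
rewrite (bigD1 j) //= coord_slot eqxx big1 ?addr0; last first.
  by move=> i ij; rewrite coord_slot (negPf ij) scaler0.
by congr (_ *: _); rewrite scalerA -mulrA qx_vtx0.
Qed.

(** ** The grading *)

Lemma vtx0_part_comm i (n : N) : part (mgr N) i (e0 *: n) = e0 *: part (mgr N) i n.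
Proof. by rewrite -[i in LHS]add0r part_act //; exact: vtx_homog. Qed.

Definition ideal_part (i : int) (h : ideal_space) : ideal_space :=
  [ffun j : 'I_r.+1 => vtx0_proj (part (mgr N) (i - j.+1%:Z) (coord h j))] : ideal_fam.

Lemma coord_part i h j : coord (ideal_part i h) j = part (mgr N) (i - j.+1%:Z) (coord h j).
Proof. by rewrite /coord ffunE inN_proj -vtx0_part_comm vtx0_inN. Qed.

Lemma ideal_partB i : {morph ideal_part i : u v / u - v}.
Proof. by move=> g h; apply: coord_inj => j; rewrite coordB !coord_part coordB partB. Qed.

Lemma ideal_partK i j h :
  ideal_part i (ideal_part j h) = if i == j then ideal_part j h else 0.
Proof.
apply: coord_inj => a; rewrite !coord_part partK (inj_eq (addIr _)).
by rewrite (fun_if (coord^~ a)) coord_part coord0.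
Qed.

Lemma ideal_part_slot i (j : 'I_r.+1) n :
  ideal_part i (slot j n) = slot j (part (mgr N) (i - j.+1%:Z) n).
Proof.
apply: coord_inj => a; rewrite coord_part !coord_slot; case: eqP => [->|_].
  exact: vtx0_part_comm.
exact: part0.
Qed.

Lemma ideal_part_sum h :
  exists2 s : seq int, uniq s & h = \sum_(i <- s) ideal_part i h.
Proof.
apply: decomposedW; rewrite [h]slot_sum; apply: decomposed_bigsum => [|j].
  exact: ideal_partB.
rewrite [coord h j](gsupp_sum (mgr N)).
rewrite (big_morph (slot j) (slotD j) (slot0 j)).
apply: decomposed_bigsum => [|i]; first exact: ideal_partB.
apply: (decomposed_homog ideal_partK (i := i + j.+1%:Z)).
by rewrite ideal_part_slot addrK homog_part.
Qed.

Definition ideal_grading : grading ideal_space :=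
  Grading ideal_partB ideal_partK ideal_part_sum.

Lemma ideal_homogP i (h : ideal_space) : homog ideal_grading i h <->
  forall j : 'I_r.+1, homog (mgr N) (i - j.+1%:Z) (coord h j).
Proof.
split=> [hh j|H]; first by rewrite /homog -{2}hh coord_part.
by apply: coord_inj => j; rewrite coord_part; exact: H.
Qed.

Lemma homog_sum (V : zmodType) (G : grading V) i (I : Type) (s : seq I) (F : I -> V) :
  (forall j, homog G i (F j)) -> homog G i (\sum_(j <- s) F j).
Proof.
by move=> H; rewrite /homog part_bigsum; apply: eq_bigr => j _; exact: H.
Qed.

Lemma ideal_letter_homog l i (h : ideal_space) :
  homog ideal_grading i h -> homog ideal_grading (1 + i) (letterB S l *: h).
Proof.
move=> /ideal_homogP hh; apply/ideal_homogP => j; case: l.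
  rewrite coord_y; case: eqP => [_|/eqP j0]; first exact: part0.
  have := hh (inord j.-1); rewrite inordK ?(leq_ltn_trans (leq_pred _)) //.
  have -> : 1 + i - j.+1%:Z = i - (j : nat)%:Z by lia.
  by rewrite prednK ?lt0n.
rewrite coord_x; case: eqP => [->|_]; last exact: part0.
rewrite -[1 + i - _]add0r; apply: mgr_act; first exact: vtx_homog.
apply: homog_sum => a.
have -> : 1 + i - 1%:Z = a.+1%:Z + (i - a.+1%:Z) by lia.
apply: mgr_act (hh a); rewrite -addn1 PoszD.
by apply: agr_mul; [exact: y_homog | exact: letterK_homog].
Qed.

Lemma ideal_act i j (b : B) (h : ideal_space) :
  homog (agr B) i b -> homog ideal_grading j h -> homog ideal_grading (i + j) (b *: h).
Proof.
move=> /algB_homog_span [s [si ->]] hh; rewrite scaler_suml big_seq.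
apply: (big_ind (homog ideal_grading (i + j))) => [|u v hu hv|t /si <-].
- exact: part0.
- by rewrite /homog partD hu hv.
rewrite -[bword _]mul1r scalerAl -scalerA ideal_scalar.
suff /ideal_homogP H : homog ideal_grading ((size t.2)%:Z + j) (bword t.2 *: h).
  apply/ideal_homogP => a; rewrite -ideal_scalar coordZ -[_ - _]add0r.
  by apply: mgr_act (H a); exact: scalar_homog.
elim: t.2 => [|l w IH]; first by rewrite /word big_nil scale1r add0r.
rewrite bword_cons -scalerA -[size _]/(1 + size w)%N PoszD -addrA.
exact: ideal_letter_homog.
Qed.

Definition ideal_mod : grmod B := GrMod ideal_act.

Lemma slot_homog i (j : 'I_r.+1) n :
  homog (mgr N) i n -> homog (mgr ideal_mod) (i + j.+1%:Z) (slot j n).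
Proof. by move=> hn; rewrite /homog /= ideal_part_slot addrK hn. Qed.

End Object.

Section Morphism.
Variables (M N : grmod kQ).

Section Linear.
Variable s : {linear M -> N}.

Definition ideal_map (h : ideal_space M) : ideal_space N :=
  [ffun j => vtx0_proj (s (coord h j))] : ideal_fam N.

Lemma coord_map h j : coord (ideal_map h) j = s (coord h j).
Proof. by rewrite /coord ffunE inN_proj -linearZ_LR vtx0_inN. Qed.

Lemma ideal_map_linear : linear ideal_map.
Proof.
apply: algB_linear => [g h|c h|l h]; apply: coord_inj => j.
- by rewrite coordD !coord_map coordD linearD.
- by rewrite coordZ !coord_map coordZ linearZ_LR.
case: l; rewrite !coord_map.
  by rewrite !coord_y; case: ifP; rewrite ?linear0 ?coord_map.
rewrite !coord_x; case: ifP; rewrite ?linear0 // linearZ_LR linear_sum => _.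
by congr (_ *: _); apply: eq_bigr => i _; rewrite linearZ_LR coord_map.
Qed.

HB.instance Definition _ := GRing.isLinear.Build B (ideal_space M) (ideal_space N)
  *:%R ideal_map ideal_map_linear.

Lemma ideal_map_slot j n : ideal_map (slot j n) = slot j (s n).
Proof.
by apply: coord_inj => i; rewrite coord_map !coord_slot; case: eqP; rewrite ?linear0 ?linearZ_LR.
Qed.

End Linear.

Definition ideal_hom (s : grhom M N) : grhom (ideal_mod M) (ideal_mod N).
Proof.
refine (@GrHom _ _ (ideal_mod M) (ideal_mod N) (ideal_map s) _) => i h /ideal_homogP hh.
by apply/ideal_homogP => j; rewrite coord_map; exact: ghom_deg.
Defined.

End Morphism.

Definition ideal_functor : functor (Gr kQ) (Gr B).
Proof.
refine (@Functor (Gr kQ) (Gr B) ideal_mod ideal_hom _ _ _).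
- by move=> M N g h gh x; apply: coord_inj => j; rewrite !coord_map gh.
- by move=> M x; apply: coord_inj => j; rewrite coord_map.
- by move=> M N P g h x; apply: coord_inj => j; rewrite !coord_map.
Defined.

(** ** Multiplication maps *)

Section Multiplication.
Variable N : grmod kQ.

Definition ideal_mult (h : ideal_space N) : res_space f N :=
  \sum_(j < r.+1) (qy ^+ j * qx) *: coord h j.

Lemma ideal_multE h : ideal_mult h = \sum_(j < r.+1) (qy ^+ j * qx) *: coord h j :> N.
Proof. by []. Qed.

Lemma ideal_mult_slot j n : ideal_mult (slot j n) = (qy ^+ j * qx) *: n :> N.
Proof.
rewrite ideal_multE (bigD1 j) //= coord_slot eqxx big1 ?addr0; last first.
  by move=> i ij; rewrite coord_slot (negPf ij) scaler0.
by rewrite scalerA -mulrA qx_vtx0.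
Qed.

Lemma ideal_mult_linear : linear ideal_mult.
Proof.
have multD : {morph ideal_mult : g h / g + h}.
  move=> g h; rewrite -[RHS]big_split; apply: eq_bigr => j _.
  by rewrite coordD scalerDr.
have mult0 : ideal_mult 0 = 0.
  by apply: big1 => j _; rewrite coord0 scaler0.
apply: algB_linear => [//|c h|l h].
  rewrite [RHS](_ : _ = (c%:A : kQ) *: (ideal_mult h : N)); last first.
    by rewrite -[LHS]/(f c%:A *: (ideal_mult h : N)) ahomZ ahom1.
  rewrite !ideal_multE scaler_sumr; apply: eq_bigr => j _.
  by rewrite coordZ !scalerA -scalerAl -scalerAr mul1r mulr1.
rewrite {1}[h]slot_sum [h in RHS]slot_sum scaler_sumr.
rewrite !(big_morph ideal_mult multD mult0) scaler_sumr; apply: eq_bigr => j _.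
rewrite -[RHS]/(letterK S l *: (ideal_mult (slot j (coord h j)) : N)) ideal_mult_slot.
case: l; last first.
  by rewrite x_slot ideal_mult_slot expr0 mul1r scalerA.
have [jr|rj] := ltnP j r.
  have hi : (j.+1 < r.+1)%N by [].
  rewrite (@y_slot _ (Ordinal hi)) // ideal_mult_slot /=.
  by rewrite scalerA mulrA -exprS.
have -> : j = ord_max.
  by apply: val_inj; apply/eqP; rewrite eqn_leq rj andbT -ltnS ltn_ord.
by rewrite y_slot_max mult0 scalerA mulrA -exprS -f_by letterB_nilp ahom0 mul0r scale0r.
Qed.

HB.instance Definition _ := GRing.isLinear.Build B (ideal_space N) (res_space f N)
  *:%R ideal_mult ideal_mult_linear.

Lemma yx_homog (j : nat) : homog (agr kQ) j.+1%:Z (qy ^+ j * qx).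
Proof.
by rewrite -addn1 PoszD; apply: agr_mul; [exact: y_homog | exact: letterK_homog].
Qed.

Definition ideal_mult_hom : grhom (ideal_mod N) (res_mod f N).
Proof.
refine (@GrHom _ _ (ideal_mod N) (res_mod f N) ideal_mult _) => i h /ideal_homogP hh.
apply: homog_sum => j.
rewrite -[i](subrK j.+1%:Z) addrC; apply: (mgr_act (g := N) (yx_homog j)).
exact: hh.
Defined.

(** The map kQ (x) I (x) N -> N. *)
Definition tens_ideal_hom : grhom (tens_mod f (ideal_mod N)) N :=
  grhom_comp (counit_hom f N) (tens_hom f ideal_mult_hom).

Lemma tens_ideal_homE d h : tens_ideal_hom (tpure f d h) = d *: (ideal_mult h : N).
Proof.
rewrite -[LHS]/(counit_hom f N (tens_hom f ideal_mult_hom (tpure f d h))).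
by rewrite [tens_hom _ _ _]tens_mapE counit_mapE.
Qed.

End Multiplication.

Section Comultiplication.
Variable M : grmod B.

(** The isomorphism e_0 kQ (x) M = B (x) M = M, extended by zero. *)
Definition vtx0_tens (t : tens f M) : M :=
  tens_lift (fun d m => pathB S ord0 d *: m) t.

Lemma vtx0_tensE d m : vtx0_tens (tpure f d m) = pathB S ord0 d *: m.
Proof.
by apply: tens_liftE => *; rewrite ?pathB_D ?scalerDl ?scalerDr ?pathB0_mul ?scalerA.
Qed.

Lemma vtx0_tensB : {morph vtx0_tens : s t / s - t}.
Proof.
by apply: tens_liftB => *; rewrite ?pathB_D ?scalerDl ?scalerDr ?pathB0_mul ?scalerA.
Qed.

Lemma vtx0_tensD : {morph vtx0_tens : s t / s + t}.
Proof. exact: (morphBD vtx0_tensB). Qed.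

Lemma vtx0_tens0 : vtx0_tens 0 = 0.
Proof. exact: (morphB0 vtx0_tensB). Qed.

Lemma vtx0_tens_pure t : e0 *: t = tpure f e0 (vtx0_tens t).
Proof.
elim/tens_ind: t => [|s t hs ht|d m].
- by rewrite scaler0 vtx0_tens0 tpure0r.
- by rewrite scalerBr hs ht vtx0_tensB tpureBr.
- by rewrite vtx0_tensE tpureZ -tpure_bal vtx_f_pathB.
Qed.

Lemma vtx0_tens_vtx t : vtx0_tens (e0 *: t) = vtx0_tens t.
Proof.
by rewrite vtx0_tens_pure vtx0_tensE pathB_vtx1 eqxx scale1r.
Qed.

Lemma vtx0_tens_yx j t :
  vtx0_tens ((qy ^+ j * qx) *: t) = (by_ ^+ j * bx) *: vtx0_tens t.
Proof.
rewrite -qx_vtx0 mulrA -scalerA vtx0_tens_pure tpureZ -mulrA qx_vtx0.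
rewrite -f_by -[qx]/(f bx) -ahomM -[f _]mul1r tpure_bal vtx0_tensE pathB1.
by rewrite scale1r.
Qed.

Definition ideal_comult (h : ideal_space (tens_mod f M)) : M :=
  \sum_(j < r.+1) (by_ ^+ j * bx) *: vtx0_tens (coord h j).

Lemma ideal_comult_slot j t : ideal_comult (slot j t) = (by_ ^+ j * bx) *: vtx0_tens t.
Proof.
rewrite /ideal_comult (bigD1 j) //= coord_slot eqxx big1 ?addr0; last first.
  by move=> i ij; rewrite coord_slot (negPf ij) vtx0_tens0 scaler0.
by rewrite vtx0_tens_vtx.
Qed.

Lemma vtx0_tensZ (c : k) t : vtx0_tens (c%:A *: t) = c%:A *: vtx0_tens t.
Proof.
elim/tens_ind: t => [|s t hs ht|d m].
- by rewrite scaler0 vtx0_tens0 scaler0.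
- by rewrite scalerBr !vtx0_tensB hs ht scalerBr.
- by rewrite tpureZ !vtx0_tensE scalerA -!scalerAl !mul1r pathB_Z.
Qed.

Lemma ideal_comult_linear : linear ideal_comult.
Proof.
have multD : {morph ideal_comult : g h / g + h}.
  move=> g h; rewrite -[RHS]big_split; apply: eq_bigr => j _.
  by rewrite coordD vtx0_tensD scalerDr.
have mult0 : ideal_comult 0 = 0.
  by apply: big1 => j _; rewrite coord0 vtx0_tens0 scaler0.
apply: algB_linear => [//|c h|l h].
  rewrite /ideal_comult scaler_sumr; apply: eq_bigr => j _.
  by rewrite coordZ vtx0_tensZ !scalerA -scalerAl -scalerAr mul1r mulr1.
rewrite {1}[h]slot_sum [h in RHS]slot_sum scaler_sumr.
rewrite !(big_morph ideal_comult multD mult0) scaler_sumr; apply: eq_bigr => j _.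
rewrite ideal_comult_slot; case: l; last first.
  by rewrite x_slot ideal_comult_slot vtx0_tens_yx expr0 mul1r.
have [jr|rj] := ltnP j r.
  have hi : (j.+1 < r.+1)%N by [].
  rewrite (@y_slot _ (Ordinal hi)) // ideal_comult_slot /=.
  by rewrite scalerA mulrA -exprS.
have -> : j = ord_max.
  by apply: val_inj; apply/eqP; rewrite eqn_leq rj andbT -ltnS ltn_ord.
by rewrite y_slot_max mult0 scalerA mulrA -exprS letterB_nilp mul0r scale0r.
Qed.

HB.instance Definition _ := GRing.isLinear.Build B (ideal_space (tens_mod f M)) M
  *:%R ideal_comult ideal_comult_linear.

Lemma pathB0_homog i d : homog (agr kQ) i d -> homog (agr B) i (pathB S ord0 d).
Proof.
have H p : homog (agr B) (plength p) (pathB S ord0 (pe S p)).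
  rewrite pathBE; case: eqP => _; last exact: part0.
  by have := word_homog (letterB_homog S) (plabel p); rewrite size_map.
move=> hd; have [s sE] := path_gen d.
have -> : pathB S ord0 d =
    \sum_(t <- s) if (plength t.2)%:Z == i then t.1 *: pathB S ord0 (pe S t.2) else 0.
  rewrite -{1}hd sE part_bigsum linear_sum; apply: eq_bigr => t _.
  have h : homog (agr kQ) (plength t.2) (t.1 *: pe S t.2).
    by apply: agr_scale; exact: pe_homog.
  rewrite (part_homog _ h) eq_sym; case: eqP => _; [exact: pathB_Z | exact: pathB_0].
apply: homog_sum => t; case: eqP => [<-|_]; last exact: part0.
by apply: agr_scale; exact: H.
Qed.

Lemma vtx0_tens_homog i t :
  homog (mgr (tens_mod f M)) i t -> homog (mgr M) i (vtx0_tens t).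
Proof.
move=> ht; rewrite -[t]ht {ht} /=; elim/tens_homog_ind: t => [|x y hx hy|i' j d m hd hm].
- by rewrite tens_part0 vtx0_tens0 /homog part0.
- by rewrite tens_partB vtx0_tensB /homog partB hx hy.
rewrite (tens_part_homog f i hd hm); case: eqP => [->|_]; last first.
  by rewrite vtx0_tens0 /homog part0.
by rewrite vtx0_tensE; apply: mgr_act hm; exact: pathB0_homog.
Qed.

(** The map I (x) kQ (x) M = I (x) M -> M. *)
Definition ideal_tens_hom : grhom (ideal_mod (tens_mod f M)) M.
Proof.
refine (@GrHom _ _ (ideal_mod (tens_mod f M)) M ideal_comult _) => i h /ideal_homogP hh.
apply: homog_sum => j; rewrite -[i](subrK j.+1%:Z) addrC; apply: mgr_act.
  rewrite -[by_ ^+ j]bword_nseq -addn1 PoszD; apply: agr_mul; last exact: letterB_homog.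
  by have := word_homog (letterB_homog S) (nseq j true); rewrite size_nseq.
exact/vtx0_tens_homog/hh.
Defined.

End Comultiplication.

Lemma ideal_tens_natural (M N : grmod B) (s : grhom M N) h :
  s (ideal_tens_hom M h) = ideal_tens_hom N (ideal_hom (tens_hom f s) h).
Proof.
rewrite /= /ideal_comult linear_sum; apply: eq_bigr => j _.
rewrite linearZ_LR coord_map; congr (_ *: _).
elim/tens_ind: (coord h j) => [|x y hx hy|d m].
- by rewrite linear0 !vtx0_tens0 linear0.
- by rewrite linearB !vtx0_tensB linearB hx hy.
- by rewrite /= tens_mapE !vtx0_tensE linearZ_LR.
Qed.

Lemma tens_ideal_natural (M N : grmod kQ) (s : grhom M N) t :
  s (tens_ideal_hom M t) = tens_ideal_hom N (tens_hom f (ideal_hom s) t).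
Proof.
elim/tens_ind: t => [|x y hx hy|d h].
- by rewrite !linear0.
- by rewrite !linearB hx hy.
have -> : tens_hom f (ideal_hom s) (tpure f d h) = tpure f d (ideal_hom s h).
  exact: tens_mapE.
rewrite !tens_ideal_homE linearZ_LR; congr (_ *: _).
rewrite !ideal_multE linear_sum; apply: eq_bigr => j _.
by rewrite linearZ_LR coord_map.
Qed.

End IdealTensor.

(** * Finite presentations *)

Section Presentations.
Variables (k : fieldType) (A : gralg k) (M : grmod A).

Lemma fin_presI (L J : finType) (d : L -> int) (e : J -> int) (R : L -> J -> A)
    (g : J -> M) :
  (forall l j, homog (agr A) (d l - e j) (R l j)) ->
  (forall j, homog (mgr M) (e j) (g j)) ->
  (forall m, exists c : J -> A, m = \sum_j c j *: g j) ->
  (forall l, \sum_j R l j *: g j = 0) ->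
  (forall c : J -> A, \sum_j c j *: g j = 0 ->
     exists b : L -> A, forall j, c j = \sum_l b l * R l j) ->
  fin_pres M.
Proof.
move=> hR hg gen rel0 rel.
have toJ (V : nmodType) (F : J -> V) : \sum_j F j = \sum_(i < #|J|) F (enum_val i).
  by rewrite (reindex (@enum_val J predT)) //; exact/onW_bij/enum_val_bij.
have toL (V : nmodType) (F : L -> V) : \sum_l F l = \sum_(i < #|L|) F (enum_val i).
  by rewrite (reindex (@enum_val L predT)) //; exact/onW_bij/enum_val_bij.
exists #|L|, #|J|, (fun l => d (enum_val l)), (fun j => e (enum_val j)),
  (\matrix_(l, j) R (enum_val l) (enum_val j)), (fun j => g (enum_val j)).
split=> [l j|j|m|c].
- by rewrite mxE; exact: hR.
- exact: hg.
- have [c ->] := gen m; exists (\row_j c (enum_val j)); rewrite toJ.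
  by apply: eq_bigr => j _; rewrite mxE.
split=> [c0|[b ->]].
  have [|b cb] := rel (fun j => c 0 (enum_rank j)).
    by rewrite toJ -[RHS]c0; apply: eq_bigr => j _; rewrite enum_valK.
  exists (\row_l b (enum_val l)); apply/rowP => j; rewrite mxE -[j in LHS]enum_valK cb toL.
  by apply: eq_bigr => l _; rewrite !mxE.
rewrite (eq_bigr (fun j => \sum_l b 0 l *: (R (enum_val l) (enum_val j) *: g (enum_val j)))).
  rewrite exchange_big big1 // => l _.
  by rewrite -scaler_sumr -(toJ _ (fun j => R (enum_val l) j *: g j)) rel0 scaler0.
by move=> j _; rewrite mxE scaler_suml; apply: eq_bigr => l _; rewrite mxE scalerA.
Qed.

Lemma fin_presE : fin_pres M ->
  exists (p n : nat) (d : 'I_p -> int) (e : 'I_n -> int) (R : 'I_p -> 'I_n -> A)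
    (g : 'I_n -> M),
  [/\ forall l j, homog (agr A) (d l - e j) (R l j),
      forall j, homog (mgr M) (e j) (g j),
      forall m, exists c : 'I_n -> A, m = \sum_j c j *: g j,
      forall l, \sum_j R l j *: g j = 0 &
      forall c : 'I_n -> A, \sum_j c j *: g j = 0 ->
        exists b : 'I_p -> A, forall j, c j = \sum_l b l * R l j].
Proof.
move=> [p [n [d [e [R [g [hR hg gen rel]]]]]]].
exists p, n, d, e, R, g; split=> // [m|l|c c0].
- by have [c ->] := gen m; exists (c 0).
- have := (rel (row l R)).2; rewrite (eq_bigr (fun j => R l j *: g j)).
    by apply; exists (delta_mx 0 l); rewrite -rowE.
  by move=> j _; rewrite mxE.
- have [|b cb] := (rel (\row_j c j)).1.
    by rewrite -[RHS]c0; apply: eq_bigr => j _; rewrite mxE.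
  exists (b 0) => j; have := congr1 (fun x : 'rV_n => x 0 j) cb.
  by rewrite !mxE.
Qed.

End Presentations.

(** ** Extension of scalars *)

Section TensPresentation.
Variables (k : fieldType) (B D : gralg k) (f : gralg_hom B D) (M : grmod B).
Variables (p n : nat) (R : 'I_p -> 'I_n -> B) (g : 'I_n -> M).
Hypothesis gen : forall m, exists c : 'I_n -> B, m = \sum_j c j *: g j.
Hypothesis rel : forall c : 'I_n -> B, \sum_j c j *: g j = 0 ->
  exists b : 'I_p -> B, forall j, c j = \sum_l b l * R l j.

Definition tens_rel_mem : {pred {ffun 'I_n -> D}} := fun c =>
  `[< exists b : 'I_p -> D, forall j, c j = \sum_l b l * f (R l j) >].

Lemma tens_rel_memP (c : {ffun 'I_n -> D}) :
  reflect (exists b : 'I_p -> D, forall j, c j = \sum_l b l * f (R l j))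
          (c \in tens_rel_mem).
Proof. exact: asboolP. Qed.

Lemma tens_rel_closed : zmod_closed tens_rel_mem.
Proof.
split=> [|c c' /tens_rel_memP [b cb] /tens_rel_memP [b' cb']]; apply/tens_rel_memP.
  by exists (fun=> 0) => j; rewrite ffunE big1 // => l _; rewrite mul0r.
exists (fun l => b l - b' l) => j; rewrite !ffunE cb cb' -sumrB.
by apply: eq_bigr => l _; rewrite mulrBl.
Qed.

HB.instance Definition _ := GRing.isZmodClosed.Build _ tens_rel_mem tens_rel_closed.

Local Notation relq := {ideal_quot tens_rel_mem}.
Let pi (c : 'I_n -> D) : relq := \pi_{ideal_quot tens_rel_mem} [ffun j => c j].

Let piD c c' : pi (fun j => c j + c' j) = pi c + pi c'.
Proof.
by rewrite -[RHS]raddfD; congr (\pi _); apply/ffunP => j; rewrite !ffunE.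
Qed.

Let pi_eq c c' : (exists b : 'I_p -> D, forall j, c j - c' j = \sum_l b l * f (R l j)) ->
  pi c = pi c'.
Proof.
move=> [b cb]; apply/eqP; rewrite -subr_eq0 -raddfB quot_eq0; apply/tens_rel_memP.
by exists b => j; rewrite !ffunE.
Qed.

(** By right exactness the relations of D (x) M are those of M: the class of
    (d c_1, ..., d c_n) modulo the relations depends only on d (x) sum c_j g_j. *)
Lemma tens_relations (c : 'I_n -> D) : \sum_j c j *: tpure f 1 (g j) = 0 ->
  exists b : 'I_p -> D, forall j, c j = \sum_l b l * f (R l j).
Proof.
have [co coE] := choice gen.
pose h (d : D) (m : M) : relq := pi (fun j => d * f (co m j)).
have hE d c' : h d (\sum_j c' j *: g j) = pi (fun j => d * f (c' j)).
  set m := \sum_j _; apply: pi_eq; have [|b bE] := @rel (fun j => co m j - c' j).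
    rewrite (eq_bigr (fun j => co m j *: g j - c' j *: g j)).
      by rewrite sumrB -coE subrr.
    by move=> j _; rewrite scalerBl.
  exists (fun l => d * f (b l)) => j.
  rewrite -mulrBr -ahomB bE ahom_sum mulr_sumr; apply: eq_bigr => l _.
  by rewrite ahomM mulrA.
have hDl d d' m : h (d + d') m = h d m + h d' m.
  by rewrite -piD; congr pi; apply/funext => j; rewrite mulrDl.
have hDr d m m' : h d (m + m') = h d m + h d m'.
  rewrite [m]coE [m']coE -big_split (eq_bigr (fun j => (co m j + co m' j) *: g j)).
    by rewrite !hE -piD; congr pi; apply/funext => j; rewrite ahomD mulrDr.
  by move=> j _; rewrite scalerDl.
have h_bal d b m : h (d * f b) m = h d (b *: m).
  have e : b *: m = \sum_j (b * co m j) *: g j.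
    by rewrite {1}[m]coE scaler_sumr; apply: eq_bigr => j _; rewrite scalerA.
  rewrite e [X in h _ X = _]coE !hE; congr pi.
  by apply/funext => j; rewrite ahomM mulrA.
pose lh : tens f M -> relq := tens_lift h; move=> c0; have := congr1 lh c0.
have liftB : {morph lh : x y / x - y} by exact: tens_liftB hDl hDr h_bal.
rewrite (morphB0 liftB) (big_morph lh (morphBD liftB) (morphB0 liftB)).
have pi0 : pi (fun=> 0) = 0.
  by apply: (addrI (pi (fun=> 0))); rewrite -piD !addr0.
rewrite (eq_bigr (fun j => pi (fun i => if i == j then c j else 0))); last first.
  move=> j _; rewrite tpureZ mulr1 [lh _]tens_liftE //.
  have -> : g j = \sum_i (if i == j then 1 else 0) *: g i.
    rewrite (bigD1 j) //= eqxx scale1r big1 ?addr0 // => i ij.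
    by rewrite (negPf ij) scale0r.
  rewrite hE; congr pi; apply/funext => i.
  by case: eqP => _; rewrite ?ahom1 ?mulr1 ?ahom0 ?mulr0.
have piS (F : 'I_n -> 'I_n -> D) : \sum_j pi (F j) = pi (fun i => \sum_j F j i).
  rewrite -raddf_sum; congr (\pi _); apply/ffunP => i; rewrite sum_ffunE !ffunE.
  by apply: eq_bigr => j _; rewrite ffunE.
rewrite piS => /eqP; rewrite quot_eq0 => /tens_rel_memP [b bE].
exists b => j; rewrite -bE ffunE (bigD1 j) //= eqxx big1 ?addr0 // => i ij.
by rewrite eq_sym (negPf ij).
Qed.

End TensPresentation.

Lemma tens_fin_pres (k : fieldType) (B D : gralg k) (f : gralg_hom B D)
    (M : grmod B) : fin_pres M -> fin_pres (tens_mod f M).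
Proof.
move=> /fin_presE [p [n [d [e [R [g [hR hg gen rel0 rel]]]]]]].
apply: (@fin_presI k D (tens_mod f M) _ _ d e (fun l j => f (R l j)) (fun j => tpure f 1 (g j))).
- by move=> l j; apply: ahom_deg; exact: hR.
- move=> j; rewrite /homog /= (tens_part_homog f (e j) (agr_one D) (hg j)).
  by rewrite add0r eqxx.
- move=> t; elim/tens_ind: t => [|x y [c ->] [c' ->]|a m].
  + by exists (fun=> 0); rewrite big1 // => j _; rewrite scale0r.
  + exists (fun j => c j - c' j); rewrite -sumrB; apply: eq_bigr => j _.
    by rewrite scalerBl.
  + have [c ->] := gen m; exists (fun j => a * f (c j)); rewrite tpure_sumr.
    by apply: eq_bigr => j _; rewrite -tpure_bal tpureZ mulr1.
- move=> l; rewrite (eq_bigr (fun j => tpure f 1 (R l j *: g j))).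
    by rewrite -tpure_sumr rel0 tpure0r.
  by move=> j _; rewrite tpureZ mulr1 -tpure_bal mul1r.
- exact: tens_relations.
Qed.

(** ** Tensoring with the ideal I *)

Section IdealPresentation.
Variables (k : fieldType) (r : nat) (S : path_setting k r).

Local Notation Q := (quiverQ r).
Local Notation kQ := (algQ_of S).
Local Notation B := (algB_of S).
Local Notation f := (fhom S).
Local Notation bx := (letterB S false).
Local Notation by_ := (letterB S true).
Local Notation qx := (letterK S false).
Local Notation qy := (letterK S true).
Local Notation e_ := (@vtx k r S).
Local Notation e0 := (@vtx k r S ord0).
Local Notation pe := (@pe k r S).

(** Removing the last arrow shows that right multiplication by x is
    injective, and right multiplication by y as well away from the vertex r. *)
Lemma last_arrow : exists g : {linear kQ -> kQ},
  (forall d, g (d * qx) = d) /\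
  forall d (i : 'I_r.+1), (i < r)%N -> g (d * e_ i * qy) = d * e_ i.
Proof.
pose h (p : qpath Q) : kQ :=
  if insub (psrc p, take (size (parrows p)).-1 (parrows p)) is Some q then pe q else 0.
have [g g_lin gE] := path_lift S h.
pose gR := GRing.isLinear.Build k kQ kQ *:%R g g_lin.
pose gL : {linear kQ -> kQ} := HB.pack g gR.
have ga (q : qpath Q) (a : arrow Q) : ptgt q = asrc a -> g (pe q * pe (parrow a)) = pe q.
  move=> qa; have [|p qp] := @pconcat_def _ q (parrow a); first by rewrite qa.
  have [_ sp ap] := (pconcatP _ _ _).1 qp.
  rewrite (path_mulE S qp) gE /h sp ap size_cat addn1 /= take_size_cat //.
  by rewrite -[(_, _)]surjective_pairing valK.
exists gL; split=> [d|d i ir]; rewrite /=.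
  rewrite -[g]/(gL : kQ -> kQ); elim/kQ_ind: d => [|a b ha hb|c a ha|p].
  - by rewrite mul0r linear0.
  - by rewrite mulrDl linearD ha hb.
  - by rewrite -scalerAl linearZ_LR ha.
  - by rewrite path_x [LHS]ga.
rewrite -[g]/(gL : kQ -> kQ); elim/kQ_ind: d => [|a b ha hb|c a ha|p].
- by rewrite !mul0r linear0.
- by rewrite !mulrDl linearD ha hb.
- by rewrite -!scalerAl linearZ_LR ha.
rewrite path_vtx; case: eqP => [pi|_]; last by rewrite mul0r linear0.
have pr : (ptgt p < r)%N by rewrite pi.
by rewrite (path_y S pr) [LHS]ga //; exact: val_inj.
Qed.

Lemma vtx_y_exp (u v : 'I_r.+1) (i : nat) : v = (u + i)%N :> nat -> e_ u * qy ^+ i = qy ^+ i * e_ v.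
Proof.
elim: i u => [|i IH] u.
  by rewrite addn0 => vu; rewrite !expr0 mulr1 mul1r; congr e_; exact: val_inj.
move=> vu; have hu : (u.+1 < r.+1)%N.
  by rewrite (leq_ltn_trans _ (ltn_ord v)) // vu addnS ltnS leq_addr.
rewrite exprS mulrA (@vtx_y _ _ _ _ (Ordinal hu)) // -!mulrA; congr (_ * _).
by apply: IH; rewrite vu addSnnS.
Qed.

Lemma vtx0_y_exp (i : 'I_r.+1) : e0 * qy ^+ i * e_ i = e0 * qy ^+ i.
Proof. by rewrite (@vtx_y_exp _ i) // -mulrA vtxM eqxx. Qed.

Lemma f_inj b : f b = 0 -> b = 0.
Proof. by move=> fb; rewrite -(pathB0_f b) fb pathB_0. Qed.

(** The ideal I is a free left B-module on the x y^i: right multiplication by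
    e_i isolates the multiple of x y^i, which ends at the vertex i only, and the
    last letters are removed one by one. *)
Lemma ideal_free (b : 'I_r.+1 -> B) :
  \sum_i f (b i) * (qx * qy ^+ i) = 0 -> forall i, b i = 0.
Proof.
move=> b0 i; apply: f_inj.
have [g [gx gy]] := last_arrow.
have {b0} : f (b i) * (qx * qy ^+ i) = 0.
  have := congr1 (fun d => d * e_ i) b0; rewrite mul0r mulr_suml => <-.
  rewrite (bigD1 i) //= -mulrA qxy_vtx big1 ?addr0 // => j ji.
  by rewrite -mulrA -(qxy_vtx S j) -mulrA vtxM (negPf ji) !mulr0.
move: (f (b i)) => c; case: i => i /=; elim: i => [|i IH] ir.
  by rewrite expr0 mulr1 => h; rewrite -(gx c) h linear0.
move=> h; apply: (IH (ltnW ir)); pose o := Ordinal (ltnW ir).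
have e : qx * qy ^+ i * e_ o = qx * qy ^+ i := qxy_vtx S o.
rewrite -e mulrA -gy //.
by rewrite -[c * _ * _]mulrA e -[c * _ * _]mulrA -mulrA -exprSr h linear0.
Qed.

(** The element x y^i (x) n. *)
Definition hgen (N : grmod kQ) (i : nat) (n : N) : ideal_space N := slot ord0 (qy ^+ i *: n).

(** In I (x) N one has x (x) p n = b x y^i (x) n for every path p from 0
    to i, since x p = b x y^i for the word b obtained from the labels of p. *)
Lemma slot_path (p : qpath Q) : psrc p = ord0 :> 'I_r.+1 ->
  exists2 b : B, homog (agr B) ((plength p)%:Z - (ptgt p : nat)%:Z) b &
    forall (N : grmod kQ) (n : N), slot ord0 (pe p *: n) = b *: hgen (ptgt p) n.
Proof.
case: p => [[v s] ws]; rewrite /plength /parrows /=; elim/last_ind: s ws => [|s a IH] ws /= v0.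
  rewrite /ptgt /psrc /= in v0 *; exists 1; first by rewrite v0; exact: agr_one.
  move=> N n; rewrite scale1r /hgen v0 expr0 scale1r -[in RHS]slot_vtx.
  by congr (slot _ (pe _ *: _)); apply: val_inj; rewrite /= -v0.
have : is_walk v (s ++ [:: a]) by rewrite cats1.
rewrite is_walk_cat /= => /and3P [ws' /eqP sa _].
pose p' : qpath Q := exist _ (v, s) ws'.
have [b hb bE] := IH ws' v0.
have tp' : ptgt p' = asrc a by exact: esym sa.
have pE : pconcat p' (parrow a) = Some (exist _ (v, rcons s a) ws).
  by apply/pconcatP; split=> //; rewrite /parrows /= cats1.
have step (N : grmod kQ) (n : N) :
    slot ord0 (pe (exist _ (v, rcons s a) ws) *: n) =
    b *: slot ord0 ((e0 * qy ^+ (ptgt p') * letterK S (label a)) *: n).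
  rewrite -(path_mulE S pE) -scalerA bE /hgen; congr (_ *: _).
  rewrite -slot_vtx !scalerA; congr (slot _ (_ *: _)).
  by rewrite -vtx_letter mulrA -tp' vtx0_y_exp.
have -> : ptgt (exist _ (v, rcons s a) ws : qpath Q) = atgt a.
  by rewrite /ptgt /parrows /= map_rcons last_rcons.
have ta : nat_of_ord (atgt a) = if label a then (asrc a : nat).+1 else 0%N.
  by case: (a) => i //; rewrite lift0.
have ea : nat_of_ord (ptgt p') = asrc a by rewrite tp'.
rewrite -/p' ea in hb; rewrite ta size_rcons; case la: (label a) step => step.
  exists b => [|N n].
    by have -> : (size s).+1%:Z - (asrc a : nat).+1%:Z = (size s)%:Z - (asrc a : nat)%:Z by lia.
  by rewrite step /hgen -mulrA -scalerA slot_vtx ea -exprSr.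
exists (b * bx * by_ ^+ asrc a) => [|N n].
  have -> : (size s).+1%:Z - 0%:Z =
      ((size s)%:Z - (asrc a : nat)%:Z) + 1 + (size (nseq (asrc a) true))%:Z.
    by rewrite size_nseq; lia.
  rewrite -[by_ ^+ _]bword_nseq; apply: agr_mul.
    by apply: agr_mul; [exact: hb | exact: letterB_homog].
  by apply: word_homog; exact: letterB_homog.
rewrite step -mulrA -scalerA slot_vtx /hgen expr0 scale1r ea.
by rewrite -!scalerA y_exp_slot x_slot scalerA.
Qed.

Lemma slot_decomp_homog m (d : kQ) : homog (agr kQ) m d ->
  exists2 t : 'I_r.+1 -> B, (forall i : 'I_r.+1, homog (agr B) (m - (i : nat)%:Z) (t i)) &
    forall (N : grmod kQ) (n : N), slot ord0 (d *: n) = \sum_i t i *: hgen i n.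
Proof.
move=> hd; have [s sE] := path_gen d.
have H (c : k) (p : qpath Q) :
    exists2 t : 'I_r.+1 -> B, (forall i : 'I_r.+1, homog (agr B) (m - (i : nat)%:Z) (t i)) &
    forall (N : grmod kQ) (n : N),
      slot ord0 (part (agr kQ) m (c *: pe p) *: n) = \sum_i t i *: hgen i n.
  have hp : homog (agr kQ) (plength p) (c *: pe p).
    by apply: agr_scale; exact: pe_homog.
  have zero : exists2 t : 'I_r.+1 -> B, (forall i : 'I_r.+1, homog (agr B) (m - (i : nat)%:Z) (t i)) &
      forall (N : grmod kQ) (n : N), 0 = \sum_i t i *: hgen i n.
    exists (fun=> 0) => [i|N n]; first exact: part0.
    by rewrite big1 // => i _; rewrite scale0r.
  rewrite (part_homog _ hp); case: (m =P (plength p)%:Z) => [mp|_]; last first.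
    have [t ht tE] := zero; exists t => // N n; rewrite scale0r slot0; exact: tE.
  have [p0|/eqP p0] := (psrc p : 'I_r.+1) =P ord0; last first.
    have [t ht tE] := zero; exists t => // N n.
    rewrite -slot_vtx scalerA -scalerAr vtx_path (negPf p0) scaler0 scale0r slot0.
    exact: tE.
  have [b hb bE] := slot_path p0.
  exists (fun i => if i == ptgt p then c *: b else 0) => [i|N n].
    case: eqP => [->|_]; last exact: part0.
    by apply: agr_scale; rewrite mp.
  rewrite (bigD1 (ptgt p)) //= eqxx big1 ?addr0; last first.
    by move=> i ip; rewrite (negPf ip) scale0r.
  have -> : c *: pe p = c%:A * pe p by rewrite -scalerAl mul1r.
  have -> : c *: b = c%:A * b by rewrite -scalerAl mul1r.
  by rewrite -!scalerA slotZ bE.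
have -> : d = \sum_(t <- s) part (agr kQ) m (t.1 *: pe t.2).
  by rewrite -part_bigsum -sE hd.
elim: s {sE} => [|a s [t ht tE]].
  exists (fun=> 0) => [i|N n]; first exact: part0.
  by rewrite big_nil scale0r slot0 big1 // => i _; rewrite scale0r.
have [t' ht' tE'] := H a.1 a.2; exists (fun i => t' i + t i) => [i|N n].
  by rewrite /homog partD ht' ht.
rewrite big_cons scalerDl slotD tE' tE -big_split.
by apply: eq_bigr => i _; rewrite scalerDl.
Qed.

Lemma slot_decomp (d : kQ) : exists t : 'I_r.+1 -> B,
  forall (N : grmod kQ) (n : N), slot ord0 (d *: n) = \sum_i t i *: hgen i n.
Proof.
rewrite [d](gsupp_sum (agr kQ)); elim: (gsupp _ d) => [|m s [t tE]].
  exists (fun=> 0) => N n; rewrite big_nil scale0r slot0 big1 // => i _.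
  by rewrite scale0r.
have [t' _ tE'] := slot_decomp_homog (homog_part (agr kQ) m d).
exists (fun i => t' i + t i) => N n.
rewrite big_cons scalerDl slotD tE' tE -big_split.
by apply: eq_bigr => i _; rewrite scalerDl.
Qed.

Lemma slot_sumr (N : grmod kQ) j (I : finType) (F : I -> N) :
  slot j (\sum_i F i) = \sum_i slot j (F i).
Proof. by apply: (big_morph (slot j)); [exact: slotD | exact: slot0]. Qed.

Section RightMultiplication.
Variables (N : grmod kQ) (n : N).

Definition act_on (d : regular_mod kQ) : N := (d : kQ) *: n.

Lemma act_on_linear : linear act_on.
Proof. by move=> a d d'; rewrite /act_on scalerDl -scalerA. Qed.

HB.instance Definition _ := GRing.isLinear.Build kQ (regular_mod kQ) N *:%R act_on
  act_on_linear.

End RightMultiplication.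

Lemma hgen_act_on (N : grmod kQ) (n : N) i :
  ideal_map (act_on n) (hgen i (1 : regular_mod kQ)) = hgen i n.
Proof.
rewrite /hgen ideal_map_slot; congr slot; rewrite /= /act_on.
by rewrite -[X in X *: n]/(qy ^+ i * 1) mulr1.
Qed.

Lemma hgen_free (b : 'I_r.+1 -> B) :
  \sum_i b i *: hgen i (1 : regular_mod kQ) = 0 -> forall i, b i = 0.
Proof.
move=> b0; apply: ideal_free; have := congr1 (@ideal_mult _ _ S _) b0.
rewrite linear0 linear_sum => h; rewrite -[RHS]h; apply: eq_bigr => i _.
rewrite linearZ_LR -[RHS]/(f (b i) *: (ideal_mult (hgen i (1 : regular_mod kQ)) : regular_mod kQ)).
rewrite ideal_mult_slot expr0 mul1r -[RHS]/(f (b i) * (qx * (qy ^+ i * 1))).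
by rewrite mulr1.
Qed.

(** Tensoring with I is right exact, and I (x) kQ^n = I^n is free over B on the
    x y^i (x) g_j. So I (x) N is presented by these generators, with relations
    the x y^i (x) R_l for the relations R_l of N. *)
Lemma ideal_fin_pres (N : grmod kQ) : fin_pres N -> fin_pres (ideal_mod N).
Proof.
move=> /fin_presE [p [n [d [e [R [g [hR hg gen rel0 rel]]]]]]].
have hyR (i : 'I_r.+1) l j :
    homog (agr kQ) ((i : nat)%:Z + (d l - e j)) (qy ^+ i * R l j).
  by apply: agr_mul; [exact: y_homog | exact: hR].
pose tau i l j := s2val (cid2 (slot_decomp_homog (hyR i l j))).
have tau_homog (i : 'I_r.+1) l j (i' : 'I_r.+1) : homog (agr B) ((i : nat)%:Z + (d l - e j) - (i' : nat)%:Z) (tau i l j i').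
  exact: (s2valP (cid2 (slot_decomp_homog (hyR i l j)))).
have tauE (i : 'I_r.+1) l j (N' : grmod kQ) (m : N') :
    slot ord0 ((qy ^+ i * R l j) *: m) = \sum_i' tau i l j i' *: hgen i' m.
  exact: (s2valP' (cid2 (slot_decomp_homog (hyR i l j)))).
have [t tE] := choice slot_decomp.
have [co coE] := choice gen.
have slotE (a : 'I_r.+1) (N' : grmod kQ) (I : finType) (c : I -> kQ) (m : I -> N') :
    slot a (\sum_j c j *: m j) =
    \sum_j \sum_i (by_ ^+ a * t (c j) i) *: hgen i (m j).
  rewrite -y_exp_slot slot_sumr scaler_sumr; apply: eq_bigr => j _.
  by rewrite tE scaler_sumr; apply: eq_bigr => i _; rewrite scalerA.
apply: (@fin_presI k B (ideal_mod N) ('I_p * 'I_r.+1)%type ('I_n * 'I_r.+1)%type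
  (fun l => d l.1 + (l.2 : nat)%:Z + 1) (fun j => e j.1 + (j.2 : nat)%:Z + 1)
  (fun l j => tau l.2 l.1 j.1 j.2) (fun j => hgen j.2 (g j.1))).
- move=> [l i] [j i'] /=.
  have -> : d l + (i : nat)%:Z + 1 - (e j + (i' : nat)%:Z + 1) =
      (i : nat)%:Z + (d l - e j) - (i' : nat)%:Z by lia.
  exact: tau_homog.
- move=> [j i] /=; rewrite [e j + _]addrC.
  exact: (slot_homog ord0 (mgr_act (y_homog S i) (hg j))).
- move=> h; exists (fun j => \sum_(a < r.+1) by_ ^+ a * t (co (coord h a) j.1) j.2).
  rewrite -(pair_bigA _ (fun j i => (\sum_a by_ ^+ (a : 'I_r.+1) * t (co (coord h a) j) i) *:
    hgen i (g j))) /= {1}[h]slot_sum.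
  rewrite (eq_bigr (fun a => \sum_j \sum_i (by_ ^+ (a : 'I_r.+1) * t (co (coord h a) j) i) *:
    hgen i (g j))); last by move=> a _; rewrite {1}[coord h a]coE slotE.
  rewrite exchange_big; apply: eq_bigr => j _; rewrite exchange_big.
  by apply: eq_bigr => i _; rewrite scaler_suml.
- move=> [l i]; rewrite -(pair_bigA _ (fun j i' => tau i l j i' *: hgen i' (g j))) /=.
  rewrite (eq_bigr (fun j => slot ord0 (qy ^+ i *: (R l j *: g j)))).
    by rewrite -slot_sumr -scaler_sumr rel0 scaler0 slot0.
  by move=> j _; rewrite scalerA tauE.
move=> b; rewrite (eq_bigr (fun j => b (j.1, j.2) *: hgen j.2 (g j.1))); last by case.
rewrite -(pair_bigA _ (fun j i => b (j, i) *: hgen i (g j))) /= => b0.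
(* the family sum_i b_{ji} x y^i in I, one for each generator g j *)
pose z j : ideal_space (regular_mod kQ) := \sum_i b (j, i) *: hgen i (1 : regular_mod kQ).
have [be beE] : exists be : 'I_r.+1 -> 'I_p -> kQ,
    forall a j, coord (z j) a = \sum_l be a l * R l j.
  suff H a : exists be, forall j, (coord (z j) a : kQ) = \sum_l be l * R l j.
    by have [be beE] := choice H; exists be.
  apply: rel; rewrite -[RHS](coord0 (S := S) N a) -b0.
  rewrite (big_morph (fun h : ideal_space N => coord h a) (id1 := 0) (op1 := +%R)); last exact: coord0.
    apply: eq_bigr => j _; rewrite -[LHS]/(act_on (g j) (coord (z j) a)) -coord_map.
    rewrite linear_sum; congr coord; apply: eq_bigr => i _.
    by rewrite linearZ_LR; congr (_ *: _); exact: hgen_act_on.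
  by move=> h h'; exact: coordD.
exists (fun l => \sum_(a < r.+1) by_ ^+ a * t (be a l.1) l.2) => [[j i]] /=.
apply/eqP; rewrite -subr_eq0; apply/eqP.
rewrite -(pair_bigA _ (fun l i' => (\sum_a by_ ^+ (a : 'I_r.+1) * t (be a l) i') * tau i' l j i)) /=.
move: i; apply: hgen_free.
under eq_bigr do rewrite scalerBl.
rewrite sumrB -/(z j) {1}[z j]slot_sum; apply/eqP; rewrite subr_eq0; apply/eqP.
have bE a : coord (z j) a = \sum_l be a l *: (R l j : regular_mod kQ) by exact: beE.
rewrite (eq_bigr (fun a => \sum_l \sum_i' (by_ ^+ (a : 'I_r.+1) * t (be a l) i') *:
    hgen i' (R l j : regular_mod kQ))); last by move=> a _; rewrite bE slotE.
have RE (i' : 'I_r.+1) l : hgen i' (R l j : regular_mod kQ) =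
    \sum_i tau i' l j i *: hgen i (1 : regular_mod kQ).
  rewrite -tauE /hgen; congr slot.
  by rewrite -[RHS]/(qy ^+ i' * R l j * 1) mulr1.
under [RHS]eq_bigr do rewrite scaler_suml.
rewrite [RHS]exchange_big [LHS]exchange_big /=; apply: eq_bigr => l _.
under [RHS]eq_bigr do rewrite scaler_suml.
rewrite [RHS]exchange_big [LHS]exchange_big /=; apply: eq_bigr => i' _.
rewrite -scaler_suml RE scaler_sumr; apply: eq_bigr => i _.
by rewrite scalerA.
Qed.

End IdealPresentation.

(** * Finite dimensional kernels and cokernels *)

(** Suppose that A is the sum of a finite dimensional space and of a direct sum
    of right ideals a_j A, where a_j A is a copy of e_j A. If N is free of finite
    rank, the map (n_j) |-> sum a_j n_j on the e_j N is injective with finite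
    dimensional cokernel. Finite presentation allows only finite dimensional
    corrections: an element of the kernel lifts, after subtraction of relations,
    to a family of free elements whose image lies in the finite dimensional
    space spanned by the products of S with the relations. *)
Section AlmostDecomposition.
Variables (k : fieldType) (A : gralg k) (J : finType) (a e : J -> A) (S : seq A).
Hypothesis e_idem : forall j, e j * e j = e j.
Hypothesis ae : forall j, a j * e j = a j.
Hypothesis span : forall d, exists d' : J -> A, in_span S (d - \sum_j a j * d' j).
Hypothesis free : forall d : J -> A, \sum_j a j * d j = 0 -> forall j, e j * d j = 0.
Variable N : grmod A.
Hypothesis fpN : fin_pres N.

Lemma decomposition_coker : exists l : seq (kspace N), forall n, exists h : J -> N,
  (forall j, e j *: h j = h j) /\ in_span l (n - \sum_j a j *: h j : kspace N).
Proof.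
have [p [m [d [dg [R [g [hR hg gen rel0 rel]]]]]]] := fin_presE fpN.
exists [seq (s : A) *: g i : kspace N | i <- enum 'I_m, s <- S] => n.
have [c ->] := gen n; have [c' cE] := choice (fun i => span (c i)).
exists (fun j => e j *: \sum_i c' i j *: g i); split=> [j|].
  by rewrite scalerA e_idem.
have -> : \sum_i c i *: g i - \sum_j a j *: (e j *: \sum_i c' i j *: g i) =
    \sum_i (c i - \sum_j a j * c' i j) *: g i.
  rewrite (eq_bigr (fun j => \sum_i (a j * c' i j) *: g i)).
    by rewrite exchange_big -sumrB; apply: eq_bigr => i _; rewrite scalerBl scaler_suml.
  move=> j _; rewrite scalerA ae scaler_sumr.
  by apply: eq_bigr => i _; rewrite scalerA.
apply: (@subspace_sum k (kspace N)) => [|i]; first exact: span_subspace.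
have lin : linear ((fun s : A => s *: g i) : A -> kspace N).
  by move=> x u v; rewrite scalerDl kspaceZA.
apply: in_span_sub (in_span_map lin (cE i)) => _ /mapP [s sS ->].
by apply: mem_in_span; apply/allpairsP; exists (i, s); rewrite mem_enum.
Qed.

Lemma decomposition_ker : fin_span (fun h : {ffun J -> kspace N} =>
  (forall j, e j *: (h j : N) = h j) /\ \sum_j a j *: (h j : N) = 0).
Proof.
have [p [m [d [dg [R [g [hR hg gen rel0 rel]]]]]]] := fin_presE fpN.
pose U := {ffun J * 'I_m -> A}.
pose P (x : U) := forall j i, e j * x (j, i) = x (j, i).
pose th (x : U) : {ffun 'I_m -> A} := [ffun i => \sum_j a j * x (j, i)].
have th_lin : linear th.
  move=> c x y; apply/ffunP => i; rewrite !ffunE scaler_sumr -big_split.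
  by apply: eq_bigr => j _; rewrite !ffunE mulrDr scalerAr.
have sP : subspace P.
  split=> [j i|c x y Px Py j i]; first by rewrite ffunE mulr0.
  by rewrite !ffunE mulrDr -scalerAr Px Py.
pose W := [seq [ffun i => (s : A) * R l i] : {ffun 'I_m -> A} | l <- enum 'I_p, s <- S].
have [|t tE] := fin_span_preimage th_lin W sP.
  exists [::] => x [Px /ffunP x0]; apply/ffunP => [[j i]]; rewrite ffunE -Px.
  apply: (free (d := fun j => x (j, i))).
  by have := x0 i; rewrite !ffunE.
pose psi (x : U) : {ffun J -> kspace N} := [ffun j => \sum_i x (j, i) *: g i].
have psi_lin : linear psi.
  move=> c x y; apply/ffunP => j; rewrite !ffunE scaler_sumr -big_split.
  by apply: eq_bigr => i _; rewrite !ffunE scalerDl kspaceZA.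
exists (map psi t) => h [eh h0].
have [c cE] := choice (fun j => gen (h j)).
have [|b bE] := rel (fun i => \sum_j a j * c j i).
  rewrite -[RHS]h0 (eq_bigr (fun i => \sum_j a j *: (c j i *: g i))).
    by rewrite exchange_big; apply: eq_bigr => j _; rewrite cE scaler_sumr.
  by move=> i _; rewrite scaler_suml; apply: eq_bigr => j _; rewrite scalerA.
have [b' b'E] := choice (fun l => span (b l)).
(* lift the family h to free elements and subtract the relations *)
pose x : U := [ffun ji => e ji.1 * (c ji.1 ji.2 - \sum_l b' l ji.1 * R l ji.2)].
have -> : h = psi x.
  apply/ffunP => j; rewrite ffunE (eq_bigr (fun i => e j *: (c j i *: g i) -
      \sum_l (e j * b' l j) *: (R l i *: g i))); last first.
    move=> i _; rewrite ffunE /= mulrBr scalerBl scalerA mulr_sumr scaler_suml.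
    by congr (_ - _); apply: eq_bigr => l _; rewrite scalerA mulrA.
  rewrite sumrB -scaler_sumr -cE eh exchange_big [X in _ - X]big1 ?subr0 // => l _.
  by rewrite -scaler_sumr rel0 scaler0.
apply: (in_span_map psi_lin); apply: tE; split=> [j i|].
  by rewrite ffunE mulrA e_idem.
have -> : th x = \sum_l [ffun i => (b l - \sum_j a j * b' l j) * R l i].
  apply/ffunP => i; rewrite ffunE sum_ffunE.
  rewrite (eq_bigr (fun j => a j * c j i - \sum_l a j * b' l j * R l i)); last first.
    move=> j _; rewrite ffunE /= mulrA ae mulrBr mulr_sumr; congr (_ - _).
    by apply: eq_bigr => l _; rewrite mulrA.
  rewrite sumrB bE exchange_big -sumrB; apply: eq_bigr => l _.
  by rewrite ffunE mulrBl mulr_suml.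
apply: subspace_sum => [|l]; first exact: span_subspace.
have lin : linear ((fun s : A => [ffun i => s * R l i]) : A -> {ffun 'I_m -> A}).
  by move=> y u v; apply/ffunP => i; rewrite !ffunE mulrDl scalerAl.
apply: in_span_sub (in_span_map lin (b'E l)) => _ /mapP [s sS ->].
by apply: mem_in_span; apply/allpairsP; exists (l, s); rewrite mem_enum.
Qed.

End AlmostDecomposition.

Section Decompositions.
Variables (k : fieldType) (r : nat) (S : path_setting k r).

Local Notation Q := (quiverQ r).
Local Notation kQ := (algQ_of S).
Local Notation B := (algB_of S).
Local Notation f := (fhom S).
Local Notation bword := (word (letterB S)).
Local Notation qword := (word (letterK S)).
Local Notation bx := (letterB S false).
Local Notation by_ := (letterB S true).
Local Notation qx := (letterK S false).
Local Notation qy := (letterK S true).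
Local Notation e_ := (@vtx k r S).
Local Notation e0 := (@vtx k r S ord0).
Local Notation pe := (@pe k r S).

Lemma path_yx (v : 'I_r.+1) (i : nat) : (v + i < r.+1)%N ->
  exists p : qpath Q, [/\ psrc p = v, plabel p = rcons (nseq i true) false & ptgt p = ord0].
Proof.
elim: i v => [|i IH] v; first by exists (parrow (inl v : arrow Q)).
move=> vi; have vr : (v < r)%N by lia.
pose a := inr (Ordinal vr) : arrow Q.
have [|p [sp lp tp]] := IH (atgt a).
  by rewrite lift0 addSnnS.
have [|q aq] := @pconcat_def _ (parrow a) p; first by rewrite sp.
have [_ sq lq] := (pconcatP _ _ _).1 aq.
exists q; split; first by rewrite sq; apply: val_inj.
  by rewrite /plabel lq map_cat /= -lp.
by rewrite (pconcat_tgt aq).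
Qed.

(** Removing a first segment with labels y^j x separates the right ideals
    generated by the paths with one arrow x at their end. *)
Lemma first_segment (j : nat) : exists g : {linear kQ -> kQ},
  forall (v : 'I_r.+1) (i : nat) d, (v + i < r.+1)%N ->
    g (e_ v * qy ^+ i * qx * d) = if i == j then e0 * d else 0.
Proof.
pose h (p : qpath Q) : kQ :=
  if index false (plabel p) == j then
    if insub ((ord0 : vertex Q), drop j.+1 (parrows p)) is Some q then pe q else 0
  else 0.
have [g g_lin gE] := path_lift S h.
pose gR := GRing.isLinear.Build k kQ kQ *:%R g g_lin.
pose gL : {linear kQ -> kQ} := HB.pack g gR.
exists gL => v i d vi; rewrite -[RHS]/(if i == j then e0 * d else 0).
have [p [sp lp tp]] := path_yx vi.
have -> : e_ v * qy ^+ i * qx = pe p.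
  rewrite -vtx_plabel sp lp -cats1 word_cat qword_nseq mulrA.
  by rewrite [word _ [:: false]]big_seq1.
elim/kQ_ind: d => [|a b ha hb|c a ha|q].
- by rewrite !mulr0 linear0 if_same.
- by rewrite !mulrDr linearD ha hb; case: eqP; rewrite ?addr0.
- by rewrite -!scalerAr linearZ_LR ha; case: eqP; rewrite ?scaler0.
rewrite vtx_path; case: (psrc q =P ord0 :> 'I_r.+1) => [sq|sq]; last first.
  rewrite path_mul /pconcat tp [X in if X then _ else None](_ : _ = false).
    by rewrite linear0 if_same.
  by apply/eqP => e; apply: sq; rewrite -e.
have [|pq pqE] := @pconcat_def _ p q; first by rewrite tp sq.
have [_ spq apq] := (pconcatP _ _ _).1 pqE.
rewrite (path_mulE S pqE) [LHS]gE /h /plabel apq map_cat -/(plabel p) lp -cats1 -catA.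
rewrite index_cat mem_nseq /= andbF size_nseq addn0; case: eqP => // <-.
have sz : size (parrows p) = i.+1.
  by rewrite -(size_map (@label r)) -/(plabel p) lp size_rcons size_nseq.
rewrite -sz drop_size_cat // -sq.
by rewrite -[(_, _)]surjective_pairing valK.
Qed.

(** kQ is the direct sum of the span of the e_v y^i and of the right ideals
    e_v y^i x kQ, which are copies of e_0 kQ as long as v + i <= r and zero
    otherwise. *)
Definition Qgen (p : 'I_r.+1 * 'I_r.+1) : kQ := e_ p.1 * qy ^+ p.2 * qx.
Definition Qidem (p : 'I_r.+1 * 'I_r.+1) : kQ := if (p.1 + p.2 < r.+1)%N then e0 else 0.

Lemma Qidem_idem p : Qidem p * Qidem p = Qidem p.
Proof. by rewrite /Qidem; case: ifP => _; rewrite ?vtx0_idem ?mul0r. Qed.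

Lemma Qgen_idem p : Qgen p * Qidem p = Qgen p.
Proof.
rewrite /Qgen /Qidem; case: ltnP => [_|pr]; first by rewrite -mulrA qx_vtx0.
by rewrite vtx_y_exp0 // !mul0r.
Qed.

Definition Qrest : seq kQ := [seq e_ v * qy ^+ i | v <- enum 'I_r.+1, i <- iota 0 r.+1].
Definition Brest : seq B := [seq by_ ^+ i | i <- iota 0 r.+1].

Lemma Qspan d : exists d' : 'I_r.+1 * 'I_r.+1 -> kQ, in_span Qrest (d - \sum_p Qgen p * d' p).
Proof.
have sQ := span_subspace Qrest.
have H v w : exists d' : 'I_r.+1 * 'I_r.+1 -> kQ,
    in_span Qrest (e_ v * qword w - \sum_p Qgen p * d' p).
  have zero : \sum_p Qgen p * 0 = 0 by rewrite big1 // => p _; rewrite mulr0.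
  case: (word_first_x w) => [->|[i [u ->]]].
    exists (fun=> 0); rewrite zero subr0 qword_nseq.
    have [wr|rw] := ltnP (size w) r.+1; last first.
      by rewrite vtx_y_exp0 ?(leq_trans rw (leq_addl _ _)) //; exact: sQ.1.
    apply: mem_in_span; apply/allpairsP; exists (v, size w).
    by rewrite mem_enum mem_iota.
  rewrite word_cat qword_cons qword_nseq.
  have [ir|ri] := ltnP i r.+1; last first.
    exists (fun=> 0); rewrite zero subr0 mulrA vtx_y_exp0 ?mul0r //.
      exact: sQ.1.
    exact: leq_trans ri (leq_addl _ _).
  exists (fun p => if p == (v, Ordinal ir) then qword u else 0).
  rewrite (bigD1 (v, Ordinal ir)) //= eqxx big1 ?addr0; last first.
    by move=> p /negPf ->; rewrite mulr0.
  by rewrite /Qgen /= !mulrA subrr; exact: sQ.1.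
have [s ->] := kQ_word_span d.
elim: s => [|[c [v w]] s [d1 d1E]].
  exists (fun=> 0); rewrite big_nil big1 ?subr0; first exact: sQ.1.
  by move=> p _; rewrite mulr0.
have [d2 d2E] := H v w; exists (fun p => c *: d2 p + d1 p).
rewrite big_cons /=; set x := _ * _ in d2E *.
have -> : \sum_p Qgen p * (c *: d2 p + d1 p) =
    c *: (\sum_p Qgen p * d2 p) + \sum_p Qgen p * d1 p.
  rewrite scaler_sumr -big_split; apply: eq_bigr => p _.
  by rewrite mulrDr -scalerAr.
by rewrite opprD addrACA -scalerBr; exact: sQ.2.
Qed.

(** Multiplication by e_v separates the sources, and the removal of the first
    segment y^j x separates the exponents. *)
Lemma Qfree (d : 'I_r.+1 * 'I_r.+1 -> kQ) : \sum_p Qgen p * d p = 0 ->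
  forall p, Qidem p * d p = 0.
Proof.
move=> d0 [v j]; rewrite /Qidem /=; case: ltnP => [vj|_]; last exact: mul0r.
have [g gE] := first_segment j.
have := congr1 (fun x => g (e_ v * x)) d0; rewrite mulr0 linear0 => <-.
rewrite mulr_sumr linear_sum (bigD1 (v, j)) //= big1 ?addr0.
  by rewrite /Qgen /= !mulrA vtxM eqxx gE // eqxx.
move=> [u i] /= /eqP uij; rewrite /Qgen /= !mulrA vtxM; case: (eqVneq v u) => [vu|_]; last first.
  by rewrite !mul0r linear0.
subst u; have [vi|iv] := ltnP (v + i) r.+1; last by rewrite vtx_y_exp0 // !mul0r linear0.
rewrite gE //; case: eqP => // ij; case: uij; congr (_, _); exact: val_inj.
Qed.

Lemma Bspan (b : B) : exists b' : 'I_r.+1 -> B,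
  in_span Brest (b - \sum_(j < r.+1) by_ ^+ j * bx * b' j).
Proof.
have sB := span_subspace Brest.
elim/algB_ind: b => [|a b [a' a'E] [b' b'E]|c b [b' b'E]|w].
- exists (fun=> 0); rewrite big1 ?subr0; first exact: sB.1.
  by move=> j _; rewrite mulr0.
- exists (fun j => a' j + b' j); under eq_bigr do rewrite mulrDr.
  by rewrite big_split opprD addrACA; exact: subspaceD.
- exists (fun j => c *: b' j); under eq_bigr do rewrite -scalerAr.
  by rewrite -scaler_sumr -scalerBr; exact: subspaceZ.
have zero : \sum_(j < r.+1) by_ ^+ j * bx * 0 = 0 by rewrite big1 // => j _; rewrite mulr0.
case: (word_first_x w) => [->|[i [u ->]]].
  exists (fun=> 0); rewrite zero subr0 bword_nseq.
  have [wr|rw] := ltnP (size w) r.+1; last by rewrite by_exp0 //; exact: sB.1.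
  by apply: mem_in_span; apply: map_f; rewrite mem_iota.
rewrite word_cat bword_cons bword_nseq.
have [ir|ri] := ltnP i r.+1; last first.
  by exists (fun=> 0); rewrite zero subr0 by_exp0 // mul0r; exact: sB.1.
exists (fun j => if j == Ordinal ir then bword u else 0).
rewrite (bigD1 (Ordinal ir)) //= eqxx big1 ?addr0; last first.
  by move=> p /negPf ->; rewrite mulr0.
by rewrite mulrA subrr; exact: sB.1.
Qed.

Lemma Bfree (b : 'I_r.+1 -> B) : \sum_(j < r.+1) by_ ^+ j * bx * b j = 0 ->
  forall j, 1 * b j = 0.
Proof.
move=> b0 j; rewrite mul1r -(pathB0_f (b j)) -[pathB _ _ _]mul1r.
have [g gE] := first_segment j.
suff e : e0 * f (b j) = 0.
  by have := pathB_vtx ord0 ord0 (f (b j)); rewrite e eqxx pathB_0 mul1r => <-.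
have := congr1 (fun x => g (e0 * f x)) b0; rewrite ahom0 mulr0 linear0 => <-.
rewrite ahom_sum mulr_sumr linear_sum (bigD1 j) //= big1 ?addr0.
  by rewrite !ahomM f_by !mulrA gE ?eqxx // add0n.
move=> i ij; rewrite !ahomM f_by !mulrA gE ?add0n // val_eqE.
by rewrite (negPf ij).
Qed.

End Decompositions.

(** * The equivalence of the small quotient categories *)

Section SmallQuotients.
Variables (k : fieldType) (r : nat) (S : path_setting k r).

Local Notation kQ := (algQ_of S).
Local Notation B := (algB_of S).
Local Notation f := (fhom S).
Local Notation bx := (letterB S false).
Local Notation by_ := (letterB S true).
Local Notation e_ := (@vtx k r S).
Local Notation e0 := (@vtx k r S ord0).

Section VertexDecomposition.
Variable M : grmod B.

Lemma tpure_klinear d : linear (tpure f d : kspace M -> kspace (tens_mod f M)).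
Proof.
move=> c u v; rewrite tpureDr; congr (_ + _).
rewrite !kspaceZ -tpure_bal ahomZ ahom1 tpureZ.
by rewrite -scalerAr mulr1 -scalerAl mul1r.
Qed.

Lemma tens_vtx_sum t : exists m : 'I_r.+1 -> M, t = \sum_v tpure f (e_ v) (m v).
Proof.
elim/tens_ind: t => [|x y [m ->] [m' ->]|d m].
- by exists (fun=> 0); rewrite big1 // => v _; exact: tpure0r.
- by exists (fun v => m v - m' v); rewrite -sumrB; apply: eq_bigr => v _; rewrite tpureBr.
- exists (fun v => pathB S v d *: m).
  rewrite -[d in LHS]mul1r -vtx_sum mulr_suml tpure_suml; apply: eq_bigr => v _.
  by rewrite -tpure_bal vtx_f_pathB.
Qed.

Lemma vtx_tens_sum (m : 'I_r.+1 -> M) v :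
  e_ v *: (\sum_u tpure f (e_ u) (m u)) = tpure f (e_ v) (m v).
Proof.
rewrite scaler_sumr (bigD1 v) //= big1 ?addr0 => [|u uv].
  by rewrite tpureZ vtxM eqxx.
by rewrite tpureZ vtxM eq_sym (negPf uv) tpure0l.
Qed.

Lemma tpure_vtx_y (v : 'I_r.+1) i (m : M) : (r < v + i)%N -> tpure f (e_ v) (by_ ^+ i *: m) = 0.
Proof. by move=> vi; rewrite -tpure_bal f_by vtx_y_exp0 // tpure0l. Qed.

Definition y_mul_mem (v : 'I_r.+1) : {pred M} :=
  fun m => `[< exists m', m = by_ ^+ (r.+1 - v) *: m' >].

Lemma y_mul_memP (v : 'I_r.+1) (m : M) :
  reflect (exists m', m = by_ ^+ (r.+1 - v) *: m') (m \in y_mul_mem v).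
Proof. exact: asboolP. Qed.

Lemma y_mul_closed v : zmod_closed (y_mul_mem v).
Proof.
split=> [|_ _ /y_mul_memP [m ->] /y_mul_memP [m' ->]]; apply/y_mul_memP.
  by exists 0; rewrite scaler0.
by exists (m - m'); rewrite scalerBr.
Qed.

HB.instance Definition _ v := GRing.isZmodClosed.Build _ (y_mul_mem v) (y_mul_closed v).

(** Since e_v kQ is B / y^{r+1-v} B as a right B-module, e_v (kQ (x) M) is
    M / y^{r+1-v} M. *)
Lemma tpure_vtx_eq0 (v : 'I_r.+1) (m : M) :
  tpure f (e_ v) m = 0 -> exists m', m = by_ ^+ (r.+1 - v) *: m'.
Proof.
pose pi m : {ideal_quot (y_mul_mem v)} := \pi_{ideal_quot (y_mul_mem v)} m.
have piD m1 m2 : pi (m1 + m2) = pi m1 + pi m2 by rewrite /pi raddfD.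
pose h (d : kQ) (m : M) := pi (pathB S v d *: m).
have hDl d d' m' : h (d + d') m' = h d m' + h d' m' by rewrite /h pathB_D scalerDl piD.
have hDr d m1 m2 : h d (m1 + m2) = h d m1 + h d m2 by rewrite /h scalerDr piD.
have h_bal d b m' : h (d * f b) m' = h d (b *: m').
  apply/eqP; rewrite -subr_eq0 -raddfB quot_eq0; apply/y_mul_memP.
  have [b' b'E] := pathB_mul v d b.
  by exists (b' *: m'); rewrite !scalerA -scalerBl b'E.
pose lh : tens f M -> _ := tens_lift h.
have lhB : {morph lh : x y / x - y} by exact: tens_liftB hDl hDr h_bal.
move=> /(congr1 lh); rewrite (morphB0 lhB).
rewrite [lh _]tens_liftE // /h pathB_vtx1 eqxx scale1r => /eqP.
by rewrite quot_eq0 => /y_mul_memP.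
Qed.

End VertexDecomposition.

Lemma y_klinear (M : grmod B) i : linear ((fun m => by_ ^+ i *: m) : kspace M -> kspace M).
Proof. by move=> c u v; rewrite scalerDr kspaceAZ. Qed.

Lemma in_span_flatten (V : lmodType k) (I : finType) (l : I -> seq V) (F : I -> V) :
  (forall i, in_span (l i) (F i)) ->
  in_span (flatten [seq l i | i <- enum I]) (\sum_i F i).
Proof.
move=> H; apply: subspace_sum => [|i]; first exact: span_subspace.
apply: in_span_sub (H i) => e el; apply: mem_in_span; apply/flattenP.
by exists (l i) => //; apply: map_f; rewrite mem_enum.
Qed.

Lemma tens_map_vtx_sum (M N : grmod B) (s : grhom M N) (m : 'I_r.+1 -> M) :
  tens_hom f s (\sum_v tpure f (e_ v) (m v)) =
  \sum_v tpure f (e_ v) (s (m v)) :> tens f N.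
Proof.
by rewrite [LHS]linear_sum; apply: eq_bigr => v _; exact: tens_mapE.
Qed.

(** As kQ (x) M is the sum of the M / y^{r+1-v} M, only the kernel needs an
    argument: if s m = y^{r+1-v} n, then n is the image of some m' up to
    a finite dimensional space, so that s (m - y^{r+1-v} m') lies in a fixed
    finite dimensional space, and m - y^{r+1-v} m' in its preimage. *)
Lemma tens_isom_fdim (M N : grmod B) (s : grhom M N) :
  isom_mod (@fdim k B) s -> isom_mod (@fdim k kQ) (tens_hom f s).
Proof.
move=> /isom_fdimP [kers [l cokers]]; apply/isom_fdimP; split; last first.
  exists (flatten [seq [seq tpure f (e_ v) w : kspace (tens_mod f N) | w <- l] | v <- enum 'I_r.+1]) => t.
  have [n ->] := tens_vtx_sum t; have [m mE] := choice (fun v => cokers (n v)).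
  exists (\sum_v tpure f (e_ v) (m v)).
  have e : \sum_v tpure f (e_ v) (n v) - tens_hom f s (\sum_v tpure f (e_ v) (m v)) =
      \sum_v tpure f (e_ v) (n v - s (m v)) :> tens f N.
    by rewrite tens_map_vtx_sum -sumrB; apply: eq_bigr => v _; rewrite tpureBr.
  rewrite [X in in_span _ X]e.
  apply: (@in_span_flatten (kspace (tens_mod f N))) => v.
  exact: (in_span_map (@tpure_klinear N (e_ v))).
have sT : subspace (fun=> True : Prop) (V := kspace M) by [].
have pre v : fin_span (fun m : kspace M => True /\
    in_span [seq by_ ^+ (r.+1 - v) *: w : kspace N | w <- l] (s m)).
  apply: (fin_span_preimage (klinear s) _ sT).
  by have [l0 l0P] := kers; exists l0 => m [_] /l0P.
have [L LP] := choice (fun v : 'I_r.+1 => pre v).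
exists (flatten [seq [seq tpure f (e_ v) m : kspace (tens_mod f M) | m <- L v] | v <- enum 'I_r.+1]) => t.
have [m ->] := tens_vtx_sum t => st; apply: in_span_flatten => v.
have /tpure_vtx_eq0 [n smE] : tpure f (e_ v) (s (m v)) = 0.
  have := congr1 (fun t => e_ v *: t) st; rewrite scaler0 => <-.
  rewrite -linearZ_LR vtx_tens_sum; exact/esym/tens_mapE.
have [m' nE] := cokers n.
have -> : tpure f (e_ v) (m v) = tpure f (e_ v) (m v - by_ ^+ (r.+1 - v) *: m').
  by rewrite tpureBr tpure_vtx_y ?subr0 // subnKC // ltnW.
apply: (in_span_map (@tpure_klinear M (e_ v))); apply: LP; split=> //.
rewrite linearB linearZ_LR smE -scalerBr.
exact: (in_span_map (@y_klinear N (r.+1 - v))).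
Qed.

Lemma slot_klinear (N : grmod kQ) j : linear (slot j : kspace N -> kspace (ideal_mod N)).
Proof. by move=> c u v; rewrite slotD slotZ. Qed.

(** I (x) N is a sum of copies of e_0 N. *)
Lemma ideal_isom_fdim (M N : grmod kQ) (s : grhom M N) :
  isom_mod (@fdim k kQ) s -> isom_mod (@fdim k B) (ideal_hom s).
Proof.
move=> /isom_fdimP [[l0 kers] [l cokers]]; apply/isom_fdimP; split.
  exists (flatten [seq [seq slot j w : kspace (ideal_mod M) | w <- l0] | j <- enum 'I_r.+1]) => h h0.
  rewrite [h]slot_sum; apply: in_span_flatten => j.
  apply: (in_span_map (@slot_klinear M j)); apply: kers.
  by rewrite -coord_map -[ideal_map s h]/(ideal_hom s h) h0 coord0.
exists (flatten [seq [seq slot j w : kspace (ideal_mod N) | w <- l] | j <- enum 'I_r.+1]) => h.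
have [m mE] := choice (fun j => cokers (coord h j)).
exists (\sum_j slot j (m j)); rewrite {1}[h]slot_sum linear_sum -sumrB.
apply: in_span_flatten => j; rewrite /= ideal_map_slot -slotB.
exact: (in_span_map (@slot_klinear N j)).
Qed.

(** I (x) kQ (x) M = I (x) M is the sum of the y^j x (x) M, and B is the direct
    sum of the span of 1, y, ..., y^r and of the y^j x B. *)
Lemma ideal_tens_isom_fdim (M : grmod B) :
  fin_pres M -> isom_mod (@fdim k B) (ideal_tens_hom M).
Proof.
move=> fpM; apply/isom_fdimP.
pose a (j : 'I_r.+1) := by_ ^+ j * bx.
have id1 (j : 'I_r.+1) : (1 : B) * 1 = 1 by rewrite mulr1.
have a1 j : a j * 1 = a j by rewrite mulr1.
have [L LP] := decomposition_ker id1 a1 (@Bspan k r S) (@Bfree k r S) fpM.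
have [l lP] := decomposition_coker id1 a1 (@Bspan k r S) fpM.
have comult (h : 'I_r.+1 -> M) :
    ideal_tens_hom M (\sum_j slot (N := tens_mod f M) j (tpure f e0 (h j))) = \sum_j a j *: h j.
  rewrite linear_sum; apply: eq_bigr => j _ /=.
  by rewrite ideal_comult_slot vtx0_tensE pathB_vtx1 eqxx scale1r.
split; last first.
  exists l => n; have [h [_ hE]] := lP n.
  by exists (\sum_j slot (N := tens_mod f M) j (tpure f e0 (h j))); rewrite comult.
pose xi (h : {ffun 'I_r.+1 -> kspace M}) : kspace (ideal_mod (tens_mod f M)) :=
  \sum_j slot (N := tens_mod f M) j (tpure f e0 (h j)).
have xi_lin : linear xi.
  move=> c g h; rewrite scaler_sumr -big_split; apply: eq_bigr => j _.
  rewrite !ffunE; have := @tpure_klinear M e0 c (g j) (h j) => /= ->.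
  exact: slot_klinear.
exists (map xi L) => h h0.
have -> : h = xi [ffun j => vtx0_tens (coord h j)].
  rewrite {1}[h]slot_sum; apply: eq_bigr => j _.
  by rewrite ffunE -vtx0_tens_pure slot_vtx.
apply: (in_span_map xi_lin); apply: LP; split=> [j|]; first exact: scale1r.
by rewrite -[RHS]h0; apply: eq_bigr => j _; rewrite ffunE.
Qed.

(** kQ (x) I (x) N is the sum over v and j of the e_v (x) y^j x (x) e_0 N, and
    those with v + j > r vanish because e_v y^j = 0. This matches the
    decomposition of kQ. *)
Lemma tens_ideal_isom_fdim (N : grmod kQ) :
  fin_pres N -> isom_mod (@fdim k kQ) (tens_ideal_hom N).
Proof.
move=> fpN; apply/isom_fdimP.
have [L LP] := decomposition_ker (@Qidem_idem k r S) (@Qgen_idem k r S) (@Qspan k r S) (@Qfree k r S) fpN.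
have [l lP] := decomposition_coker (@Qidem_idem k r S) (@Qgen_idem k r S) (@Qspan k r S) fpN.
pose xi (h : {ffun 'I_r.+1 * 'I_r.+1 -> kspace N}) : kspace (tens_mod f (ideal_mod N)) :=
  \sum_p tpure f (M := ideal_mod N) (e_ p.1) (slot p.2 (h p)).
have mult h : tens_ideal_hom N (xi h) = \sum_p Qgen S p *: (h p : N).
  rewrite linear_sum; apply: eq_bigr => p _.
  by rewrite tens_ideal_homE ideal_mult_slot scalerA /Qgen mulrA.
split; last first.
  exists l => n; have [h [_ hE]] := lP n; exists (xi [ffun p => h p]).
  by rewrite mult; under eq_bigr do rewrite ffunE.
have xi_lin : linear xi.
  move=> c g h; rewrite scaler_sumr -big_split; apply: eq_bigr => p _.
  rewrite !ffunE slot_klinear; exact: tpure_klinear.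
exists (map xi L) => t t0.
have [h tE] := tens_vtx_sum t.
pose n : {ffun 'I_r.+1 * 'I_r.+1 -> kspace N} :=
  [ffun p => Qidem S p *: coord (h p.1) p.2].
pose F v j : tens f (ideal_mod N) :=
  tpure f (M := ideal_mod N) (e_ v) (slot j (Qidem S (v, j) *: coord (h v) j)).
have xin : t = xi n.
  transitivity (\sum_p F p.1 p.2); last by apply: eq_bigr => [[v j] _]; rewrite ffunE.
  rewrite tE -(pair_bigA _ F) /=.
  apply: eq_bigr => v _; rewrite {1}[h v]slot_sum tpure_sumr; apply: eq_bigr => j _.
  rewrite /F /Qidem /=; case: ltnP => [_|vj]; first by rewrite slot_vtx.
  by rewrite scale0r slot0 tpure0r -y_exp_slot tpure_vtx_y.
rewrite xin; apply: (in_span_map xi_lin); apply: LP; split=> [p|].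
  by rewrite ffunE scalerA Qidem_idem.
by rewrite -mult -xin t0.
Qed.

Definition tens_gr : functor (gr B) (gr kQ) :=
  restrict_functor (F := tens_functor f) (@tens_fin_pres k B kQ f).

Definition ideal_gr : functor (gr kQ) (gr B) :=
  restrict_functor (F := ideal_functor S) (@ideal_fin_pres k r S).

Lemma tens_gr_Sigma (M N : gr B) (s : hom M N) :
  Sigma_fdim s -> Sigma_fdim (fmap tens_gr s).
Proof. exact: tens_isom_fdim. Qed.

Lemma ideal_gr_Sigma (M N : gr kQ) (s : hom M N) :
  Sigma_fdim s -> Sigma_fdim (fmap ideal_gr s).
Proof. exact: ideal_isom_fdim. Qed.

Definition qgr_tens : functor (qgr B) (qgr kQ) := loc_map tens_gr_Sigma.

Theorem qgr_tens_equivalence : is_equivalence qgr_tens.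
Proof.
apply: (loc_map_equivalence _ ideal_gr_Sigma).
- apply: (nat_iso_inverted (F := comp_functor ideal_gr tens_gr) (F' := id_functor _)
    (th := fun M : gr B => ideal_tens_hom (sval M))).
    by move=> M; exact: ideal_tens_isom_fdim (svalP M).
  by move=> M N s h; exact: ideal_tens_natural.
- apply: (nat_iso_inverted (F := comp_functor tens_gr ideal_gr) (F' := id_functor _)
    (th := fun N : gr kQ => tens_ideal_hom (sval N))).
    by move=> N; exact: tens_ideal_isom_fdim (svalP N).
  by move=> M N s t; exact: tens_ideal_natural.
Qed.

Lemma qgr_tens_incl :
  nat_iso (comp_functor (qgr_incl kQ) qgr_tens) (comp_functor (QGr_tens S) (qgr_incl B)).
Proof.
apply: loc_map_square; exact: restrict_functor_incl.
Qed.

End SmallQuotients.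

(** * Shifts and structure sheaves *)

Section ShiftAndUnit.
Variables (k : fieldType) (B D : gralg k) (f : gralg_hom B D).

Lemma grhom_iso (A : gralg k) (M N : grmod A) (g : grhom M N) (h : N -> M) :
  cancel g h -> cancel h g -> @is_iso (Gr A) M N g.
Proof.
move=> gK hK.
have h_lin : linear h.
  by move=> a u v; apply: (can_inj gK); rewrite linearP !hK.
pose R := GRing.isLinear.Build A N M *:%R h h_lin.
pose hL : {linear N -> M} := HB.pack h R.
have h_deg i n : homog (mgr N) i n -> homog (mgr M) i (hL n).
  by move=> hn; apply: (can_inj gK); rewrite -grhom_part [g (hL n)]hK.
by exists (GrHom h_deg).
Qed.

Lemma isomorphic_QGr (A : gralg k) (M N : grmod A) :
  @isomorphic (Gr A) M N -> isomorphic (QGr_quo A M) (QGr_quo A N).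
Proof. by move=> [s s_iso]; exists (fmap (QGr_quo A) s); exact: fmap_iso. Qed.

(** The two modules differ in their gradings only. *)
Lemma tens_shift_iso (M : grmod B) :
  @isomorphic (Gr D) (tens_mod f (shift_mod M)) (shift_mod (tens_mod f M)).
Proof.
have [g gE] : exists g : grhom (tens_mod f (shift_mod M)) (shift_mod (tens_mod f M)),
    forall d m, g (tpure f (M := shift_mod M) d m) = tpure f (M := M) d m.
  apply: (@tens_ghom _ _ _ f (shift_mod M) (shift_mod (tens_mod f M))
    (fun d m => tpure f (M := M) d m)) => [d d' m|d m m'|d b m|a d m|i j d m hd hm].
  - exact: tpureDl.
  - exact: tpureDr.
  - exact: tpure_bal.
  - exact/esym/tpureZ.
  - rewrite /homog /= (tens_part_homog f (i + j + 1) hd (hm : homog (mgr M) (j + 1) m)).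
    by rewrite addrA eqxx.
pose h (t : tens f M) : tens f (shift_mod M) :=
  tens_lift (M := M) (fun d m => tpure f (M := shift_mod M) d m) t.
have hB : {morph h : x y / x - y}.
  by apply: tens_liftB => *; [exact: tpureDl | exact: tpureDr | exact: tpure_bal].
have hE d m : h (tpure f d m) = tpure f (M := shift_mod M) d m.
  by apply: tens_liftE => *; [exact: tpureDl | exact: tpureDr | exact: tpure_bal].
exists g; refine (@grhom_iso D (tens_mod f (shift_mod M)) (shift_mod (tens_mod f M)) g h _ _) => t.
- elim/tens_ind: t => [|x y hx hy|d m]; first by rewrite linear0 (morphB0 hB).
    by rewrite linearB hB hx hy.
  by rewrite gE hE.
- elim/tens_ind: t => [|x y hx hy|d m]; first by rewrite (morphB0 hB) linear0.
    by rewrite hB linearB hx hy.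
  by rewrite hE gE.
Qed.

Lemma tens_regular_iso :
  @isomorphic (Gr D) (tens_mod f (regular_mod B)) (regular_mod D).
Proof.
have [g gE] : exists g : grhom (tens_mod f (regular_mod B)) (regular_mod D),
    forall d b, g (tpure f (M := regular_mod B) d b) = d * f b.
  apply: (@tens_ghom _ _ _ f (regular_mod B) (regular_mod D) (fun d b => d * f b))
    => [d d' b|d b b'|d b b'|a d b|i j d b hd hb].
  - exact: mulrDl.
  - by rewrite ahomD mulrDr.
  - by rewrite -mulrA -ahomM.
  - by rewrite -mulrA.
  - exact: (agr_mul hd (ahom_deg f hb)).
pose h (d : D) : tens f (regular_mod B) := tpure f (M := regular_mod B) d (1 : B).
exists g; refine (@grhom_iso D (tens_mod f (regular_mod B)) (regular_mod D) g h _ _) => t.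
- elim/tens_ind: t => [|x y hx hy|d b]; first by rewrite linear0 /h tpure0l.
    rewrite linearB /h -{2}hx -{2}hy; apply/eqP; rewrite eq_sym subr_eq -tpureDl.
    by rewrite subrK.
  by rewrite gE /h tpure_bal; congr tpure; exact: mulr1.
- by rewrite /h gE ahom1 mulr1.
Qed.

End ShiftAndUnit.

(** * The theorem *)

(** The algebras and the homomorphism are one variable here, so that an equation
    between such tuples can be rewritten. *)
Definition tensor_equivalence (k : fieldType)
    (x : {BD : gralg k * gralg k & gralg_hom BD.1 BD.2}) : Prop :=
  let B := (projT1 x).1 in let D := (projT1 x).2 in
  exists F : functor (QGr B) (QGr D),
    nat_iso (comp_functor F (QGr_quo B))
            (comp_functor (QGr_quo D) (tens_functor (projT2 x))) /\
    is_equivalence F /\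
    ((exists F' : functor (qgr B) (qgr D),
        is_equivalence F' /\
        nat_iso (comp_functor (qgr_incl D) F') (comp_functor F (qgr_incl B))) /\
     (exists F' : functor (full_sub (@fp_object (QGr B))) (full_sub (@fp_object (QGr D))),
        is_equivalence F' /\
        nat_iso (comp_functor (full_incl (@fp_object (QGr D))) F')
                (comp_functor F (full_incl (@fp_object (QGr B)))))) /\
    (forall X : QGr B, isomorphic (F (QGr_shift B X)) (QGr_shift D (F X))) /\
    isomorphic (F (QGr_O B)) (QGr_O D).

Lemma setting_tensor_equivalence (k : fieldType) (r : nat) (S : path_setting k r) :
  tensor_equivalence (existT (fun BD : gralg k * gralg k => gralg_hom BD.1 BD.2)
    (algB_of S, algQ_of S) (fhom S)).
Proof.
exists (QGr_tens S); split; first exact: loc_map_functor.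
split; first exact: QGr_tens_equivalence.
split; first split.
- by exists (qgr_tens S); split; [exact: qgr_tens_equivalence | exact: qgr_tens_incl].
- exact/equiv_restrict_fp/QGr_tens_equivalence.
split=> [X|].
- exact: (isomorphic_QGr (tens_shift_iso (fhom S) X)).
- exact: (isomorphic_QGr (tens_regular_iso (fhom S))).
Qed.

Theorem theorem7p6 (k : fieldType) (r : nat) (hr : (1 <= r)%N) :
  exists F : functor (QGr (grB k r)) (QGr (gr_kQ k r)),
    nat_iso (comp_functor F (QGr_quo (grB k r)))
            (comp_functor (QGr_quo (gr_kQ k r)) (tens_functor (f_hom k r))) /\
    is_equivalence F /\
    ((exists F' : functor (qgr (grB k r)) (qgr (gr_kQ k r)),
        is_equivalence F' /\
        nat_iso (comp_functor (qgr_incl (gr_kQ k r)) F')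
                (comp_functor F (qgr_incl (grB k r)))) /\
     (exists F' : functor (full_sub (@fp_object (QGr (grB k r))))
                          (full_sub (@fp_object (QGr (gr_kQ k r)))),
        is_equivalence F' /\
        nat_iso (comp_functor (full_incl (@fp_object (QGr (gr_kQ k r)))) F')
                (comp_functor F (full_incl (@fp_object (QGr (grB k r))))))) /\
    (forall X : QGr (grB k r),
        isomorphic (F (QGr_shift (grB k r) X)) (QGr_shift (gr_kQ k r) (F X))) /\
    isomorphic (F (QGr_O (grB k r))) (QGr_O (gr_kQ k r)).
Proof.
have [S E] := std_setting k r.
by have := setting_tensor_equivalence S; rewrite E.
Qed.
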